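(* Let $r\ge 3$ be an integer and let $\ell\ge 2^r+1$ be odd. Then $p(n;r,C_\ell,d)=n^{-1+1/(\ell-1)}$ for $0\le d\le 1-2^{-r+2}$; $n^{-1}\le p(n;r,C_\ell,d)\le n^{-1+1/(\ell-1)}$ for $1-2^{-r+2}<d\le 1-2^{-r+1}$; $p(n;r,C_\ell,d)=n^{-2}$ for $1-2^{-r+1}<d\le 1-2^{-r}$; and $p(n;r,C_\ell,d)=0$ for $1-2^{-r}<d\le 1$.
   Context: $C_\ell$ is the cycle of length $\ell$. A graph $G$ is $(H,r)$-Ramsey if every colouring of the edges of $G$ with $r$ colours contains a monochromatic copy of $H$. The density of an $n$-vertex graph $G$ is $e(G)/\binom n2$. $G(n,p)$ is the binomial random graph on $[n]$ and $G_n\cup G(n,p)$ the union graph on $[n]$. The perturbed Ramsey threshold $p(n;r,H,d)$ is a function such that: (i) if $p=\omega(p(n;r,H,d))$ then for every sequence $(G_n)$ of $n$-vertex graphs of density at least $d$, $G_n\cup G(n,p)$ is $(H,r)$-Ramsey with high probability; (ii) if $p=o(p(n;r,H,d))$ then for some sequence $(G_n)$ of $n$-vertex graphs of density at least $d$, with high probability $G_n\cup G(n,p)$ is not $(H,r)$-Ramsey. If every sufficiently large graph of density at least $d$ is $(H,r)$-Ramsey, the threshold is $0$. An upper bound $p(n;\cdot)\le f$ means that $p=\omega(f)$ yields (i); a lower bound $p(n;\cdot)\ge g$ means $p=o(g)$ yields (ii). *)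

(* Defs.v *)
From HB Require Import structures.
From mathcomp Require Import all_boot all_order all_algebra.
From mathcomp Require Import all_classical all_reals all_analysis.
Set Implicit Arguments. Unset Strict Implicit. Unset Printing Implicit Defensive.
Import Order.TTheory GRing.Theory Num.Theory.
Import numFieldNormedType.Exports.
Local Open Scope ring_scope.

Definition pairs (n : nat) : {set {set 'I_n}} := [set e : {set 'I_n} | #|e| == 2%N].

Definition is_graph (n : nat) (G : {set {set 'I_n}}) : bool := G \subset pairs n.

Definition density (R : realType) (n : nat) (G : {set {set 'I_n}}) : R :=
  (#|G|%:R) / ('C(n, 2)%:R).

Definition mono_cycle (n r l : nat) (G : {set {set 'I_n}})
  (c : {ffun {set 'I_n} -> 'I_r}) : bool :=
  [exists v : {ffun 'I_l -> 'I_n}, exists k : 'I_r,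
     injectiveb v &&
     [forall i : 'I_l, ([set v i; v (ordS i)] \in G) &&
                       (c [set v i; v (ordS i)] == k)]].

(* G is (C_l, r)-Ramsey: every r-colouring of the edges of G has a
   monochromatic copy of C_l (colourings are given on all 2-sets; only the
   values on edges of G matter). *)
Definition ramsey_cycle (n r l : nat) (G : {set {set 'I_n}}) : bool :=
  [forall c : {ffun {set 'I_n} -> 'I_r}, mono_cycle l G c].

(* Probability that G ∪ G(n,p) is (C_l,r)-Ramsey: G(n,p) takes the value H
   (a graph on [n]) with probability p^{e(H)} (1-p)^{binom(n,2) - e(H)}. *)
Definition prob_ramsey_union (R : realType) (n r l : nat) (p : R)
  (G : {set {set 'I_n}}) : R :=
  \sum_(H : {set {set 'I_n}} | H \subset pairs n)
     (if ramsey_cycle r l (G :|: H)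
      then p ^+ #|H| * (1 - p) ^+ (#|pairs n| - #|H|) else 0).

Local Open Scope classical_set_scope.
Local Open Scope ring_scope.

Definition prob_seq (R : realType) (p : nat -> R) : Prop :=
  forall n, 0 <= p n <= 1.

Definition dense_seq (R : realType) (d : R) (G : forall n, {set {set 'I_n}}) : Prop :=
  (forall n, is_graph (G n)) /\ (\forall n \near \oo, d <= density R (G n)).

Definition omega_seq (R : realType) (p f : nat -> R) : Prop :=
  (fun n => p n / f n) @ \oo --> +oo.
Definition little_o_seq (R : realType) (p f : nat -> R) : Prop :=
  (fun n => p n / f n) @ \oo --> (0 : R).

Definition upper_bound (R : realType) (r l : nat) (d : R) (f : nat -> R) : Prop :=
  forall p : nat -> R, prob_seq p -> omega_seq p f ->
  forall G : forall n, {set {set 'I_n}}, dense_seq d G ->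
    (fun n => prob_ramsey_union r l (p n) (G n)) @ \oo --> (1 : R).

Definition lower_bound (R : realType) (r l : nat) (d : R) (g : nat -> R) : Prop :=
  forall p : nat -> R, prob_seq p -> little_o_seq p g ->
  exists G : forall n, {set {set 'I_n}}, dense_seq d G /\
    (fun n => 1 - prob_ramsey_union r l (p n) (G n)) @ \oo --> (1 : R).

Definition is_threshold (R : realType) (r l : nat) (d : R) (f : nat -> R) : Prop :=
  upper_bound r l d f /\ lower_bound r l d f.

Definition zero_threshold (R : realType) (r l : nat) (d : R) : Prop :=
  exists N : nat, forall n, (N <= n)%N -> forall G : {set {set 'I_n}},
    is_graph G -> d <= density R G -> ramsey_cycle r l G.

Definition npow (R : realType) (a : R) : nat -> R := fun n => (n%:R) `^ a.

(* Main.v *)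
(* Lower bounds. A Turan graph with 2^k parts is a union of k bipartite graphs, so k colours
   handle it without a monochromatic odd cycle and G(n,p) has to be coloured with the remaining
   r - k: none (G(n,p) is empty), one (it has no C_l), or two. For two colours, in a minimal Ramsey
   subgraph every edge is the only common edge of two of its l-cycles. Adding such cycles one by
   one, starting from an edge, either goes on for about log n steps or stops at a small subgraph of
   minimum degree 3, hence with at least 3/2 times as many edges as vertices; the expected numbers
   of outcomes of both kinds tend to 0.

   Upper bounds. A colouring of the edges of K_m with m > 2^r has a monochromatic odd cycle, and
   in a blow-up of K_m it can be lengthened to C_l because l >= 2^r + 1. A graph of density above
   1 - 1/q contains blow-ups of K_(q+1). For q = 2^r this suffices. For q = 2^(r-1), the second
   moment method places a few random edges inside the parts of one of the many blow-ups. At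
   p = omega(n^(-1 + 1/(l-1))) the random graph alone is Ramsey: the C_l-free colour classes lie in
   containers with few cycles, determined by fingerprints of O(n^(1 + 1/(l-1))) edges; by
   supersaturation, r such containers miss a positive proportion of the pairs, and the union bound
   over the fingerprints applies. *)
Require Import Defs.
From HB Require Import structures.
From mathcomp Require Import all_boot all_order all_algebra.
From mathcomp Require Import all_classical all_reals all_analysis.
From mathcomp Require Import zify ring lra.
From mathcomp Require Import fintype finset.
Import Order.TTheory GRing.Theory Num.Theory.
Import numFieldNormedType.Exports.
Local Open Scope ring_scope.
Set Implicit Arguments.
Unset Strict Implicit.
Unset Printing Implicit Defensive.

(** * Means over tuples and blow-ups *)

Section PowerMean.
Variable R : realFieldType.

(** One tool serves all dense cases: a predicate true for a positive proportion of m-tuples is true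
    throughout a positive proportion of m-tuples of rows. Applied to cliques it yields the blow-ups.
    Applied to the choice of one copy index per part it makes the colour and the vertex sequence of
    a monochromatic cycle independent of that choice, and this freedom is what lets the cycle zigzag
    along one of its edges. The containers of a cycle-free F come from growing F-paths through the
    classes of an l-partition. At level j a set of pairs (x, a) records F-paths from x to a with j
    edges; its degrees are kept at about d^j, where d^(l-1) is of order n. If the growth reaches
    level l - 1, about n^2 pairs would close a cycle and cannot be in F. If it stalls, many pairs of
    the current container would have continued it and are therefore not in F. Either way a positive
    proportion of all pairs leaves the container. A chosen edge contributes about d^j n^k to a
    weight of at most n d^(j+1) n^k, so a level costs O(n d) edges, which is the source of the
    exponent 1 + 1/(l-1). *)

Lemma exprn_tangent (x m : R) (t : nat) : 0 <= x -> 0 <= m ->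
  m ^+ t + t%:R * m ^+ t.-1 * (x - m) <= x ^+ t.
Proof.
move=> x0 m0; elim: t => [|t IH]; first by rewrite !mul0r addr0.
rewrite [x ^+ _]exprS; apply: le_trans (ler_wpM2l x0 IH).
case: t {IH} => [|t] /=.
  by rewrite le_eqVlt; apply/orP; left; apply/eqP; ring.
rewrite -subr_ge0.
have -> : x * (m ^+ t.+1 + t.+1%:R * m ^+ t * (x - m)) -
   (m ^+ t.+2 + t.+2%:R * m ^+ t.+1 * (x - m)) =
   t.+1%:R * m ^+ t * (x - m) ^+ 2.
  by rewrite !exprS !mulrS; ring.
by rewrite mulr_ge0 ?sqr_ge0// mulr_ge0// exprn_ge0.
Qed.

(** Jensen for x^t: the tangents at the mean are summed and their linear parts cancel. *)
Lemma power_mean (T : finType) (f : T -> R) (t : nat) : (0 < #|T|)%N ->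
  (forall x, 0 <= f x) ->
  ((\sum_x f x) / #|T|%:R) ^+ t <= (\sum_x f x ^+ t) / #|T|%:R.
Proof.
move=> T0 f0; set m := _ / _.
have T0' : 0 < #|T|%:R :> R by rewrite ltr0n.
have m0 : 0 <= m by rewrite divr_ge0 ?sumr_ge0// ltW.
rewrite ler_pdivlMr//.
have <- : \sum_x (m ^+ t + t%:R * m ^+ t.-1 * (f x - m)) = m ^+ t * #|T|%:R.
  rewrite big_split/= -mulr_sumr sumrB !sumr_const.
  have -> : \sum_x f x = m * #|T|%:R by rewrite divfK// gt_eqF.
  by rewrite -[m ^+ t *+ _]mulr_natr -[m *+ _]mulr_natr subrr mulr0 addr0.
by apply: ler_sum => x _; apply: exprn_tangent.
Qed.

(** The points where f is below d/2 contribute at most d/2 to the mean, so the others, where f is at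
    most 1, carry the rest. *)
Lemma mean_markov (T : finType) (f : T -> R) (d : R) : (0 < #|T|)%N ->
  (forall x, f x <= 1) -> d <= (\sum_x f x) / #|T|%:R -> 0 <= d ->
  d / 2 <= #|[pred x | d / 2 <= f x]|%:R / #|T|%:R.
Proof.
move=> T0 f1 dm d0.
have T0' : 0 < #|T|%:R :> R by rewrite ltr0n.
rewrite ler_pdivlMr//; move: dm; rewrite ler_pdivlMr// => dm.
suff H : \sum_x f x <= #|[pred x | d / 2 <= f x]|%:R + d / 2 * #|T|%:R.
  have : d = d / 2 + d / 2 by lra.
  move=> E; rewrite {1}E mulrDl in dm; lra.
have -> : #|[pred x | d / 2 <= f x]|%:R + d / 2 * #|T|%:R =
  \sum_x ((if d / 2 <= f x then 1 else 0) + d / 2).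
  rewrite big_split/= sumr_const -big_mkcond/= sumr_const -[d / 2 *+ _]mulr_natr.
  by [].
apply: ler_sum => x _; case: ifP => [_|/negbT]; rewrite ?add0r -?ltNge; last exact: ltW.
by rewrite (le_trans (f1 x))// lerDl divr_ge0.
Qed.
End PowerMean.

Lemma big_tupleS (V : finType) (R : nmodType) (k : nat) (F : seq V -> R) :
  \sum_(t : k.+1.-tuple V) F t = \sum_a \sum_(t : k.-tuple V) F (a :: t).
Proof.
rewrite pair_big/= (reindex (fun p : V * k.-tuple V => [tuple of p.1 :: p.2])) //=.
exists (fun t => (thead t, [tuple of behead t])) => [[a t] _|t _] /=.
  by congr (_, _); apply: val_inj.
by rewrite [RHS]tuple_eta; apply: val_inj.
Qed.

Lemma big_tuple0 (V : finType) (R : nmodType) (F : seq V -> R) :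
  \sum_(t : 0.-tuple V) F t = F [::].
Proof. by rewrite (big_pred1 [tuple]) // => t; rewrite [t]tuple0 /= eqxx. Qed.

Section Mean.
Variables (R : realFieldType) (V : finType).
Implicit Types (F : seq V -> R) (P : pred (seq V)).

(** F is defined on all sequences rather than on k-tuples, so that splitting off a coordinate and
    induction on k need no casts. *)
Definition mean k F : R := (\sum_(t : k.-tuple V) F t) / (#|V| ^ k)%:R.

Lemma mean0 F : mean 0 F = F [::].
Proof. by rewrite /mean big_tuple0 expn0 divr1. Qed.

Lemma meanS k F : mean k.+1 F = (\sum_a mean k (fun s => F (a :: s))) / #|V|%:R.
Proof.
rewrite /mean big_tupleS expnS natrM invfM mulrCA mulrC; congr (_ / _).
by rewrite mulr_suml.
Qed.

Lemma eq_mean k F G : (forall s, size s = k -> F s = G s) -> mean k F = mean k G.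
Proof. by move=> FG; congr (_ / _); apply: eq_bigr => t _; rewrite FG ?size_tuple. Qed.

Lemma le_mean k F G : (forall s, size s = k -> F s <= G s) -> mean k F <= mean k G.
Proof.
move=> FG; rewrite ler_wpM2r ?invr_ge0//.
by apply: ler_sum => t _; rewrite FG ?size_tuple.
Qed.

Lemma mean_ge0 k F : (forall s, 0 <= F s) -> 0 <= mean k F.
Proof. by move=> F0; rewrite divr_ge0// sumr_ge0. Qed.

Lemma mean_sum k (I : Type) (r : seq I) (Q : pred I) (G : I -> seq V -> R) :
  mean k (fun s => \sum_(i <- r | Q i) G i s) = \sum_(i <- r | Q i) mean k (G i).
Proof. by rewrite /mean exchange_big/= mulr_suml. Qed.

Lemma mean_scale k F (c : R) : mean k (fun s => F s * c) = mean k F * c.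
Proof. by rewrite /mean -mulr_suml mulrAC. Qed.

Lemma mean_cst k (c : R) : (0 < #|V|)%N -> mean k (fun=> c) = c.
Proof.
move=> V0; rewrite /mean sumr_const card_tuple -[c *+ _]mulr_natr mulfK//.
by rewrite pnatr_eq0 expn_eq0 negb_and -lt0n V0.
Qed.

Lemma mean_jensen k F t : (0 < #|V|)%N -> (forall s, 0 <= F s) ->
  mean k F ^+ t <= mean k (fun s => F s ^+ t).
Proof.
move=> V0 F0; have := @power_mean R (k.-tuple V) (fun x => F x) t.
by rewrite card_tuple; apply=> //; rewrite expn_gt0 V0.
Qed.

Lemma mean_prod t (f : V -> R) :
  mean t (fun s => \prod_(a <- s) f a) = ((\sum_a f a) / #|V|%:R) ^+ t.
Proof.
elim: t => [|t IH]; first by rewrite mean0 big_nil.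
rewrite meanS exprS -IH [RHS]mulrAC; congr (_ / _); rewrite mulr_suml.
by apply: eq_bigr => a _; rewrite mulrC -mean_scale; apply: eq_mean => s _; rewrite big_cons mulrC.
Qed.

Lemma mean_exchange k j (F : seq V -> seq V -> R) :
  mean k (fun s => mean j (F s)) = mean j (fun u => mean k (fun s => F s u)).
Proof.
rewrite /mean -!mulr_suml mulrAC exchange_big; congr (_ / _); congr (_ / _).
Qed.

Lemma mean_non_uniq k : (0 < #|V|)%N ->
  mean k (fun s => (~~ uniq s)%:R) <= (k ^ 2)%:R / #|V|%:R.
Proof.
move=> V0; have V0' : 0 < #|V|%:R :> R by rewrite ltr0n.
elim: k => [|k IH]; first by rewrite mean0 mul0r.
rewrite meanS ler_pM2r ?invr_gt0//.
have H a : mean k (fun s => (~~ uniq (a :: s))%:R) <=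
  mean k (fun s => (a \in s)%:R) + mean k (fun s => (~~ uniq s)%:R).
  rewrite /mean -mulrDl -big_split/= ler_wpM2r ?invr_ge0//.
  by apply: ler_sum => t _; case: (a \in t); case: (uniq t); rewrite /= ?addr0 ?add0r ?lerDl.
apply: le_trans; first by apply: ler_sum => a _; exact: H.
rewrite big_split/= -mean_sum sumr_const.
have H1 : mean k (fun s => \sum_a (a \in s)%:R) <= k%:R.
  rewrite -[leRHS](mean_cst k _ V0); apply: le_mean => s <-.
  rewrite -natr_sum ler_nat -big_mkcond/= sum1_card; exact: card_size.
have H2 : mean k (fun s => (~~ uniq s)%:R) *+ #|V| <= (k ^ 2)%:R.
  by rewrite -[_ *+ _]mulr_natr -ler_pdivlMr.
apply: le_trans (lerD H1 H2) _; rewrite -natrD ler_nat; nia.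
Qed.

End Mean.

(* [blown rows P]: every choice of one entry from each row satisfies P. *)
Fixpoint blown (V : eqType) (rows : seq (seq V)) (P : pred (seq V)) : bool :=
  if rows is row :: rows' then blown rows' (fun s => all (fun a => P (a :: s)) row)
  else P [::].

Lemma blownP (V : eqType) (rows : seq (seq V)) (P : pred (seq V)) (s : seq V) :
  blown rows P -> all2 (fun a (row : seq V) => a \in row) s rows -> P s.
Proof.
elim: rows s P => [|row rows IH] [|a s] P //= B /andP[ar sr].
by have /allP := IH s _ B sr; apply.
Qed.

(** The counting form of the theorem of Erdos on complete m-partite blocks in dense m-uniform
    hypergraphs. One coordinate at a time is replaced by a row of t entries; by convexity the mean
    of the t-th power of a proportion is at least the t-th power of its mean. *)
Lemma blowup_density (R : realType) (m t : nat) (d : R) : 0 < d ->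
  exists2 e : R, 0 < e & exists N : nat,
  forall (V : finType) (P : pred (seq V)), (N <= #|V|)%N ->
  d <= mean m (fun s => (P s)%:R) ->
  e <= mean m (fun rows : seq (t.-tuple V) =>
    (all (fun row : t.-tuple V => uniq row) rows && blown (map val rows) P)%:R).
Proof.
elim: m d => [|m IH] d d0.
  by exists d => //; exists 0%N => V P _; rewrite !mean0.
have dt0 : 0 < d ^+ t by rewrite exprn_gt0.
(* Rows with repetitions cost at most a quarter of d^t. Rows that reach half of the remaining 3/4
   d^t make up a proportion of at least 3/8 d^t, and the induction hypothesis applies to each of
   them. *)
have e0 : 0 < 3 / 4 * d ^+ t / 2 by rewrite divr_gt0// mulr_gt0.
have [e e_gt0 [N HN]] := IH _ e0.
exists (d ^+ t / 4 * e); first by rewrite mulr_gt0// divr_gt0.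
pose M := Num.bound ((t ^ 2)%:R / (d ^+ t / 4)).
have HM : (t ^ 2)%:R / (d ^+ t / 4) < M%:R by apply: archi_boundP; rewrite divr_ge0// divr_ge0// ltW.
exists (maxn N.+1 M.+1) => V P; rewrite geq_max => /andP[NV MV] dP.
have V0 : (0 < #|V|)%N by apply: leq_ltn_trans NV.
have V0' : 0 < #|V|%:R :> R by rewrite ltr0n.
have degU : (t ^ 2)%:R / #|V|%:R <= d ^+ t / 4.
  rewrite ler_pdivrMr// mulrC -ler_pdivrMr ?divr_gt0// ltW// (lt_trans HM)//.
  by rewrite ltr_nat.
pose Q (row : seq V) (s : seq V) := all (fun a => P (a :: s)) row.
have HQ : d ^+ t <= mean t (fun row => mean m (fun s => (Q row s)%:R)).
  have M0 : 0 <= mean m.+1 (fun s => (P s)%:R) :> R by apply: mean_ge0.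
  apply: le_trans (lerXn2r t _ M0 dP) _; first by rewrite nnegrE ltW.
  have -> : mean m.+1 (fun s => (P s)%:R) =
    mean m (fun s => (\sum_a (P (a :: s))%:R) / #|V|%:R) :> R.
    by rewrite meanS mean_scale mean_sum.
  apply: le_trans (mean_jensen _ _ V0 _) _ => [s|].
    by rewrite divr_ge0 ?sumr_ge0.
  rewrite mean_exchange le_eqVlt; apply/orP; left; apply/eqP; apply: eq_mean => s _.
  rewrite -mean_prod; apply: eq_mean => row _; rewrite /Q.
  by elim: row => [|a row IHr]; rewrite ?big_nil// big_cons IHr /= -natrM mulnb.
pose f (row : t.-tuple V) : R := (uniq row)%:R * mean m (fun s => (Q row s)%:R).
have meanle1 row : mean m (fun s => (Q row s)%:R) <= 1 :> R.
  by rewrite -[leRHS](mean_cst m 1 V0); apply: le_mean => s _; case: (Q _ _).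
have f1 row : f row <= 1 by rewrite /f; case: uniq; rewrite ?mul1r ?mul0r.
have T0 : (0 < #|{: t.-tuple V}|)%N by rewrite card_tuple expn_gt0 V0.
have Hf : 3 / 4 * d ^+ t <= (\sum_row f row) / #|{: t.-tuple V}|%:R.
  have := mean_non_uniq R t V0 => U.
  suff : mean t (fun row => mean m (fun s => (Q row s)%:R)) <=
    (\sum_row f row) / #|{: t.-tuple V}|%:R + mean t (fun s : seq V => (~~ uniq s)%:R) :> R.
    lra.
  rewrite card_tuple /mean -mulrDl ler_wpM2r ?invr_ge0// -big_split/=.
  apply: ler_sum => row _; rewrite /f; case: (uniq row); rewrite ?mul1r ?addr0//.
  by rewrite mul0r add0r; apply: meanle1.
have T0' : 0 < #|{: t.-tuple V}|%:R :> R by rewrite ltr0n.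
rewrite meanS ler_pdivlMr//.
have Hc := mean_markov T0 f1 Hf ltac:(lra); move: Hc.
rewrite ler_pdivlMr// => Hc.
suff step : e * #|[pred x | 3 / 4 * d ^+ t / 2 <= f x]|%:R <=
  \sum_a mean m (fun s => (all (fun row0 : t.-tuple V => uniq row0) (a :: s) &&
     blown (map val (a :: s)) P)%:R) :> R.
  apply: le_trans step; rewrite mulrAC mulrC; apply: ler_wpM2l; first exact: ltW.
  apply: le_trans Hc; rewrite ler_wpM2r ?ltW//; lra.
rewrite -sum1_card natr_sum mulr_sumr big_mkcond/=; apply: ler_sum => row _.
case: ifP => [|_]; last by apply: mean_ge0.
rewrite inE /f mulr1; case: (boolP (uniq row)) => [Ur|_]; last first.
  by rewrite mul0r => H; exfalso; move: H; rewrite leNgt; lra.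
rewrite mul1r => H; have NV' : (N <= #|V|)%N by apply: ltnW.
apply: le_trans (HN V (Q row) NV' H) _.
by apply: le_mean => s _.
Qed.

(** * Monochromatic odd cycles in blow-ups *)

Section OddCycle.
Variables (Z : finType) (e : rel Z).
Hypothesis sym_e : symmetric e.

Lemma non_uniq_split (T : eqType) (c : seq T) : ~~ uniq c ->
  exists x c1 c2 c3, c = c1 ++ x :: c2 ++ x :: c3.
Proof.
elim: c => [|a c IH] //=; rewrite negb_and negbK; case: (boolP (a \in c)) => [ac _|_ /= /IH].
  by case/splitPr: ac => c2 c3; exists a, [::], c2, c3.
by move=> [x [c1 [c2 [c3 ->]]]]; exists x, (a :: c1), c2, c3.
Qed.

(** A closed walk that visits x twice splits at x into two shorter closed walks, one of which has
    odd length. *)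
Lemma odd_cycle_uniq (c : seq Z) : cycle e c -> odd (size c) ->
  exists p, [/\ uniq p, cycle e p & odd (size p)].
Proof.
have [n] := ubnP (size c); elim: n c => // n IH c; rewrite ltnS => cn cc oc.
case: (boolP (uniq c)) => [uc|/non_uniq_split [x [c1 [c2 [c3 E]]]]]; first by exists c.
have cc' : cycle e (x :: c2 ++ x :: c3 ++ c1).
  move: cc; rewrite -(rot_cycle (size c1)) E rot_size_cat /= -catA //.
have sc : size c = (size c2 + size c3 + size c1).+2.
  by rewrite E !size_cat /= !size_cat /=; lia.
move: cc'; rewrite /= rcons_cat cat_path /= => /andP[p1 /andP[p2 p3]].
have o : odd (size (x :: c2)) || odd (size (x :: c3 ++ c1)).
  by move: oc; rewrite sc /= size_cat !oddD; case: odd; case: odd; case: odd.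
case/orP: o => o.
- have s2 : (size (x :: c2) < n)%N by apply: leq_trans cn; rewrite sc /=; lia.
  by apply: (IH _ s2) => //=; rewrite rcons_path p1.
- have s3 : (size (x :: c3 ++ c1) < n)%N by apply: leq_trans cn; rewrite sc /= size_cat; lia.
  by apply: (IH _ s3).
Qed.

(* Connectivity in the bipartite double cover decides between the alternatives. *)
Lemma bipartite_or_odd_cycle :
  (exists f : Z -> bool, forall x y, e x y -> f x != f y) \/
  (exists p, [/\ uniq p, cycle e p & odd (size p)]).
Proof.
pose e2 := [rel u v : Z * bool | e u.1 v.1 && (u.2 != v.2)].
have sym2 : connect_sym e2.
  by apply: sym_connect_sym => u v /=; rewrite sym_e eq_sym.
have sym1 : connect_sym e by apply: sym_connect_sym.
case: (boolP [exists x, connect e2 (x, false) (x, true)]).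
  move=> /existsP[x /connectP[p pp lp]]; right.
  have [c cc oc] : exists2 c, cycle e c & odd (size c).
    have par : forall p u, path e2 u p -> path e u.1 (map fst p) /\
       odd (size p) = (u.2 != (last u p).2).
      elim=> [|v p' IHp] u /=; first by rewrite eqxx.
      move=> /andP[/andP[uv uv2] /IHp[-> ->]]; rewrite uv; split=> //.
      by move: uv2; case: u.2; case: v.2; case: (last v p').2.
    have [p1 p2] := par _ _ pp.
    move: p2; rewrite -lp /= => op.
    have l1 : last x (map fst p) = x by rewrite (last_map fst p (x, false)) -lp.
    case: p pp lp p1 op l1 => [//|v p] _ _; case/lastP: (map fst (v :: p)) (size_map fst (v :: p)) => [|c y] //.
    rewrite size_rcons => sz pth op; rewrite last_rcons => ?; subst y.
    by exists (x :: c); rewrite ?[size _]sz.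
  exact: odd_cycle_uniq oc.
rewrite negb_exists => /forallP H; left.
exists (fun x => connect e2 (fingraph.root e x, false) (x, true)) => x y exy.
have rxy : fingraph.root e x = fingraph.root e y by apply/(fingraph.rootP sym1); apply: connect1.
rewrite -rxy; set z := fingraph.root e x.
have step b : connect e2 (x, b) (y, ~~ b) by apply: connect1; rewrite /= exy; case: b.
have cz : connect e z x by rewrite sym1 connect_root.
have cb : exists b, connect e2 (z, false) (x, b).
  case/connectP: cz => p pp ->; elim/last_ind: p pp => [|p v IHp]; first by exists false; apply: connect0.
  rewrite rcons_path last_rcons => /andP[/IHp[b cb] ev]; exists (~~ b).
  by apply: connect_trans cb _; apply: connect1; rewrite /= ev; case: b.
case E1: (connect e2 (z, false) (x, true)); case E2: (connect e2 (z, false) (y, true)) => //.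
  have := H y; rewrite (connect_trans _ E2) //.
  by rewrite sym2; apply: connect_trans E1 _; apply: step true.
case: cb => -[|] cb; first by rewrite cb in E1.
by rewrite (connect_trans cb (step false)) in E2.
Qed.
End OddCycle.

(** If every colour class were bipartite, the r bipartitions together would separate all points and
    inject Z into a set of size 2^r. *)
Lemma mono_odd_cycle (Z : finType) (r : nat) (col : Z -> Z -> 'I_r) :
  (2 ^ r < #|Z|)%N -> (forall x y, col x y = col y x) ->
  exists k p, [/\ uniq p, odd (size p) & cycle (fun x y => (x != y) && (col x y == k)) p].
Proof.
move=> Zr scol; apply: contrapT => Hno.
have Hk : forall k : 'I_r, exists f : Z -> bool, forall x y,
   (x != y) && (col x y == k) -> f x != f y.
  move=> k; have sk : symmetric (fun x y : Z => (x != y) && (col x y == k)).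
    by move=> x y; rewrite eq_sym scol.
  case: (bipartite_or_odd_cycle sk) => [//|[p [up cp op]]].
  by exfalso; apply: Hno; exists k, p.
have [F HF] := fin_all_exists Hk.
have inj : injective (fun x => [ffun k => F k x]).
  move=> x y E; apply/eqP; apply: contraT => xy.
  have := HF (col x y) x y; rewrite xy eqxx => /(_ isT).
  by have /ffunP/(_ (col x y)) := E; rewrite !ffunE => ->; rewrite eqxx.
have := leq_card _ inj; rewrite card_ffun card_bool card_ord.
by rewrite leqNgt Zr.
Qed.

Lemma mean_pigeonhole (R : realFieldType) (V I : finType) (m : nat) (P : I -> pred (seq V)) :
  (0 < #|V|)%N -> (forall s, size s = m -> exists i, P i s) ->
  exists i, (#|I|%:R)^-1 <= mean m (fun s => (P i s)%:R) :> R.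
Proof.
move=> V0 HP; apply: contrapT => Hno.
have Hlt i : mean m (fun s => (P i s)%:R) < (#|I|%:R)^-1 :> R.
  by rewrite ltNge; apply/negP => H; apply: Hno; exists i.
have I0 : (0 < #|I|)%N.
  have [a _] := card_gt0P V0; have [i _] := HP _ (size_nseq m a).
  by apply/card_gt0P; exists i.
have : 1 <= \sum_i mean m (fun s => (P i s)%:R) :> R.
  rewrite -mean_sum -[leLHS](mean_cst m _ V0); apply: le_mean => s /HP[i Pi].
  by rewrite (bigD1 i) //= Pi lerDl sumr_ge0.
apply/negP; rewrite -ltNge.
have E1 : 1 = \sum_(i : I) (#|I|%:R)^-1 :> R.
  by rewrite sumr_const -[_ *+ _]mulr_natr mulVf // pnatr_eq0 -lt0n.
have [i0 _] := card_gt0P I0.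
rewrite [ltRHS]E1 (bigD1 i0) //= [ltRHS](bigD1 i0) //=; apply: ltr_leD => //.
by apply: ler_sum => i _; apply: ltW.
Qed.

Lemma mean_gt0_ex (R : realFieldType) (V : finType) (m : nat) (P : pred (seq V)) (d : R) :
  0 < d -> d <= mean m (fun s => (P s)%:R) -> exists2 t : m.-tuple V, true & P t.
Proof.
move=> d0 dm; have [t Pt|H] := pickP [pred t : m.-tuple V | P t]; first by exists t.
by move: dm; rewrite /mean big1 ?mul0r ?leNgt ?d0 // => t _; have /= -> := H t.
Qed.

Section Structure.
Variables (r l m : nat) (pt : 'I_(2 ^ r + 1) -> 'I_m).
Hypothesis lbig : (2 ^ r + 1 <= l)%N.
Hypothesis lodd : odd l.
Hypothesis fib2 : forall i j k, pt i = pt j -> pt j = pt k -> [|| i == j, j == k | i == k].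

Let Z := 'I_(2 ^ r + 1).

(** The edge from the last vertex to the first has to join different parts: between parts all copies
    are adjacent, so this is the edge along which the cycle can be lengthened. *)
Definition good_cycle (q : rel Z) (p : seq Z) : bool :=
  [&& uniq p, odd (size p), cycle q p &
      if p is i :: p' then pt i != pt (last i p') else false].

Lemma good_cycle_ex (col : Z -> Z -> 'I_r) : (forall x y, col x y = col y x) ->
  exists k p, good_cycle (fun x y => (x != y) && (col x y == k)) p.
Proof.
move=> scol; have [|k [p [up op cp]]] := @mono_odd_cycle Z r col _ scol.
  by rewrite card_ord addn1.
exists k; set q := fun x y => _ in cp *.
have p3 : (2 < size p)%N.
  case: p up op cp => [|a [|b [|c p]]] //= _ _; rewrite /q eqxx //.
(* Otherwise three consecutive vertices of the cycle would lie in one part, which holds at most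
   two. *)
have [i [ip npt]] : exists i, i \in p /\ pt i != pt (next p i).
  apply: contrapT => Hno.
  have same i : i \in p -> pt (next p i) = pt i.
    by move=> ip; apply/esym/eqP; apply: contraT => H; exfalso; apply: Hno; exists i.
  case: p up op cp p3 same {Hno} => [|a [|b [|c p]]] //= /andP[ni /andP[nj _]] _ _ _ same.
  have ba : b == a = false by apply/negbTE; apply: contra ni => /eqP ->; rewrite mem_head.
  have bin : b \in [:: a, b, c & p] by rewrite !inE eqxx orbT.
  have := same _ (mem_head _ _); have := same _ bin; rewrite /= ba !eqxx => Hb Ha.
  have := fib2 (esym Ha) (esym Hb).
  move: ni nj; rewrite !inE !negb_or => /and3P[ab ac _] /andP[bc _].
  by rewrite (negbTE ab) (negbTE ac) (negbTE bc).
have [t p' E] := rot_to ip.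
move: npt; rewrite -(next_rot t up) E.
have : (2 < size (i :: p'))%N by rewrite -E size_rot.
case: p' E => [//|b p'] E _; rewrite /= eqxx => npt.
(* One more rotation turns the edge from i to b into the closing edge. *)
have E2 : b :: rcons p' i = rot 1 (rot t p) by rewrite E rot1_cons.
exists (b :: rcons p' i); apply/and4P; split.
- by rewrite E2 !rot_uniq.
- by rewrite E2 !size_rot.
- by rewrite E2 !rot_cycle.
- by rewrite last_rcons eq_sym.
Qed.

Lemma good_cycle_next (q : rel Z) p a t : good_cycle q p -> (t < size p)%N ->
  q (nth a p t) (nth (nth a p 0) p t.+1).
Proof.
case/and4P=> up _ cp; case: p up cp => // i p up cp _ ts /=.
have <- : next (i :: p) (nth a (i :: p) t) = nth i p t.
  by rewrite next_nth mem_nth //= -[(if i == _ then _ else _)]/(index _ (i :: p)) index_uniq.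
by apply: next_cycle => //; apply: mem_nth.
Qed.

Lemma blown_nth (V : eqType) (rows : seq (seq V)) (P : pred (seq V)) (a : V) (phi : nat -> nat) :
  blown rows P -> (forall i, (i < size rows)%N -> (phi i < size (nth [::] rows i))%N) ->
  P (mkseq (fun i => nth a (nth [::] rows i) (phi i)) (size rows)).
Proof.
move=> B H; apply: (blownP B).
elim: rows phi {B P} H => [//|row rows IH] phi H.
have h0 := H 0%N (ltn0Sn _); rewrite /= in h0; rewrite /mkseq /= mem_nth //=.
rewrite -[1%N]/(1 + 0)%N iotaDl -map_comp.
have := IH (fun i => phi i.+1) (fun i Hi => H i.+1 Hi).
by rewrite /mkseq; congr all2; apply: eq_map => i /=; rewrite add1n.
Qed.

(** [x i k] is the k-th copy of vertex i. Copies in different parts are all adjacent; inside a part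
    only copies of equal index have to be. With parts of one vertex this is a blow-up of K_(2^r +
    1); with parts of two vertices it is a blow-up of about half as many vertices together with one
    matching in each full part. *)
Lemma ramsey_structure (R : realType) : exists K : nat, forall n (G : {set {set 'I_n}})
    (x : Z -> 'I_K.+1 -> 'I_n),
  (forall i i' k k', x i k = x i' k' -> i = i' /\ k = k') ->
  (forall i i' k k', (pt i != pt i') || (i != i') && (k == k') -> [set x i k; x i' k'] \in G) ->
  ramsey_cycle r l G.
Proof.
pose pat := ('I_r * (2 ^ r + 1).-bseq Z)%type.
have [e e0 [N HN]] := @blowup_density R m l (#|{: pat}|.+1%:R^-1) ltac:(by rewrite invr_gt0).
exists N => n G x xinj adj; apply/forallP => c.
(* There is one index per part, so two vertices of a part get copies of equal index and the matching
   edge between them is present. *)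
pose X (s : seq 'I_N.+1) i := x i (nth ord0 s (pt i)).
pose col s i i' := c [set X s i; X s i'].
pose P (u : pat) s := good_cycle (fun i i' => (i != i') && (col s i i' == u.1)) u.2.
(* The number of patterns does not depend on the number of copies, so one pattern occurs for a
   positive proportion of the index tuples. This gives l indices per part from which every choice
   shows that pattern. *)
have [//||u Hu] := @mean_pigeonhole R 'I_N.+1 {: pat} m P; first by rewrite card_ord.
  move=> s _; have [|k [p gp]] := @good_cycle_ex (col s).
    by move=> i i'; rewrite /col setUC.
  have sp : (size p <= 2 ^ r + 1)%N.
    by have /and4P[/card_uniqP <- _ _ _] := gp; rewrite -[leqRHS]card_ord max_card.
  by exists (k, Bseq sp).
have /HN : #|{: pat}|.+1%:R^-1 <= mean m (fun s => (P u s)%:R) :> R.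
  apply: le_trans Hu; rewrite lef_pV2 ?posrE ?ltr0n// ?ler_nat//.
  by apply/card_gt0P; exists u.
rewrite card_ord => /(_ (leqnSn _)) /(mean_gt0_ex e0)[rows _ /andP[/allP Urows]].
have : size (map val rows) = m by rewrite size_map size_tuple.
have : forall i, (i < m)%N -> uniq (nth [::] (map val rows) i) /\ size (nth [::] (map val rows) i) = l.
  move=> i im; rewrite (nth_map (nth (nseq_tuple l ord0) rows i)) ?size_tuple //; split=> //.
  by apply: Urows; apply: mem_nth; rewrite size_tuple.
move: {rows Urows} (map val rows) => rows Hrows srows Brows.
clear Hu; case: u Brows => k p Brows.
have l0 : (0 < l)%N by lia.
have Phi (phi : nat -> nat) : (forall i, phi i < l)%N ->
   P (k, p) (mkseq (fun i => nth ord0 (nth [::] rows i) (phi i)) m).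
  move=> Hphi; rewrite -srows; apply: blown_nth => // i; rewrite srows => im.
  by have [_ ->] := Hrows i im.
pose y i j := x i (nth ord0 (nth [::] rows (pt i)) j).
have Xy phi i : X (mkseq (fun i => nth ord0 (nth [::] rows i) (phi i)) m) i = y i (phi (pt i)).
  by rewrite /X /y nth_mkseq.
have := Phi (fun=> 0%N) (fun=> l0); rewrite /P /= => /and4P[up op _].
case Ep : (bseqval p) up op => [//|i0 p'] up op; set iz := last i0 p' => ptz.
pose s0 := size (i0 :: p').
have edge1 t j : (j < l)%N -> (t < s0)%N -> 
  (nth i0 (i0 :: p') t != nth i0 (i0 :: p') t.+1) /\ 
  c [set y (nth i0 (i0 :: p') t) j; y (nth i0 (i0 :: p') t.+1) j] = k.
  move=> jl ts; have := Phi (fun=> j) (fun=> jl); rewrite /P /= Ep.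
  move=> /(good_cycle_next i0)/(_ ts) /andP[-> /eqP].
  by rewrite /col !Xy.
have iz_nth : nth i0 (i0 :: p') (size p') = iz by rewrite /iz -[LHS]/(nth i0 (i0 :: p') (size (i0 :: p')).-1) nth_last.
have nth_s0 : nth (nth i0 (i0 :: p') 0) (i0 :: p') (size p').+1 = i0 by rewrite nth_default.
(* The ends of the closing edge lie in different parts, so their indices vary independently. *)
have edge2 j j' : (j < l)%N -> (j' < l)%N -> 
  c [set y i0 j; y iz j'] = k.
  move=> jl jl'; pose phi i := if i == pt i0 :> nat then j else j'.
  have Hphi i : (phi i < l)%N by rewrite /phi; case: ifP.
  have := Phi phi Hphi; rewrite /P /= Ep => /(good_cycle_next i0)/(_ (leqnn (size p').+1)).
  rewrite iz_nth nth_s0 => /andP[_ /eqP]; rewrite /col !Xy.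
  rewrite /phi eqxx (_ : (pt iz == pt i0 :> nat) = false) 1?setUC //.
  by apply/negbTE; rewrite eq_sym.
(* The cycle follows p once in copies of index position 0, then alternates between i0 and iz in
   fresh copies. As l - s0 is even, it ends at iz and closes up at i0. *)
pose w t := if (t < s0)%N then nth i0 (i0 :: p') t else if odd (t - s0) then iz else i0.
pose jj t := if (t < s0)%N then 0%N else (t - s0).+1.
have s0l : (s0 <= l)%N.
  by apply: leq_trans lbig; rewrite /s0 -Ep size_bseq.
have jjl t : (t < l)%N -> (jj t < l)%N by rewrite /jj /s0 /=; case: ifP => //; lia.
have adj1 i i' j : i != i' -> [set y i j; y i' j] \in G.
  move=> ii; apply: adj; rewrite ii /=; case: (eqVneq (pt i) (pt i')) => //= ->.
  by rewrite eqxx.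
have adj2 j j' : [set y i0 j; y iz j'] \in G by apply: adj; rewrite ptz.
have w_end t : (s0 <= t.+1)%N -> w t \in [:: i0; iz].
  rewrite /w; case: ltnP => h1 h2; last by case: ifP; rewrite !inE eqxx ?orbT.
  have -> : t = size p' by apply/anti_leq/andP; split; [exact: h1|exact: h2].
  by rewrite iz_nth !inE eqxx orbT.
have w_alt t : (s0 <= t.+1)%N -> (w t == i0) = (w t.+1 == iz).
  have izn : (iz == i0) = false by apply: contraNF ptz => /eqP ->.
  move=> h; rewrite /w (ltnNge t.+1) h /=; case: ltnP => h1.
    have Et : t = size p' by apply/anti_leq/andP; split; [exact: h1|exact: h].
    rewrite {1}Et iz_nth (_ : t.+1 - s0 = 0)%N ?Et /s0 /= ?subnn //=.
  by rewrite subSn //=; case: odd => /=; rewrite ?eqxx // eq_sym.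
have edge t : (t.+1 < l)%N -> 
  [set y (w t) (jj t); y (w t.+1) (jj t.+1)] \in G /\ 
  c [set y (w t) (jj t); y (w t.+1) (jj t.+1)] = k.
  move=> tl; case: (ltnP t.+1 s0) => ts.
    have ts' : (t < s0)%N by apply: ltnW.
    rewrite /w /jj ts ts'; have [h1 h2] := edge1 t 0%N l0 ts'; split=> //.
    exact: adj1.
  have tl' : (t < l)%N by apply: ltnW.
  have := w_end t.+1 (leqW ts); have := w_end t ts; have := w_alt t ts; rewrite !inE.
  case: eqP => [-> /esym/eqP -> _ _|_ ].
    by split; [exact: adj2|apply: edge2; apply: jjl].
  move=> /esym -> /= /eqP -> /orP[/eqP -> |//].
  by rewrite setUC; split; [exact: adj2|apply: edge2; apply: jjl].
have wlast : w l.-1 = iz.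
  rewrite /w; case: ltnP => h.
    have -> : l.-1 = size p'.
      apply/anti_leq/andP; split; first exact: h.
      by rewrite -ltnS prednK //; exact: s0l.
    by rewrite iz_nth.
  have op' : odd s0 := op; rewrite (_ : odd _ = true) //.
  by move: (s0) h op' s0l => u; lia.
have w0 : w 0%N = i0 by [].
apply/existsP; exists [ffun t : 'I_l => y (w t) (jj t)]; apply/existsP; exists k.
apply/andP; split.
  apply/injectiveP => t t'; rewrite !ffunE => /xinj[Ew /eqP].
  have [ut st] := Hrows _ (ltn_ord (pt (w t'))).
  rewrite Ew nth_uniq ?st ?jjl // => /eqP Ej; apply: val_inj => /=.
  move: Ew Ej; rewrite /w /jj; case: ltnP => h1; case: ltnP => h2 //; last by lia.
  by move=> /eqP; rewrite nth_uniq // => /eqP.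
apply/forallP => t; rewrite !ffunE /=.
case: (ltnP t.+1 l) => tl.
  by rewrite modn_small //; have [-> ->] := edge t tl; rewrite eqxx.
have -> : (t.+1 %% l = 0)%N by rewrite (_ : t.+1 = l) ?modnn //; apply/eqP; rewrite eqn_leq tl ltn_ord.
have -> : t = l.-1 :> nat by have := ltn_ord t; lia.
rewrite wlast w0 setUC adj2 /=; apply/eqP; apply: edge2 => //; apply: jjl; lia.
Qed.
End Structure.

(** * The binomial random graph *)

Lemma ler_sum_inj (R : numDomainType) (I J : finType) (P : pred I) (Q : pred J)
    (h : I -> J) (f : J -> R) : {in P &, injective h} ->
  (forall i, P i -> Q (h i)) -> (forall j, Q j -> 0 <= f j) ->
  \sum_(i | P i) f (h i) <= \sum_(j | Q j) f j.
Proof.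
move=> hinj hPQ f0.
have -> : \sum_(i | P i) f (h i) = \sum_(j in [set h i | i in P]) f j by rewrite big_imset.
rewrite big_mkcond [leRHS]big_mkcond /=; apply: ler_sum => j _.
case: ifP => [/imsetP[i Pi ->]|_]; first by rewrite hPQ.
by case: ifP => // /f0.
Qed.

Section Prob.
Variables (R : realType) (n : nat) (p : R).
Hypothesis p01 : 0 <= p <= 1.

Implicit Types (H A B D : {set {set 'I_n}}) (E : pred {set {set 'I_n}}).

Definition weight H : R := p ^+ #|H| * (1 - p) ^+ (#|pairs n| - #|H|).

Definition expect (f : {set {set 'I_n}} -> R) : R := \sum_(H : {set {set 'I_n}} | H \subset pairs n) weight H * f H.

Definition Pr (E : pred {set {set 'I_n}}) : R := expect (fun H => (E H)%:R).

Lemma weight_ge0 H : 0 <= weight H.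
Proof. by have [p0 p1] := andP p01; rewrite mulr_ge0 // exprn_ge0 // subr_ge0. Qed.

Lemma prod_set (T : finType) (A : {set T}) (x : R) :
  \prod_(e : T) (if e \in A then x else 1) = x ^+ #|A|.
Proof. by rewrite -big_mkcond prodr_const. Qed.

(** The product over all sets e of a factor for e in H plus a factor for e outside H expands into
    the sum over H; a set that is not a pair gets the factor 0 for being in H. *)
Lemma Pr_cylinder A B : A \subset pairs n -> B \subset pairs n -> [disjoint A & B] ->
  Pr (fun H => (A \subset H) && [disjoint B & H]) = p ^+ #|A| * (1 - p) ^+ #|B|.
Proof.
move=> AP BP AB.
pose F (e : {set 'I_n}) : R := if e \in pairs n then (if e \in B then 0 else p) else 0.
pose G (e : {set 'I_n}) : R := if e \in pairs n then (if e \in A then 0 else 1 - p) else 1.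
have := @bigA_distr R 0 1 *%R +%R {set 'I_n} F G.
have -> : \prod_e (F e + G e) = p ^+ #|A| * (1 - p) ^+ #|B|.
  rewrite -!prod_set -big_split /=; apply: eq_bigr => e _; rewrite /F /G.
  case: (boolP (e \in A)) => eA.
    rewrite (subsetP AP _ eA) (disjointFr AB eA) /=; ring.
  case: (boolP (e \in B)) => eB; first by rewrite (subsetP BP _ eB); ring.
  by case: ifP => _; ring.
move=> ->; rewrite /Pr /expect big_mkcond; apply: eq_bigr => H _.
case: ifP => HP; last first.
  have /subsetPn[e eH eP] := negbT HP.
  by rewrite (bigD1 e) //= eH /F (negbTE eP) mul0r.
case: (boolP ((A \subset H) && _)) => [/andP[AH BH]|]; last first.
  rewrite negb_and mulr0 => /orP[/subsetPn[e eA eH]|].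
    by rewrite (bigD1 e) //= (negbTE eH) /G eA (subsetP AP _ eA) mul0r.
  rewrite -setI_eq0 => /set0Pn[e]; rewrite inE => /andP[eB eH].
  by rewrite (bigD1 e) //= eH /F eB (subsetP BP _ eB) mul0r.
rewrite mulr1 /weight -(cardsDS HP) -!prod_set -big_split; apply: eq_bigr => e _ /=.
rewrite /F /G in_setD; case: (boolP (e \in H)) => eH /=.
  by rewrite (subsetP HP _ eH) (disjointFl BH eH) mulr1.
case: ifP => eP; rewrite ?mulr1 ?mul1r //.
by case: ifP => // eA; rewrite (subsetP AH _ eA) in eH.
Qed.

Lemma Pr_sub A : A \subset pairs n -> Pr (fun H => A \subset H) = p ^+ #|A|.
Proof.
move=> AP; have := Pr_cylinder AP (sub0set _) _.
rewrite cards0 mulr1 => <-; last by rewrite -setI_eq0 setI0.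
by apply: eq_bigr => H _; rewrite -[in RHS]setI_eq0 set0I eqxx andbT.
Qed.

Lemma Pr_true : Pr xpredT = 1.
Proof.
have := Pr_sub (sub0set _); rewrite cards0 expr0 => <-.
by apply: eq_bigr => H _; rewrite sub0set.
Qed.

Lemma Pr_ge0 E : 0 <= Pr E.
Proof. by apply: sumr_ge0 => H _; rewrite mulr_ge0 // weight_ge0. Qed.

Lemma Pr_le E E' : (forall H, H \subset pairs n -> E H -> E' H) -> Pr E <= Pr E'.
Proof.
move=> EE; apply: ler_sum => H HP; apply: ler_wpM2l; first exact: weight_ge0.
by rewrite ler_nat; have := EE H HP; case: (E H) => // ->.
Qed.

Lemma Pr_compl E : Pr E = 1 - Pr (fun H => ~~ E H).
Proof.
rewrite -Pr_true -sumrB; apply: eq_bigr => H _.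
by rewrite -mulrBr; case: (E H); rewrite /= ?subr0 ?subrr.
Qed.

Lemma Pr_union (I : finType) (Q : pred I) (A B : I -> {set {set 'I_n}}) E :
  (forall i, Q i -> [/\ A i \subset pairs n, B i \subset pairs n & [disjoint A i & B i]]) ->
  (forall H, H \subset pairs n -> E H ->
     exists2 i, Q i & (A i \subset H) && [disjoint B i & H]) ->
  Pr E <= \sum_(i | Q i) p ^+ #|A i| * (1 - p) ^+ #|B i|.
Proof.
move=> HQ HE.
have -> : \sum_(i | Q i) p ^+ #|A i| * (1 - p) ^+ #|B i| =
  \sum_(i | Q i) Pr (fun H => (A i \subset H) && [disjoint B i & H]).
  by apply: eq_bigr => i /HQ[h1 h2 h3]; rewrite Pr_cylinder.
rewrite exchange_big /=; apply: ler_sum => H HP; rewrite -mulr_sumr.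
apply: ler_wpM2l; first exact: weight_ge0.
case EH: (E H); last by rewrite sumr_ge0.
have [i Qi Hi] := HE H HP EH.
by rewrite (bigD1 i) //= Hi lerDl sumr_ge0.
Qed.

Lemma Pr_union_sub (I : finType) (Q : pred I) (A : I -> {set {set 'I_n}}) E :
  (forall i, Q i -> A i \subset pairs n) ->
  (forall H, H \subset pairs n -> E H -> exists2 i, Q i & A i \subset H) ->
  Pr E <= \sum_(i | Q i) p ^+ #|A i|.
Proof.
move=> HQ HE; have := @Pr_union I Q A (fun=> set0) E; rewrite cards0.
under eq_bigr do rewrite mulr1; apply=> [i Qi|H HP EH].
  by rewrite HQ // sub0set; split=> //; rewrite -setI_eq0 setI0.
by have [i Qi Ai] := HE H HP EH; exists i => //; rewrite Ai -setI_eq0 set0I /=.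
Qed.

Lemma prob_ramseyE r l (G : {set {set 'I_n}}) :
  prob_ramsey_union r l p G = Pr (fun H => ramsey_cycle r l (G :|: H)).
Proof.
by apply: eq_bigr => H _; case: (ramsey_cycle _ _ _); rewrite ?mulr1 ?mulr0.
Qed.

Lemma bin_le_exp (a b : nat) : ('C(a, b) <= a ^ b)%N.
Proof.
rewrite -(leq_pmul2r (fact_gt0 b)) bin_ffact; apply: leq_trans (_ : a ^ b <= _)%N.
  elim: b => [//|b IH]; by rewrite ffactnSr expnSr leq_mul ?leq_subr.
by rewrite leq_pmulr // fact_gt0.
Qed.

(** Chebyshev's inequality. Disjoint D and D' are uncorrelated. A D' that meets D is given by its
    intersection with D, at most 2^k choices, and by its other pairs, whose total weight is at most
    (N p)^(k-1) because N p >= 1. *)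
Lemma second_moment (k : nat) (F : {set {set {set 'I_n}}}) (dl : R) :
  0 < p -> (0 < k)%N -> 0 < dl -> 1 <= #|pairs n|%:R * p ->
  (forall D, D \in F -> D \subset pairs n /\ #|D| = k) ->
  dl * #|pairs n|%:R ^+ k <= #|F|%:R ->
  Pr (fun H => [forall D in F, ~~ (D \subset H)]) <= 2 ^+ k / (dl * (#|pairs n|%:R * p)).
Proof.
move=> p0 k0 dl0; set N := #|pairs n|; move=> Np HF dF.
have N0 : 0 < N%:R :> R by rewrite ltr0n lt0n; apply: contraTneq Np => ->; rewrite mul0r ler10.
have Np0 : 0 < N%:R * p by rewrite mulr_gt0.
pose X H : R := \sum_(D in F) (D \subset H)%:R.
pose mu : R := #|F|%:R * p ^+ k.
have F0 : 0 < #|F|%:R :> R by apply: lt_le_trans dF; rewrite mulr_gt0 ?exprn_gt0.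
have mu0 : 0 < mu by rewrite mulr_gt0 ?exprn_gt0.
have EX : expect X = mu.
  rewrite /expect; under eq_bigr do rewrite mulr_sumr.
  rewrite exchange_big /= /mu -sum1_card natr_sum mulr_suml; apply: eq_bigr => D /HF[DP kD].
  by rewrite mul1r -kD -Pr_sub.
have EX2 : expect (fun H => X H ^+ 2) = \sum_(D in F) \sum_(D' in F) p ^+ #|D :|: D'|.
  rewrite /expect; under eq_bigr do rewrite expr2 mulr_suml mulr_sumr.
  rewrite exchange_big; apply: eq_bigr => D /HF[DP _].
  under eq_bigr do rewrite mulrCA mulr_sumr mulr_sumr.
  rewrite exchange_big; apply: eq_bigr => D' /HF[DP' _].
  rewrite -Pr_sub ?subUset ?DP //; apply: eq_bigr => H _.
  by rewrite subUset mulrCA -natrM mulnb.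
have var : Pr (fun H => [forall D in F, ~~ (D \subset H)]) * mu ^+ 2 <=
    expect (fun H => X H ^+ 2) - mu ^+ 2.
  have -> : expect (fun H => X H ^+ 2) - mu ^+ 2 = expect (fun H => (X H - mu) ^+ 2).
    have -> : expect (fun H => (X H - mu) ^+ 2) =
      expect (fun H => X H ^+ 2) - 2 * mu * expect X + mu ^+ 2 * Pr xpredT.
      rewrite /expect /Pr !mulr_sumr -sumrB -big_split; apply: eq_bigr => H _ /=.
      by ring.
    by rewrite Pr_true EX; ring.
  rewrite /Pr /expect mulr_suml; apply: ler_sum => H _; rewrite -mulrA.
  apply: ler_wpM2l; first exact: weight_ge0.
  case: (boolP [forall _ in _, _]) => [/forall_inP h|_]; last by rewrite mul0r sqr_ge0.
  by rewrite mul1r /X big1 ?sub0r ?sqrrN // => D /h /negbTE ->.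
have small D : D \in F ->
  \sum_(D' in F | D' :&: D != set0) p ^+ #|D' :\: D| <= 2 ^+ k * (N%:R * p) ^+ k.-1.
  move=> DF; have [DP kD] := HF D DF.
  pose Q (u : {set {set 'I_n}} * {set {set 'I_n}}) :=
    (u.1 \subset D) && (u.1 != set0) && ((u.2 \subset pairs n) && (#|u.2| == k - #|u.1|)%N).
  apply: le_trans (_ : \sum_(u | Q u) p ^+ #|u.2| <= _).
    apply: (@ler_sum_inj R _ _ _ Q (fun D' => (D' :&: D, D' :\: D)) (fun u => p ^+ #|u.2|)).
    - by move=> D1 D2 _ _ [E1 E2]; rewrite -(setID D1 D) E1 E2 setID.
    - move=> D' /andP[/HF[DP' kD'] ne]; rewrite /Q /= subsetIr ne /=.
      by rewrite (subset_trans (subsetDl _ _) DP') /= cardsD kD'.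
    - by move=> u _; rewrite exprn_ge0 ?ltW.
  rewrite /Q -(pair_big_dep (fun A => (A \subset D) && (A != set0))
    (fun A B : {set {set 'I_n}} => (B \subset pairs n) && (#|B| == k - #|A|)%N) (fun A B => p ^+ #|B|)) /=.
  have -> : 2 ^+ k * (N%:R * p) ^+ k.-1 = \sum_(A in powerset D) (N%:R * p) ^+ k.-1.
    by rewrite sumr_const card_powerset kD -[RHS]mulr_natl natrX.
  rewrite big_mkcond [leRHS]big_mkcond /=; apply: ler_sum => A _.
  rewrite powersetE; case: (boolP (A \subset D)) => // AD.
  case: (boolP (A == set0)) => [_|A0] /=; first by rewrite exprn_ge0 ?ltW.
  have A1 : (0 < #|A|)%N by rewrite card_gt0.
  have -> : \sum_(B : {set {set 'I_n}} | (B \subset pairs n) && (#|B| == k - #|A|)%N) p ^+ #|B| =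
     ('C(N, k - #|A|))%:R * p ^+ (k - #|A|).
    under eq_bigr => B /andP[_ /eqP ->] do [].
    rewrite sumr_const -[LHS]mulr_natl; congr (_%:R * _).
    by rewrite -cards_draws; apply: eq_card => B; rewrite [RHS]inE.
  apply: le_trans (_ : (N%:R * p) ^+ (k - #|A|) <= _).
    rewrite exprMn -natrX; apply: ler_wpM2r; first by rewrite exprn_ge0 // ltW.
    by rewrite ler_nat bin_le_exp.
  by apply: ler_weXn2l => //; rewrite -subn1 leq_sub2l.
have inner D : D \in F ->
  \sum_(D' in F) p ^+ #|D :|: D'| <= #|F|%:R * p ^+ (k + k) + p ^+ k * (2 ^+ k * (N%:R * p) ^+ k.-1).
  move=> DF; have [DP kD] := HF D DF.
  have cU D' : #|D :|: D'| = (k + #|D' :\: D|)%N.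
    by rewrite -kD cardsU cardsD (setIC D) addnBA // subset_leq_card // subsetIl.
  rewrite (bigID (fun D' => D' :&: D != set0)) /= addrC; apply: lerD.
    rewrite -sum1_card natr_sum mulr_suml big_mkcond [leRHS]big_mkcond /=.
    apply: ler_sum => D' _; rewrite mul1r negbK; case: (boolP (D' \in F)) => //= D'F.
    case: eqP => [E|_]; last by rewrite exprn_ge0 ?ltW.
    by rewrite cU cardsD E cards0 subn0; have [_ ->] := HF D' D'F.
  under eq_bigr do rewrite cU exprD.
  rewrite -mulr_sumr; apply: ler_wpM2l; first by rewrite exprn_ge0 // ltW.
  exact: small.
have bound : Pr (fun H => [forall D in F, ~~ (D \subset H)]) * mu ^+ 2 <=
   #|F|%:R * (p ^+ k * (2 ^+ k * (N%:R * p) ^+ k.-1)).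
  apply: le_trans var _; rewrite EX2 lerBlDl.
  apply: le_trans (ler_sum _ inner) _.
  rewrite sumr_const -[leLHS]mulr_natl mulrDr; apply: lerD => //.
  by rewrite /mu exprD le_eqVlt; apply/orP; left; apply/eqP; ring.
rewrite ler_pdivlMr ?mulr_gt0 //.
set P := Pr _ in bound *.
have b2 : P * mu <= 2 ^+ k * (N%:R * p) ^+ k.-1.
  rewrite -(ler_pM2r mu0) -mulrA -expr2; apply: le_trans bound _.
  by rewrite mulrA mulrC.
rewrite -(ler_pM2r (exprn_gt0 k.-1 Np0)); apply: le_trans b2.
have -> : P * (dl * (N%:R * p)) * (N%:R * p) ^+ k.-1 = P * (dl * (N%:R * p) ^+ k).
  by rewrite -[in RHS](prednK k0) exprS; ring.
apply: ler_wpM2l; first exact: Pr_ge0.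
by rewrite exprMn mulrA ler_wpM2r // exprn_ge0 // ltW.
Qed.
End Prob.

(** * Dense graphs *)

Section Cliques.
Variables (R : realType) (V : finType) (adj : rel V).
Hypothesis adj_sym : symmetric adj.

Definition edge_weight (U : {set V}) : R := \sum_(u in U) \sum_(v in U) (adj u v)%:R.

Lemma edge_weight_rem (U : {set V}) (u : V) : u \in U -> ~~ adj u u ->
  edge_weight U = edge_weight (U :\ u) + 2 * #|[set v in U | adj u v]|%:R.
Proof.
move=> uU irr.
have D : \sum_(v in U) (adj u v)%:R = #|[set v in U | adj u v]|%:R :> R.
  by rewrite -natr_sum -sum1_card big_mkcond [in RHS]big_mkcond /=; congr (_%:R);
     apply: eq_bigr => v _; rewrite inE; case: (v \in U); case: (adj u v).
have D' : \sum_(v in U :\ u) (adj u v)%:R = #|[set v in U | adj u v]|%:R :> R.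
  by rewrite -D (big_setD1 u uU) /= (negbTE irr) add0r.
rewrite /edge_weight (big_setD1 u uU) /= D.
have -> : \sum_(x in U :\ u) \sum_(v in U) (adj x v)%:R =
  \sum_(x in U :\ u) (adj u x)%:R + \sum_(x in U :\ u) \sum_(v in U :\ u) (adj x v)%:R :> R.
  by rewrite -big_split /=; apply: eq_bigr => x _; rewrite (big_setD1 u uU) /= adj_sym.
by rewrite D'; ring.
Qed.

(* Maximising 2e(U) - lam |U|^2 forces a large minimum degree inside U. *)
Lemma min_degree_subset (lam : R) : irreflexive adj -> exists U : {set V},
  edge_weight setT - lam * (#|V| ^ 2)%:R <= edge_weight U - lam * (#|U| ^ 2)%:R /\
  forall u, u \in U -> lam * (#|U|%:R - 1 / 2) <= #|[set v in U | adj u v]|%:R.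
Proof.
move=> irr; pose phi (U : {set V}) := edge_weight U - lam * (#|U| ^ 2)%:R.
have [U _ HU] := @Order.TotalTheory.arg_maxP _ R _ setT xpredT phi isT.
exists U; split; first by have := HU setT isT; rewrite /phi cardsT.
move=> u uU; have := HU (U :\ u) isT; rewrite /phi (edge_weight_rem uU) ?irr //.
rewrite (cardsD1 u U) uU /= !natrX natrD; set a := #|_|%:R => H.
have : edge_weight (U :\ u) - lam * a ^+ 2 <= edge_weight (U :\ u) +
    2 * #|[set v in U | adj u v]|%:R - lam * (1 + a) ^+ 2 by exact: H.
have -> : lam * (1 + a - 1 / 2) = (lam * (1 + a) ^+ 2 - lam * a ^+ 2) / 2 by field.
lra.
Qed.

Lemma common_neighbours (U : {set V}) (D : R) (s : seq V) :
  (forall u, u \in U -> D <= #|[set v in U | adj u v]|%:R) -> all (mem U) s ->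
  #|U|%:R - (size s)%:R * (#|U|%:R - D) <= #|[set v in U | all (adj v) s]|%:R.
Proof.
move=> HD; elim: s => [|a s IH] /=.
  by rewrite mul0r subr0 ler_nat => _; apply: subset_leq_card; apply/subsetP => v vU; rewrite inE vU.
case/andP=> aU /IH {}IH; have Da := HD a aU.
set A := [set v in U | all (adj v) s] in IH; set B := [set v in U | adj a v] in Da.
have -> : [set v in U | adj v a && all (adj v) s] = A :&: B.
  by apply/setP => v; rewrite !inE (adj_sym v a); case: (v \in U); case: adj; case: all.
have : (#|A| + #|B| <= #|A :&: B| + #|U|)%N.
  rewrite -cardsUI addnC leq_add2l subset_leq_card //.
  by apply/subsetP => v; rewrite !inE => /orP[/andP[]|/andP[]].
rewrite -(ler_nat R) !natrD => H; rewrite -natr1; lra.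
Qed.

(** Greedy construction: every clique of fewer than m vertices in U extends in at least c |V|
    ways. *)
Lemma mean_clique (U : {set V}) (c : R) (m : nat) : 0 <= c -> (0 < #|V|)%N ->
  (forall s, (size s < m)%N -> all (mem U) s ->
     c * #|V|%:R <= #|[set v in U | all (adj v) s]|%:R) ->
  c ^+ m <= mean m (fun s => (all (mem U) s && pairwise adj s)%:R).
Proof.
move=> c0 V0; have V0' : 0 < #|V|%:R :> R by rewrite ltr0n.
elim: m => [|m IH] H; first by rewrite mean0.
rewrite meanS -mean_sum -mean_scale exprSr.
have := IH (fun s sm => H s (leqW sm)) => {}IH.
apply: le_trans (ler_wpM2r c0 IH) _; rewrite -mean_scale; apply: le_mean => s sm.
case: (boolP (all _ s && _)) => [/andP[sU sp]|_]; last first.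
  by rewrite mul0r mulr_ge0 ?invr_ge0 ?sumr_ge0.
rewrite mul1r ler_pdivlMr //; apply: le_trans (H s _ sU) _; first by rewrite sm.
rewrite -sum1_card natr_sum [leLHS]big_mkcond /=; apply: ler_sum => v _.
by rewrite inE; case: ifP => // /andP[vU av] /=; rewrite vU sU av sp.
Qed.
End Cliques.

(** Turan's theorem with supersaturation. In a subset U of minimum degree about lam |U|, with lam >
    1 - 1/q, any q vertices have about (1 - q (1 - lam)) |U| common neighbours, a positive
    proportion. *)
Lemma dense_cliques (R : realType) (q : nat) (d : R) : (0 < q)%N -> 1 - q%:R^-1 < d ->
  exists2 c : R, 0 < c & exists N : nat, forall (V : finType) (adj : rel V),
  (N <= #|V|)%N -> symmetric adj -> irreflexive adj ->
  d * (#|V|%:R * (#|V|%:R - 1)) <= \sum_u \sum_v (adj u v)%:R ->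
  c <= mean q.+1 (fun s => (pairwise adj s)%:R).
Proof.
move=> q0 dq.
have q0' : 0 < q%:R :> R by rewrite ltr0n.
pose lam := (1 - q%:R^-1 + d) / 2.
have l1 : 1 - q%:R^-1 < lam by rewrite /lam; lra.
have l2 : lam < d by rewrite /lam; lra.
have qi1 : q%:R^-1 <= 1 :> R by rewrite invf_le1 // ler1n.
have lam0 : 0 < lam by apply: le_lt_trans l1; rewrite subr_ge0.
pose sg := 1 - q%:R * (1 - lam).
have sg0 : 0 < sg.
  by rewrite /sg subr_gt0 -ltr_pdivlMl // mulr1; lra.
pose eta := (d - lam) / 2.
have eta0 : 0 < eta by rewrite /eta; lra.
(* The bound |U| >= ka |V| will come from |U|^2 >= eta |V|^2. *)
pose ka := Num.min 1 eta.
have ka0 : 0 < ka by rewrite lt_min ltr01.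
exists ((sg / 2 * ka) ^+ q.+1); first by rewrite exprn_gt0// mulr_gt0// divr_gt0.
(* [N1] absorbs the term d |V| by which d |V| (|V| - 1) falls short of d |V|^2; [N2] absorbs the
   half vertex in the minimum degree bound. *)
pose N1 := Num.bound (d / eta).
pose N2 := Num.bound (lam * q%:R / (sg * ka)).
exists (maxn N1.+1 N2.+1) => V adj; rewrite geq_max => /andP[NV1 NV2] sym irr Hd.
have V0 : (0 < #|V|)%N by apply: leq_ltn_trans NV1.
have V0' : 0 < #|V|%:R :> R by rewrite ltr0n.
have d0 : 0 < d by apply: lt_trans l2.
have V1 : d <= eta * #|V|%:R.
  rewrite mulrC -ler_pdivrMr // ltW //; apply: lt_trans (archi_boundP _) _.
    by rewrite divr_ge0 // ltW.
  by rewrite ltr_nat.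
have V2 : lam * q%:R <= sg * ka * #|V|%:R.
  have : lam * q%:R / (sg * ka) < #|V|%:R.
    apply: lt_trans (archi_boundP _) _; last by rewrite ltr_nat.
    by apply: divr_ge0; apply: ltW; apply: mulr_gt0.
  by rewrite ltr_pdivrMr ?mulr_gt0 // => h; rewrite [leRHS]mulrC ltW.
have [U [HU HD]] := min_degree_subset sym lam irr.
have ET : edge_weight R adj setT = \sum_u \sum_v (adj u v)%:R.
  by rewrite /edge_weight; apply: eq_big => [u|u _]; rewrite ?inE //; apply: eq_bigl => v; rewrite inE.
have EU : edge_weight R adj U <= (#|U| ^ 2)%:R.
  rewrite /edge_weight natrX expr2 -{2}sum1_card natr_sum mulr_sumr; apply: ler_sum => u _.
  rewrite mulr1 -sum1_card natr_sum; by apply: ler_sum => v _; case: (adj u v).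
have UV : eta * #|V|%:R ^+ 2 <= #|U|%:R ^+ 2.
  rewrite -natrX in EU *; rewrite ET in HU.
  have L0 : 0 <= lam * (#|U| ^ 2)%:R by rewrite mulr_ge0 // ltW.
  have : d * #|V|%:R <= eta * #|V|%:R ^+ 2 by rewrite expr2 mulrA ler_wpM2r // ltW.
  have : d * (#|V|%:R * (#|V|%:R - 1)) = lam * #|V|%:R ^+ 2 + 2 * eta * #|V|%:R ^+ 2 - d * #|V|%:R.
    by rewrite /eta; field.
  rewrite !natrX in HU EU L0 *; lra.
have kaU : ka * #|V|%:R <= #|U|%:R.
  have kaV0 : 0 <= ka * #|V|%:R by rewrite mulr_ge0 // ltW.
  rewrite -(@ler_pXn2r _ 2) ?nnegrE //; apply: le_trans UV.
  rewrite exprMn ler_wpM2r ?sqr_ge0 // expr2.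
  apply: (@le_trans _ _ (1 * ka)); last by rewrite mul1r ge_min lexx orbT.
  by apply: ler_wpM2r; [exact: ltW|rewrite ge_min lexx].
apply: le_trans (mean_clique _ V0 _) (_ : mean q.+1 (fun s => (all (mem U) s && pairwise adj s)%:R) <= _).
- by rewrite mulr_ge0 ?divr_ge0 ?ltW.
- move=> s; rewrite ltnS => sq sU.
  apply: le_trans (common_neighbours sym HD sU).
  have L : #|U|%:R - q%:R * (#|U|%:R - lam * (#|U|%:R - 1 / 2)) <=
    #|U|%:R - (size s)%:R * (#|U|%:R - lam * (#|U|%:R - 1 / 2)) :> R.
    rewrite lerD2l lerN2; case: (set_0Vmem U) => [U0|[u uU]].
      by have := lt_le_trans (mulr_gt0 ka0 V0') kaU; rewrite U0 cards0 ltxx.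
    rewrite ler_wpM2r ?ler_nat //  subr_ge0; apply: le_trans (HD u uU) _.
    by rewrite ler_nat subset_leq_card //; apply/subsetP => v; rewrite inE => /andP[].
  apply: le_trans L; have -> : #|U|%:R - q%:R * (#|U|%:R - lam * (#|U|%:R - 1 / 2)) =
    sg * #|U|%:R - lam * q%:R / 2 by rewrite /sg; field.
  have : sg * (ka * #|V|%:R) <= sg * #|U|%:R by rewrite ler_wpM2l // ltW.
  by move: V2; rewrite -!mulrA; lra.
- by apply: le_mean => s _; case: (all _ s).
Qed.

Lemma card_edges (n : nat) (G : {set {set 'I_n}}) : is_graph G ->
  (\sum_u \sum_v ((u != v) && ([set u; v] \in G)) = 2 * #|G|)%N.
Proof.
move=> /subsetP gG; rewrite pair_big /= -big_mkcond sum1_card.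
rewrite -sum1_card (partition_big (fun p : 'I_n * 'I_n => [set p.1; p.2]) (mem G)) /=; last first.
  by move=> [u v] /= /andP[].
rewrite -sum1_card big_distrr /=; apply: eq_bigr => e eG; rewrite muln1.
have e2 : #|e| == 2%N by have := gG _ eG; rewrite inE.
have [a [b [ab Ee]]] := cards2P _ e2.
rewrite sum1_card (_ : 2 = #|[set (a, b); (b, a)]|)%N.
  apply: eq_card => -[u v]; rewrite !inE /= !xpair_eqE.
  apply/idP/idP.
    move=> /andP[/andP[uv _] /eqP E].
    have ue : u \in e by rewrite -E !inE eqxx.
    have ve : v \in e by rewrite -E !inE eqxx orbT.
    move: ue ve uv; rewrite Ee !inE => /orP[/eqP ->|/eqP ->] /orP[/eqP ->|/eqP ->];
      by rewrite ?eqxx ?orbT.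
  move=> /orP[/andP[/eqP -> /eqP ->]|/andP[/eqP -> /eqP ->]].
    by rewrite [_ \in _](_ : _ = (a != b) && ([set a; b] \in G) && ([set a; b] == e)) // ab -Ee eG eqxx.
  by rewrite [_ \in _](_ : _ = (b != a) && ([set b; a] \in G) && ([set b; a] == e)) // eq_sym ab setUC -Ee eG eqxx.
by rewrite cards2 xpair_eqE negb_and ab.
Qed.

Lemma density_adj (R : realType) (n : nat) (G : {set {set 'I_n}}) (d : R) : is_graph G ->
  d <= density R G ->
  d * (n%:R * (n%:R - 1)) <= \sum_u \sum_v ((u != v) && ([set u; v] \in G))%:R.
Proof.
move=> gG dG; have := card_edges gG => E.
have -> : \sum_u \sum_v ((u != v) && ([set u; v] \in G))%:R = 2 * #|G|%:R :> R.
  by rewrite -natrM -E natr_sum; apply: eq_bigr => u _; rewrite natr_sum.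
have E2 : (n%:R * (n%:R - 1)) = 2 * ('C(n, 2))%:R :> R.
  have : (n * n.-1 = 2 * 'C(n, 2))%N by have := mul_bin_diag n 1; rewrite bin1.
  by case: (n) => [|k] /= H; [rewrite mul0r -natrM -H mul0n|rewrite -natrM -H natrM -natr1 addrK].
rewrite E2; case: (posnP 'C(n, 2)) => [->|C0]; first by rewrite !mulr0 mulr_ge0.
by rewrite mulrCA ler_wpM2l // -ler_pdivlMr ?ltr0n.
Qed.

Lemma blown_clique (V : eqType) (adj : rel V) (rows : seq (seq V)) (t : nat) (a : V) :
  blown rows (pairwise adj) -> all (fun row : seq V => size row == t) rows ->
  forall i j k k', (i < j < size rows)%N -> (k < t)%N -> (k' < t)%N ->
  adj (nth a (nth [::] rows i) k) (nth a (nth [::] rows j) k').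
Proof.
move=> B /allP St i j k k' /andP[ij js] kt k't.
have Hphi h : (h < size rows)%N -> ((if h == i then k else k') < size (nth [::] rows h))%N.
  by move=> hs; rewrite (eqP (St _ (mem_nth [::] hs))); case: ifP.
have := blown_nth a B Hphi.
have is_ : (i < size rows)%N by apply: ltn_trans js.
move=> /(pairwiseP a) /(_ i j); rewrite !inE size_mkseq !nth_mkseq //.
by rewrite eqxx gtn_eqF //; apply.
Qed.

Lemma zero_threshold_dense (R : realType) (r l : nat) (d : R) :
  (2 ^ r + 1 <= l)%N -> odd l -> 1 - 2 ^- r < d -> zero_threshold r l d.
Proof.
move=> lr lo dr.
(* With one vertex per part the structure is exactly a blow-up of K_(2^r + 1). *)
have [|K HK] := @ramsey_structure r l (2 ^ r + 1) id lr lo _ R.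
  by move=> i j k -> _; rewrite eqxx.
have q0 : (0 < 2 ^ r)%N by rewrite expn_gt0.
have [|c c0 [N HN]] := @dense_cliques R (2 ^ r) d q0; first by rewrite natrX.
have [e e0 [M HM]] := @blowup_density R (2 ^ r).+1 K.+1 c c0.
exists (maxn N.+1 M) => n; rewrite geq_max => /andP[Nn0 Mn].
case: n Nn0 Mn => [//|n] /ltnW Nn Mn G gG dG.
pose adj (u v : 'I_n.+1) := (u != v) && ([set u; v] \in G).
have asym : symmetric adj by move=> u v; rewrite /adj eq_sym setUC.
have airr : irreflexive adj by move=> u; rewrite /adj eqxx.
have := HN 'I_n.+1 adj; rewrite card_ord => /(_ Nn asym airr (density_adj gG dG)).
move=> /HM; rewrite card_ord => /(_ Mn) /(mean_gt0_ex e0) [rows _ /andP[/allP Ur B]].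
pose rws := map val rows; rewrite -/rws in B.
have srows : size rws = (2 ^ r + 1)%N by rewrite size_map size_tuple addn1.
have St : all (fun row : seq 'I_n.+1 => size row == K.+1) rws.
  by apply/allP => row /mapP[t _ ->]; rewrite size_tuple.
have Urw row : row \in rws -> uniq row by case/mapP => t /Ur ut ->.
pose x (i : 'I_(2 ^ r + 1)) (k : 'I_K.+1) := nth ord0 (nth [::] rws i) k.
have adjx i i' k k' : i != i' -> adj (x i k) (x i' k').
  wlog ii : i i' k k' / (i < i')%N.
    move=> H ne; case: (ltngtP i i') => h; [exact: H| |by move: ne; rewrite (val_inj h) eqxx].
    by rewrite asym; apply: H => //; rewrite eq_sym.
  by move=> _; apply: (blown_clique _ B St) => //; rewrite ii srows ltn_ord.
apply: (HK _ G x).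
  move=> i i' k k' E; case: (eqVneq i i') => [Ei|/(adjx i i' k k')]; last by rewrite E airr.
  subst i'; split=> //; apply: val_inj; apply/eqP; move/eqP: E; rewrite /x nth_uniq //.
  - by rewrite (eqP (allP St _ (mem_nth _ _))) // srows.
  - by rewrite (eqP (allP St _ (mem_nth _ _))) // srows.
  - by apply: Urw; apply: mem_nth; rewrite srows.
move=> i i' k k' /orP[ii|/andP[ii _]]; by have /andP[] := adjx i i' k k' ii.
Qed.

(** * Sprinkling over a dense graph *)

Section Limits.
Variable R : realType.
Implicit Types (f p : nat -> R).
Local Open Scope classical_set_scope.

Lemma cvg_of_bounds f (a : R) :
  (forall e : R, 0 < e -> exists N : nat, forall n, (N <= n)%N -> `|a - f n| <= e) ->
  f @ \oo --> a.
Proof.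
move=> H; apply/cvgrPdist_le => e e0; have [N HN] := H e e0.
by exists N => // n /= Nn; apply: HN.
Qed.

Lemma omega_seqE p f : omega_seq p f ->
  forall A : R, exists N : nat, forall n, (N <= n)%N -> A <= p n / f n.
Proof.
move=> /cvgryPge H A; have [N _ HN] := H A.
by exists N => n Nn; apply: (HN n).
Qed.

Lemma little_o_seqE p f : little_o_seq p f ->
  forall e : R, 0 < e -> exists N : nat, forall n, (N <= n)%N -> `|p n / f n| <= e.
Proof.
move=> /cvgrPdist_le H e e0; have [N _ HN] := H e e0.
by exists N => n Nn; have := HN n Nn; rewrite sub0r normrN.
Qed.

Lemma dense_seqE (d : R) (G : forall n, {set {set 'I_n}}) : dense_seq d G ->
  (forall n, is_graph (G n)) /\ exists N : nat, forall n, (N <= n)%N -> d <= density R (G n).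
Proof.
move=> [gG [N _ HN]]; split=> //; exists N => n Nn; exact: HN.
Qed.

Lemma dense_seqI (d : R) (G : forall n, {set {set 'I_n}}) (N : nat) :
  (forall n, is_graph (G n)) -> (forall n, (N <= n)%N -> d <= density R (G n)) ->
  dense_seq d G.
Proof. by move=> gG H; split=> //; exists N => // n /= Nn; apply: H. Qed.

End Limits.

Lemma card_pairs n : #|pairs n| = 'C(n, 2).
Proof. by rewrite /pairs card_draws card_ord. Qed.

Lemma bool_block (a b : bool) (K k1 k2 : nat) : (k1 < K)%N -> (k2 < K)%N ->
  (a * K + k1 = b * K + k2)%N -> a = b /\ k1 = k2.
Proof. by case: a; case: b; rewrite ?mul1n ?mul0n => h1 h2 h3; split=> //; lia. Qed.

Lemma bool_block_lt (a : bool) (K k : nat) : (k < K)%N -> (a * K + k < 2 * K)%N.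
Proof. by case: a; lia. Qed.

Lemma half_eq_odd (z z' : nat) : z != z' -> z./2 = z'./2 -> odd z' = ~~ odd z.
Proof.
move=> ne E; have := odd_double_half z; have := odd_double_half z'; rewrite E.
by move: ne; case: (odd z); case: (odd z') => //= /eqP; lia.
Qed.

Lemma half_lt (z q : nat) : (z < 2 * q + 1)%N -> (z./2 < q.+1)%N.
Proof. by have := odd_double_half z; lia. Qed.

Section CommonUpper.
Variables (R : realType) (r l : nat) (d : R).
Hypothesis lr : (2 ^ r + 1 <= l)%N.
Hypothesis lo : odd l.
Hypothesis r0 : (0 < r)%N.
Hypothesis dr : 1 - 2 ^- (r - 1) < d.

Let q := (2 ^ (r - 1))%N.

Lemma half_part_subproof (z : 'I_(2 ^ r + 1)) : (z./2 < q.+1)%N.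
Proof.
have E : (2 ^ r = 2 * q)%N by rewrite /q -expnS subn1 prednK.
by apply: half_lt; rewrite -E.
Qed.
(** Vertices 2h and 2h + 1 share part h. Since 2^r + 1 = 2q + 1, there are q + 1 parts and the last
    one has a single vertex. *)
Definition half_part z : 'I_q.+1 := Ordinal (half_part_subproof z).

Lemma half_part_fib i j k : half_part i = half_part j -> half_part j = half_part k ->
  [|| i == j, j == k | i == k].
Proof.
move=> /(congr1 val) /= E1 /(congr1 val) /= E2; rewrite -!val_eqE /=.
have := odd_double_half i; have := odd_double_half j; have := odd_double_half k.
rewrite -E2 -E1; move: (i./2) => h.
by case: (odd i); case: (odd j); case: (odd k); rewrite ?add1n ?add0n => <- <- <-; rewrite eqxx ?orbT.
Qed.

(** Each row of a blown-up (q+1)-clique has 2 (K + 1) entries, one half for each of the two vertices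
    of its part. It suffices that G(n,p) contains the matchings between the halves of all rows of
    one block. These unions of matchings are at least dl N^k many among the k-sets of the N pairs,
    as the second moment bound demands. *)
Lemma dense_sprinkle : exists k N : nat, exists2 dl : R, 0 < dl &
  forall n (p : R) (G : {set {set 'I_n}}), (N <= n)%N -> 0 <= p <= 1 ->
  1 <= #|pairs n|%:R * p -> is_graph G -> d <= density R G ->
  1 - 2 ^+ k / (dl * (#|pairs n|%:R * p)) <= prob_ramsey_union r l p G.
Proof.
have [K HK] := @ramsey_structure r l q.+1 half_part lr lo half_part_fib R.
have q0 : (0 < q)%N by rewrite expn_gt0.
have [|c c0 [N1 HN1]] := @dense_cliques R q d q0; first by rewrite natrX.
pose t := (2 * K.+1)%N.
have [e e0 [N2 HN2]] := @blowup_density R q.+1 t c c0.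
pose m := q.+1; pose k := (m * K.+1)%N.
have tm0 : 0 < (t * m)%:R :> R by rewrite ltr0n.
exists k, (maxn N1.+1 N2), (e / (t * m)%:R ^+ (m * t)); first by rewrite divr_gt0 ?exprn_gt0.
move=> n p G; rewrite geq_max => /andP[N1n N2n] p01 Np gG dG.
case: n N1n N2n G Np gG dG => [//|n] /ltnW N1n N2n G Np gG dG.
pose adj (u v : 'I_n.+1) := (u != v) && ([set u; v] \in G).
have asym : symmetric adj by move=> u v; rewrite /adj eq_sym setUC.
have airr : irreflexive adj by move=> u; rewrite /adj eqxx.
have := HN1 'I_n.+1 adj; rewrite card_ord => /(_ N1n asym airr (density_adj gG dG)).
move=> /HN2; rewrite card_ord => /(_ N2n) => He.
pose good (rows : m.-tuple (t.-tuple 'I_n.+1)) :=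
  all (fun row : t.-tuple 'I_n.+1 => uniq row) rows && blown (map val rows) (pairwise adj).
pose y (rows : m.-tuple (t.-tuple 'I_n.+1)) (i : 'I_m) (j : 'I_t) := tnth (tnth rows i) j.
have yE rows i j : y rows i j = nth ord0 (nth [::] (map val rows) i) j.
  rewrite /y (tnth_nth ord0) (nth_map (tnth rows i)) ?size_tuple //.
  by rewrite -(tnth_nth (tnth rows i)).
have Srows (rows : m.-tuple (t.-tuple 'I_n.+1)) : all (fun row : seq 'I_n.+1 => size row == t) (map val rows).
  by apply/allP => row /mapP[u _ ->]; rewrite size_tuple.
have yadj rows i i' j j' : good rows -> i != i' -> adj (y rows i j) (y rows i' j').
  wlog ii : i i' j j' / (i < i')%N.
    move=> H g ne; case: (ltngtP i i') => h; [exact: H| |by move: ne; rewrite (val_inj h) eqxx].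
    by rewrite asym; apply: H => //; rewrite eq_sym.
  move=> /andP[_ B] _; rewrite !yE; apply: (blown_clique _ B (Srows _)) => //.
  by rewrite ii size_map size_tuple ltn_ord.
have yinj rows i i' j j' : good rows -> y rows i j = y rows i' j' -> i = i' /\ j = j'.
  move=> g E; case: (eqVneq i i') => [Ei|/(yadj rows i i' j j' g)]; last by rewrite E airr.
  subst i'; split=> //; move: E; rewrite /y; apply/tuple_uniqP.
  by have /andP[/allP + _] := g; apply; apply: mem_tnth.
have jl (k' : 'I_K.+1) : (k' < t)%N by have := bool_block_lt false (ltn_ord k').
have jr (k' : 'I_K.+1) : (K.+1 + k' < t)%N.
  by have := bool_block_lt true (ltn_ord k'); rewrite mul1n.
pose ed rows (ik : 'I_m * 'I_K.+1) := [set y rows ik.1 (Ordinal (jl ik.2)); y rows ik.1 (Ordinal (jr ik.2))].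
pose D rows := [set ed rows ik | ik in setT].
have edinj rows : good rows -> injective (ed rows).
  move=> g [i k1] [i' k2] /= /setP E.
  have := E (y rows i (Ordinal (jl k1))); rewrite !inE eqxx /= => /esym/orP[|] /eqP /(yinj _ _ _ _ _ g)[-> /(congr1 val)] /=.
    by move=> /val_inj ->.
  by move=> Ek; have := ltn_ord k1; rewrite Ek ltnNge leq_addr.
have edP rows ik : good rows -> ed rows ik \in pairs n.+1.
  move=> g; rewrite inE cards2 eqSS eqb1; apply/eqP => E.
  have [_ /(congr1 val) /= Ek] := yinj _ _ _ _ _ g E.
  by have := ltn_ord ik.2; rewrite Ek ltnNge leq_addr.
have DP rows : good rows -> D rows \subset pairs n.+1 /\ #|D rows| = k.
  move=> g; split; first by apply/subsetP => _ /imsetP[ik _ ->]; apply: edP.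
  by rewrite card_imset ?cardsT ?card_prod ?card_ord //; apply: edinj.
pose RR := [set rows | good rows].
pose F := [set D rows | rows in RR].
(* The matching edges determine a vertex set of size at most t m, and all m t entries of the rows
   lie in it. *)
have fib D0 : D0 \in F -> (#|[set rows in RR | D rows == D0]| <= (t * m) ^ (m * t))%N.
  case/imsetP=> rows0; rewrite inE => g0 ->; set C := cover (D rows0).
  have cC : (#|C| <= t * m)%N.
    apply: leq_trans (leq_card_cover _) _.
    have [h1 h2] := DP _ g0.
    rewrite (eq_bigr (fun=> 2%N)) => [|A /(subsetP h1)]; last by rewrite inE => /eqP.
    by rewrite sum_nat_const h2 /k /t mulnC -mulnA (mulnC m).
  pose f (rows : m.-tuple (t.-tuple 'I_n.+1)) := [ffun ij : 'I_m * 'I_t => y rows ij.1 ij.2].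
  have finj : injective f.
    move=> r1 r2 /ffunP E; apply: eq_from_tnth => i; apply: eq_from_tnth => j.
    by have := E (i, j); rewrite !ffunE.
  rewrite -(card_imset _ finj).
  apply: leq_trans (_ : #|[set h : {ffun 'I_m * 'I_t -> 'I_n.+1} | h \in ffun_on (mem C)]| <= _)%N.
    apply: subset_leq_card; apply/subsetP => hh /imsetP[rows + ->]; rewrite inE => /andP[_ /eqP E].
    rewrite inE; apply/ffun_onP => -[i j]; rewrite ffunE /= /C -E.
    have [j0 [Ej|Ej]] : exists j0 : 'I_K.+1, j = j0 :> nat \/ (j = K.+1 + j0 :> nat)%N.
      case: (ltnP j K.+1) => h; first by exists (Ordinal h); left.
      have h' : (j - K.+1 < K.+1)%N by rewrite ltn_subLR // addnn -mul2n.
      by exists (Ordinal h'); right; rewrite /= subnKC.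
    - apply/bigcupP; exists (ed rows (i, j0)); first exact: imset_f.
      by rewrite !inE (_ : j = Ordinal (jl j0)) ?eqxx //; apply: val_inj.
    - apply/bigcupP; exists (ed rows (i, j0)); first exact: imset_f.
      by rewrite !inE (_ : j = Ordinal (jr j0)) ?eqxx ?orbT //; apply: val_inj.
  rewrite cardsE card_ffun_on card_prod !card_ord.
  by rewrite leq_exp2r // muln_gt0.
have cF : (#|RR| <= #|F| * (t * m) ^ (m * t))%N.
  rewrite -sum1_card (partition_big D (mem F)) /=; last by move=> rows h; apply: imset_f.
  rewrite -sum_nat_const; apply: leq_sum => D0 /fib; apply: leq_trans.
  by rewrite -sum1_card; apply: eq_leq; apply: eq_bigl => rows; rewrite inE.
have cRR : e * n.+1%:R ^+ (t * m) <= #|RR|%:R.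
  move: He; rewrite /mean card_tuple card_ord -expnM natrX ler_pdivlMr ?exprn_gt0 ?ltr0n //.
  move=> H; apply: le_trans H _; rewrite -sum1_card natr_sum [leRHS]big_mkcond /=.
  by apply: ler_sum => rows _; rewrite inE /good; case: (_ && _).
rewrite prob_ramseyE // Pr_compl // lerD2l lerN2.
have p0 : 0 < p.
  rewrite lt_neqAle (andP p01).1 andbT; apply: contraTneq Np => <-.
  by rewrite mulr0 ler10.
apply: le_trans (second_moment p01 (F := F) (k := k) p0 _ _ Np _ _).
- apply: Pr_le => // H HP; apply: contraR; rewrite negb_forall_in => /exists_inP[D1 /imsetP[rows + ->]].
  rewrite inE => g; rewrite negbK => /subsetP DH.
  have oK (z : 'I_(2 ^ r + 1)) (k' : 'I_K.+1) : (odd z * K.+1 + k' < t)%N.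
    exact: bool_block_lt.
  pose x z k' := y rows (half_part z) (Ordinal (oK z k')).
  apply: (HK _ _ x).
    move=> z z' k1 k2 /(yinj _ _ _ _ _ g) [/(congr1 val) /= E1 /(congr1 val) /= E2].
    have E : odd z = odd z' /\ k1 = k2 :> nat.
      exact: bool_block E2.
    split; apply: val_inj; last exact: E.2.
    by rewrite /= -(odd_double_half z) -(odd_double_half z') E.1 E1.
  move=> z z' k1 k2; rewrite inE; case: (eqVneq (half_part z) (half_part z')) => [E /= /andP[zz /eqP <-]|ne _].
    apply/orP; right; apply: DH; apply/imsetP; exists (half_part z, k1) => //.
    have Eo : odd z' = ~~ odd z by apply: half_eq_odd => //; move/(congr1 val): E.
    have xE (z0 : 'I_(2 ^ r + 1)) (j : 'I_t) : (odd z0 * K.+1 + k1 = j)%N -> x z0 k1 = y rows (half_part z0) j.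
      by move=> Ej; congr (y rows _ _); apply: val_inj.
    have y0 : y rows (half_part z) (Ordinal (jl k1)) \in [set x z k1; x z' k1] /\
              y rows (half_part z) (Ordinal (jr k1)) \in [set x z k1; x z' k1].
      move: Eo; case oz: (odd z) => /= oz'.
        rewrite (xE z (Ordinal (jr k1))) ?oz ?mul1n // (xE z' (Ordinal (jl k1))) ?oz' //.
        by rewrite -E !inE !eqxx ?orbT.
      rewrite (xE z (Ordinal (jl k1))) ?oz // (xE z' (Ordinal (jr k1))) ?oz' ?mul1n //.
      by rewrite -E !inE !eqxx ?orbT.
    apply/esym/eqP; rewrite eqEcard; apply/andP; split.
      by apply/subsetP => u; rewrite !inE => /orP[/eqP ->|/eqP ->]; rewrite -in_set2; [exact: y0.1|exact: y0.2].
    rewrite cards2; have := edP rows (half_part z, k1) g; rewrite inE => /eqP ->.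
    by case: eqP.
  by apply/orP; left; have /andP[] := yadj rows _ _ (Ordinal (oK z k1)) (Ordinal (oK z' k2)) g ne.
- by rewrite muln_gt0.
- by rewrite divr_gt0 ?exprn_gt0.
- by move=> D2 /imsetP[rows + ->]; rewrite inE; apply: DP.
(* The t m entries of the rows are the ends of the k matching edges, and a pair has at most n^2
   choices. *)
have NP : #|pairs n.+1|%:R ^+ k <= n.+1%:R ^+ (t * m) :> R.
  rewrite -!natrX ler_nat card_pairs (_ : t * m = 2 * k)%N; last by rewrite /t /k -mulnA (mulnC m).
  by rewrite expnM leq_exp2r ?muln_gt0 // bin_le_exp.
rewrite mulrAC ler_pdivrMr ?exprn_gt0 //; apply: le_trans (_ : #|RR|%:R <= _).
  by apply: le_trans cRR; rewrite ler_wpM2l // ltW.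
by rewrite -natrX -natrM ler_nat.
Qed.

Lemma upper_bound_sprinkle : upper_bound r l d (npow (-2)).
Proof.
move=> p p01 /omega_seqE om G /dense_seqE [gG [N1 HN1]].
have [k [N2 [dl dl0 H]]] := dense_sprinkle.
apply: cvg_of_bounds => e e0.
(* The factor 4 comes from n^2 <= 4 binom(n,2). The first entry ensures N p >= 1, the second makes
   the failure probability at most e. *)
pose A := Num.max 4 (4 * 2 ^+ k / (dl * e)).
have [N3 HN3] := om A.
exists (maxn (maxn N1 N2) (maxn N3 2)) => n; rewrite !geq_max => /andP[/andP[n1 n2] /andP[n3 n4]].
have n0 : 0 < n%:R :> R by rewrite ltr0n; lia.
have E : p n / npow (-2) n = p n * n%:R ^+ 2.
  by rewrite /npow powRN invrK powR_mulrn // ltW.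
have Cn : n%:R ^+ 2 <= 4 * #|pairs n|%:R :> R.
  rewrite card_pairs -natrX -natrM ler_nat.
  have := mul_bin_diag n 1; rewrite bin1; nia.
have [pn0 pn1] := andP (p01 n).
have Ap : A <= 4 * (#|pairs n|%:R * p n).
  apply: le_trans (HN3 n n3) _; rewrite E mulrC mulrA; exact: ler_wpM2r.
have A4 : 4 <= A by rewrite le_max lexx.
have Np : 1 <= #|pairs n|%:R * p n by lra.
have := H n (p n) (G n) n2 (p01 n) Np (gG n) (HN1 n n1).
have le1 : prob_ramsey_union r l (p n) (G n) <= 1.
  rewrite prob_ramseyE -(Pr_true n (p n)); exact: Pr_le.
have Np0 : 0 < #|pairs n|%:R * p n by lra.
have : 2 ^+ k / (dl * (#|pairs n|%:R * p n)) <= e.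
  rewrite ler_pdivrMr; last exact: mulr_gt0 dl0 Np0.
  have : 4 * 2 ^+ k / (dl * e) <= 4 * (#|pairs n|%:R * p n).
    by apply: le_trans Ap; rewrite le_max lexx orbT.
  rewrite ler_pdivrMr ?mulr_gt0 // => h.
  by rewrite -(ler_pM2l (_ : 0 < 4 :> R)) //; apply: le_trans h _; rewrite le_eqVlt; apply/orP; left; apply/eqP; ring.
by move=> h1 h2; rewrite ger0_norm; lra.
Qed.
End CommonUpper.

(** * Turan graphs and the sparse lower bounds *)

Lemma ordS_neq (l : nat) (i : 'I_l) : (2 <= l)%N -> ordS i != i.
Proof.
move=> l2; apply/eqP => /(congr1 val) /= E; have := ltn_ord i.
case: (ltnP i.+1 l) => h; first by move: E; rewrite modn_small // => /eqP; rewrite gtn_eqF.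
move=> il; have El : i.+1 = l by apply/anti_leq/andP.
by move: E; rewrite El modnn => E; move: l2; rewrite -El -E.
Qed.

Lemma ordSS_neq (l : nat) (i : 'I_l) : (3 <= l)%N -> ordS (ordS i) != i.
Proof.
move=> l3; apply/eqP => /(congr1 val) /=; rewrite -addn1 modnDml addn1.
have il := ltn_ord i; case: (ltnP i.+2 l) => h; first by rewrite modn_small // => /eqP; lia.
have -> : (i.+2 = l + (i.+2 - l))%N by lia.
by rewrite modnDl modn_small; lia.
Qed.

Section CycleEdges.
Variables (n l : nat).

Definition cycle_edges (v : {ffun 'I_l -> 'I_n}) : {set {set 'I_n}} :=
  [set [set v i; v (ordS i)] | i in 'I_l].

Lemma cycle_edge_inj (v : {ffun 'I_l -> 'I_n}) : (3 <= l)%N -> injective v ->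
  injective (fun i => [set v i; v (ordS i)]).
Proof.
move=> l3 vi i j /setP E; have := E (v i); have := E (v (ordS i)).
rewrite !inE !eqxx /= orbT => /esym/orP[/eqP/vi e1|/eqP/vi e1] /esym/orP[/eqP/vi e2|/eqP/vi e2] //.
- have := ordSS_neq j l3; rewrite -e2 e1 eqxx //.
- by have := ordS_neq i (ltnW l3); rewrite e1 -e2 eqxx.
Qed.

Lemma card_cycle_edges (v : {ffun 'I_l -> 'I_n}) : (3 <= l)%N -> injective v ->
  #|cycle_edges v| = l.
Proof. by move=> l3 vi; rewrite card_imset ?card_ord //; apply: cycle_edge_inj. Qed.

Lemma cycle_edges_pairs (v : {ffun 'I_l -> 'I_n}) : (2 <= l)%N -> injective v ->
  cycle_edges v \subset pairs n.
Proof.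
move=> l2 vi; apply/subsetP => _ /imsetP[i _ ->]; rewrite inE cards2.
by rewrite (inj_eq vi) [i == _]eq_sym ordS_neq.
Qed.
End CycleEdges.

Lemma mono_cycleP (n r l : nat) (G : {set {set 'I_n}}) (c : {ffun {set 'I_n} -> 'I_r}) :
  reflect (exists v : {ffun 'I_l -> 'I_n}, exists k : 'I_r, [/\ injective v,
     cycle_edges v \subset G & forall e, e \in cycle_edges v -> c e = k])
  (Defs.mono_cycle l G c).
Proof.
apply: (iffP existsP) => -[v].
  case/existsP=> k /andP[/injectiveP vi /forallP H]; exists v, k; split=> //.
    by apply/subsetP => _ /imsetP[i _ ->]; have /andP[] := H i.
  by move=> _ /imsetP[i _ ->]; have /andP[_ /eqP] := H i.
case=> k [vi /subsetP vG H]; exists v; apply/existsP; exists k; apply/andP; split.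
  exact/injectiveP.
apply/forallP => i; have ei : [set v i; v (ordS i)] \in cycle_edges v by apply: imset_f.
by rewrite vG //= H.
Qed.

Lemma odd_alternate (l : nat) (b : 'I_l -> bool) : odd l -> ~ (forall i, b (ordS i) != b i).
Proof.
case: l b => // l b ol H.
have E i : (i < l.+1)%N -> b (inord i) = b ord0 (+) odd i.
  elim: i => [_|i IH il].
    by rewrite addbF; congr b; apply: val_inj; rewrite /= inordK.
  have il' : (i < l.+1)%N by apply: ltnW.
  have := H (inord i); have -> : ordS (inord i) = inord i.+1 :> 'I_l.+1.
    by apply: val_inj; rewrite /= !inordK // modn_small.
  rewrite IH //= addbN; by case: (b (inord _)); case: (_ (+) _).
have := H (inord l); have -> : ordS (inord l) = ord0 :> 'I_l.+1.
  by apply: val_inj; rewrite /= inordK // modnn.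
by rewrite E //; move: ol => /= /negbTE ->; rewrite addbF eqxx.
Qed.

Section Turan.
Variable n : nat.

Definition turan (q : nat) : {set {set 'I_n}} :=
  [set e in pairs n | [exists u in e, exists v in e, (u %% q != v %% q)%N]].

Lemma turan_graph q : is_graph (turan q).
Proof. by apply/subsetP => e; rewrite inE => /andP[]. Qed.

Lemma congr_count (q : nat) (u : 'I_n) :
  (#|[set v : 'I_n | (v < u)%N && (v %% q == u %% q)]| <= u %/ q)%N.
Proof.
set A := [set v | _]; rewrite cardE -(size_map (fun v : 'I_n => v %/ q)%N) -(size_iota 0 (u %/ q)).
apply: uniq_leq_size.
  rewrite map_inj_in_uniq ?enum_uniq // => v w; rewrite !mem_enum !inE => /andP[_ /eqP ev] /andP[_ /eqP ew] E.
  by apply: val_inj; rewrite /= (divn_eq v q) (divn_eq w q) E ev ew.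
move=> _ /mapP[v + ->]; rewrite mem_enum inE mem_iota add0n leq0n /= => /andP[vu /eqP E].
move: vu; rewrite {1}(divn_eq v q) {1}(divn_eq u q) E ltn_add2r.
by rewrite ltn_mul2r => /andP[].
Qed.

(** Vertex u has at most floor(u/q) smaller vertices in its class, and the sum of all u is
    binom(n,2). There is no error term, so the density reaches 1 - 1/q for every n, as the closed
    right end of each range of d requires. *)
Lemma turan_missing q : (q * #|pairs n :\: turan q| <= 'C(n, 2))%N.
Proof.
set S := _ :\: _; have gS : is_graph S by apply: subsetDl.
have := card_edges gS; set f := fun u v : 'I_n => (u != v) && ([set u; v] \in S).
have fs u v : f u v = f v u by rewrite /f eq_sym setUC.
have ff u : f u u = false by rewrite /f eqxx.
have -> : (\sum_u \sum_v f u v = 2 * \sum_(u : 'I_n) \sum_(v : 'I_n | v < u) f u v)%N.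
  have E2 : (\sum_(u : 'I_n) \sum_(v : 'I_n | v < u) f u v =
             \sum_(u : 'I_n) \sum_(v : 'I_n | u < v) f u v)%N.
    by rewrite (exchange_big_dep xpredT) //=; apply: eq_bigr => u _; apply: eq_bigr => v _; rewrite fs.
  rewrite mul2n -addnn {2}E2 -big_split /=; apply: eq_bigr => u _.
  rewrite (bigID (fun v : 'I_n => (v < u)%N)) /=; congr addn.
  rewrite (bigD1 u) ?ltnn //= ff add0n; apply: eq_bigl => v.
  by rewrite -leqNgt ltn_neqAle andbC -val_eqE eq_sym.
move=> /eqP; rewrite eqn_pmul2l // => /eqP <-.
rewrite -bin2_sum big_mkord big_distrr /=; apply: leq_sum => u _.
apply: leq_trans (_ : q * (u %/ q) <= _)%N; last by rewrite mulnC leq_divM.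
rewrite leq_mul2l; apply/orP; right; apply: leq_trans (congr_count q u).
rewrite -sum1_card big_mkcond [leqRHS]big_mkcond /=; apply: leq_sum => v _.
rewrite inE; case: ifP => //= vu; case E: (f u v) => //=.
move: E; rewrite /f !inE => /and3P[uv + uvP]; rewrite uvP /= negb_exists => /forallP/(_ u).
rewrite !inE eqxx /= negb_exists => /forallP/(_ v); rewrite !inE eqxx orbT /= negbK eq_sym => ->.
by [].
Qed.

Lemma turan_density (R : realType) q : (0 < q)%N -> (2 <= n)%N ->
  1 - q%:R^-1 <= density R (turan q).
Proof.
move=> q0 n2; have C0 : (0 < 'C(n, 2))%N by rewrite bin_gt0.
have C0' : 0 < ('C(n, 2))%:R :> R by rewrite ltr0n.
have q0' : 0 < q%:R :> R by rewrite ltr0n.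
rewrite /density ler_pdivlMr // mulrBl mul1r lerBlDr.
have gT : turan q \subset pairs n := turan_graph q.
have := turan_missing q; rewrite cardsDS // card_pairs => H.
have le : (#|turan q| <= 'C(n, 2))%N by rewrite -card_pairs subset_leq_card // turan_graph.
rewrite -lerBlDl -natrB // ler_pdivlMl // -natrM ler_nat //.
Qed.
End Turan.

Lemma modn_double (u m : nat) : (0 < m)%N -> (u %% (2 * m) = odd u + 2 * (u./2 %% m))%N.
Proof.
move=> m0; have := divn_eq u./2 m; set a := (_ %/ _)%N; set b := (_ %% _)%N => E.
have bm : (b < m)%N by rewrite ltn_mod.
rewrite -{1}(odd_double_half u) [in LHS]E -mul2n mulnDr addnCA mulnCA modnMDl modn_small //.
by case: odd; lia.
Qed.

Lemma bits_modn (k u v : nat) :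
  (forall j, (j < k)%N -> odd (u %/ 2 ^ j) = odd (v %/ 2 ^ j)) -> (u %% 2 ^ k = v %% 2 ^ k)%N.
Proof.
elim: k u v => [|k IH] u v H; first by rewrite !modn1.
rewrite expnS !modn_double ?expn_gt0 //; have := H 0%N isT; rewrite !divn1 => ->.
congr (_ + 2 * _)%N; apply: IH => j jk; have := H j.+1 jk.
by rewrite expnS !divnMA !divn2.
Qed.

(* An edge across the parts is coloured by a bit in which its ends differ, so these k colour classes
   are bipartite; the remaining edges keep the colour c0. *)
Lemma not_ramsey_turan (n r l k : nat) (H : {set {set 'I_n}}) (c0 : {ffun {set 'I_n} -> 'I_r}) :
  odd l -> (k <= r)%N -> (forall e, e \in H -> (k <= c0 e)%N) ->
  ~~ Defs.mono_cycle l H c0 -> ~~ ramsey_cycle r l (turan n (2 ^ k) :|: H).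
Proof.
move=> ol kr Hc0 nomono.
pose bit (j : nat) (u : 'I_n) := odd (u %/ 2 ^ j).
pose diff (e : {set 'I_n}) (j : 'I_r) := (j < k)%N && [exists u in e, exists v in e, bit j u != bit j v].
pose c := [ffun e => if [pick j | diff e j] is Some j then j else c0 e].
rewrite negb_forall; apply/existsP; exists c; apply: contra nomono => /mono_cycleP[v [kk [vi vG vk]]].
have found e : e \in turan n (2 ^ k) -> exists j, diff e j.
  rewrite inE => /andP[_ /exists_inP[u ue /exists_inP[w we uw]]].
  have [j jk bj] : exists2 j, (j < k)%N & bit j u != bit j w.
    apply: contrapT => Hno; move/negP: uw; apply; apply/eqP; apply: bits_modn => j jk.
    by apply/eqP; apply: contraT => h; exfalso; apply: Hno; exists j.
  exists (Ordinal (leq_trans jk kr)); rewrite /diff jk /=.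
  by apply/exists_inP; exists u => //; apply/exists_inP; exists w.
case: (ltnP kk k) => kkk.
  exfalso; apply: (@odd_alternate l (fun i => bit kk (v i)) ol) => i.
  have ei : [set v i; v (ordS i)] \in cycle_edges v by apply: imset_f.
  have := vk _ ei; rewrite ffunE; case: pickP => [j /andP[_ /exists_inP[u + /exists_inP[w]]]|noj].
    rewrite !inE => /orP[/eqP ->|/eqP ->] /orP[/eqP ->|/eqP ->] + Ej; subst j; rewrite ?eqxx //.
    by rewrite eq_sym.
  move=> E; have := subsetP vG _ ei; rewrite inE => /orP[/found[j]|eH]; first by rewrite noj.
  by have := Hc0 _ eH; rewrite E leqNgt kkk.
apply/mono_cycleP; exists v, kk.
have Hin e : e \in cycle_edges v -> e \in H /\ c0 e = kk.
  move=> ev; have := vk e ev; rewrite ffunE; case: pickP => [j /andP[jk _] Ej|noj E].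
    by move: jk; rewrite Ej ltnNge kkk.
  split=> //; have := subsetP vG _ ev; rewrite inE => /orP[/found[j]|//]; by rewrite noj.
by split=> // [|e /Hin[]//]; apply/subsetP => e /Hin[].
Qed.

Section LowerBounds.
Variables (R : realType) (r l k : nat) (d : R).
Hypothesis dk : d <= 1 - 2 ^- k.

Lemma lower_bound_turan (p : nat -> R) : prob_seq p ->
  (forall e : R, 0 < e -> exists N : nat, forall n, (N <= n)%N ->
     prob_ramsey_union r l (p n) (turan n (2 ^ k)) <= e) ->
  exists G : forall n, {set {set 'I_n}}, dense_seq d G /\
    ((fun n => 1 - prob_ramsey_union r l (p n) (G n)) @ \oo --> (1 : R))%classic.
Proof.
move=> p01 H; exists (fun n => turan n (2 ^ k)); split.
  apply: (@dense_seqI _ _ _ 2) => n; first exact: turan_graph.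
  move=> n2; apply: le_trans dk _; have := @turan_density n R (2 ^ k) _ n2.
  by rewrite natrX; apply; rewrite expn_gt0.
apply: cvg_of_bounds => e /H[N HN]; exists N => n /HN.
by rewrite opprB addrCA subrr addr0 ger0_norm // prob_ramseyE Pr_ge0.
Qed.
End LowerBounds.

Section LowerBoundsSparse.
Variables (R : realType) (r l : nat) (d : R).
Hypothesis lo : odd l.
Hypothesis l3 : (3 <= l)%N.
Hypothesis r0 : (0 < r)%N.

Lemma lower_bound_empty : d <= 1 - 2 ^- r -> lower_bound r l d (npow (-2)).
Proof.
move=> dr p p01 /little_o_seqE po; apply: (lower_bound_turan dr p01) => e e0.
have [N HN] := po e e0; exists (maxn N 1) => n; rewrite geq_max => /andP[Nn n1].
have n0 : 0 < n%:R :> R by rewrite ltr0n.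
have [pn0 _] := andP (p01 n).
rewrite prob_ramseyE; apply: le_trans (_ : \sum_(x in pairs n) p n ^+ #|[set x]| <= _).
  apply: (Pr_union_sub (p01 n)) => [x xP|H HP]; first by rewrite sub1set.
  case: (set_0Vmem H) => [->|[x xH] _]; last by exists x; rewrite ?sub1set // (subsetP HP).
  move=> Hr; exfalso; move: Hr; apply/negP.
  have c00 : 'I_r by exact: Ordinal r0.
  apply: (@not_ramsey_turan n r l r set0 [ffun=> Ordinal r0] lo (leqnn r)) => [x|].
    by rewrite inE.
  apply/mono_cycleP => -[v [kk [_ /subsetP vs _]]].
  have i0 : 'I_l by apply: Ordinal (ltnW (ltnW l3)).
  have := vs [set v i0; v (ordS i0)]; rewrite inE => H0.
  by have /H0 : [set v i0; v (ordS i0)] \in cycle_edges v by apply: imset_f.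
under eq_bigr do rewrite cards1 expr1.
rewrite sumr_const card_pairs -[_ *+ _]mulr_natr.
apply: le_trans (_ : p n * n%:R ^+ 2 <= _).
  by rewrite ler_wpM2l // -natrX ler_nat bin_le_exp.
apply: le_trans (HN n Nn); apply: le_trans (ler_norm _).
by rewrite /npow powRN invrK powR_mulrn // ltW.
Qed.

(** The expected number of labelled l-cycles in G(n,p) is at most (n p)^l. *)
Lemma lower_bound_cycle_free : d <= 1 - 2 ^- (r - 1) -> lower_bound r l d (npow (-1)).
Proof.
move=> dr p p01 /little_o_seqE po; apply: (lower_bound_turan dr p01) => e e0.
have m0 : 0 < Num.min e 1 by rewrite lt_min e0 ltr01.
have [N HN] := po _ m0; exists (maxn N 1) => n; rewrite geq_max => /andP[Nn n1].
have n0 : 0 < n%:R :> R by rewrite ltr0n.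
have [pn0 _] := andP (p01 n).
have pe : n%:R * p n <= Num.min e 1.
  apply: le_trans (HN n Nn); apply: le_trans (ler_norm _).
  by rewrite /npow powRN invrK powRr1 1?mulrC // ltW.
rewrite prob_ramseyE.
apply: le_trans (_ : \sum_(v : {ffun 'I_l -> 'I_n} | injectiveb v) p n ^+ #|cycle_edges v| <= _).
  apply: (Pr_union_sub (p01 n)) => [v /injectiveP vi|H HP Hr].
    by apply: cycle_edges_pairs => //; apply: ltnW.
  have rr : (r - 1 < r)%N by rewrite subn1 prednK.
  have [|] := boolP (Defs.mono_cycle l H [ffun=> Ordinal rr]).
    by move=> /mono_cycleP[v [kk [vi vH _]]]; exists v => //; apply/injectiveP.
  move=> /(@not_ramsey_turan n r l (r - 1) H [ffun=> Ordinal rr] lo (leq_subr 1 r)).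
  move=> h; exfalso; apply: (elimN idP (h _) Hr) => e1 _; rewrite ffunE /=; exact: leqnn.
rewrite (eq_bigr (fun=> p n ^+ l)) => [|v /injectiveP vi]; last by rewrite card_cycle_edges.
apply: le_trans (_ : (n%:R * p n) ^+ l <= _).
  rewrite sumr_const exprMn -[leLHS]mulr_natl -natrX ler_wpM2r ?exprn_ge0 //.
  by rewrite ler_nat; apply: leq_trans (max_card _) _; rewrite card_ffun !card_ord.
have np0 : 0 <= n%:R * p n by rewrite mulr_ge0.
apply: le_trans (_ : Num.min e 1 ^+ l <= _); first by apply: lerXn2r; rewrite ?nnegrE // ltW.
apply: le_trans (_ : Num.min e 1 ^+ 1 <= _); last by rewrite expr1 ge_min lexx.
by apply: ler_wiXn2l => //; [exact: ltW|rewrite ge_min lexx orbT|exact: (ltnW (ltnW l3))].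
Qed.
End LowerBoundsSparse.

(** * Two-colour Ramsey graphs are unlikely below the threshold *)

Lemma ler_sum_imset (R : numDomainType) (I J : finType) (P : {pred I}) (h : I -> J) (f : J -> R) :
  (forall j, 0 <= f j) -> \sum_(j in [set h i | i in P]) f j <= \sum_(i in P) f (h i).
Proof.
move=> f0; rewrite (partition_big_imset h) /=; apply: ler_sum => j /imsetP[i Pi ->].
by rewrite (bigD1 i) /= ?Pi ?eqxx // lerDl sumr_ge0.
Qed.

Lemma sum_subsets (R : comRingType) (T : finType) (P : {set T}) (x : R) :
  \sum_(A : {set T} | A \subset P) x ^+ #|A| = (1 + x) ^+ #|P|.
Proof.
have := @bigA_distr R 0 1 *%R +%R T (fun e => if e \in P then x else 0) (fun=> 1).
have -> : \prod_i ((if i \in P then x else 0) + 1) = (1 + x) ^+ #|P|.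
  rewrite -prodr_const [RHS]big_mkcond; apply: eq_bigr => i _.
  by case: ifP => _; rewrite ?add0r // addrC.
move=> ->; rewrite big_mkcond; apply: eq_bigr => A _.
case: ifP => [AP|/negbT/subsetPn[e eA eP]]; last by rewrite (bigD1 e) //= eA (negbTE eP) mul0r.
rewrite -prodr_const big_mkcond; apply: eq_bigr => e _.
by case: ifP => // /(subsetP AP) ->.
Qed.

Lemma ordS_ind (l : nat) (P : 'I_l -> Prop) (i0 : 'I_l) :
  P i0 -> (forall i, P i -> P (ordS i)) -> forall i, P i.
Proof.
case: l P i0 => [|l] P i0; first by case: i0.
move=> P0 PS i.
have H k : P (inord ((i0 + k) %% l.+1)).
  elim: k => [|k IH]; first by rewrite addn0 modn_small // inord_val.
  have := PS _ IH; congr P; apply: val_inj.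
  by rewrite /= !inordK ?ltn_mod // -addn1 modnDml addn1 addnS.
have := H (i + (l.+1 - i0))%N; congr P; apply: val_inj.
rewrite /= inordK ?ltn_mod // addnCA subnKC; last exact: ltnW.
by rewrite modnDr modn_small.
Qed.

Lemma prod_two_special (R : numDomainType) (l : nat) (i0 : 'I_l) (s : 'I_l -> R) (c : R) :
  (2 <= l)%N -> (forall i, 0 <= s i) ->
  (forall i, (i == i0) || (i == ordS i0) -> s i = 2) ->
  (forall i, ~~ ((i == i0) || (i == ordS i0)) -> s i <= c) ->
  \prod_i s i <= 4 * c ^+ (l - 2).
Proof.
move=> l2 s0 S1 S2.
rewrite (bigD1 i0) //= (bigD1 (ordS i0)) /=; last exact: ordS_neq.
rewrite (S1 i0) ?eqxx // (S1 (ordS i0)) ?eqxx ?orbT // mulrA.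
have -> : 2 * 2 = 4 :> R by rewrite -natrM.
apply: ler_wpM2l => //.
have -> : (l - 2 = #|[pred i | (i != i0) && (i != ordS i0)]|)%N.
  have := cardC [set i0; ordS i0]; rewrite cards2 [i0 == _]eq_sym ordS_neq // card_ord => E.
  by rewrite -[in LHS]E addKn; apply: eq_card => i; rewrite !inE negb_or.
rewrite -prodr_const; apply: ler_prod => i /andP[h1 h2]; rewrite s0 /=.
by apply: S2; rewrite negb_or h1.
Qed.

Section Closed.
Variables (n l : nat).
Hypothesis l3 : (3 <= l)%N.
Implicit Types (F G : {set {set 'I_n}}) (e : {set 'I_n}) (v w : {ffun 'I_l -> 'I_n}).

Definition closed_in F e := [exists v : {ffun 'I_l -> 'I_n}, exists w : {ffun 'I_l -> 'I_n},
  [&& injectiveb v, injectiveb w, cycle_edges v \subset F, cycle_edges w \subset F &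
      cycle_edges v :&: cycle_edges w == [set e]]].

Definition all_closed F := [forall e in F, closed_in F e].

(** By minimality F without e has a colouring with no monochromatic cycle. Giving e either colour
    creates one through e, and the two cycles so obtained have different colours away from e. *)
Lemma minimal_closed H : ramsey_cycle 2 l H ->
  exists F, [/\ F \subset H, F != set0 & all_closed F].
Proof.
move=> rH; have [F /minsetP[rF minF] FH] := minset_exists rH.
have l0 : (0 < l)%N by apply: leq_trans l3.
exists F; split=> //.
  apply/eqP => F0; have /forallP/(_ [ffun=> ord0])/mono_cycleP[v [k [_ + _]]] := rF.
  rewrite F0 subset0 => /eqP E; have : [set v (Ordinal l0); v (ordS (Ordinal l0))] \in cycle_edges v.
    exact: imset_f.
  by rewrite E inE.
apply/forall_inP => e eF.
have nF : ~~ ramsey_cycle 2 l (F :\ e).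
  apply/negP => /minF /(_ (subsetDl _ _)) E; by move: eF; rewrite -E !inE eqxx.
move: nF; rewrite negb_forall => /existsP[c nc].
have Hb (b : 'I_2) : exists v, [/\ injective v, cycle_edges v \subset F, e \in cycle_edges v
    & forall e', e' \in cycle_edges v -> e' != e -> c e' = b].
  have /forallP/(_ [ffun e' => if e' == e then b else c e'])/mono_cycleP[v [k [vi vF vk]]] := rF.
  have ev : e \in cycle_edges v.
    apply: contraNT nc => ev; apply/mono_cycleP; exists v, k; split=> //.
      rewrite subsetD1 vF; exact: ev.
    move=> e' e'v; have := vk e' e'v; rewrite ffunE; case: eqP => // E.
    by move: ev; rewrite -E e'v.
  exists v; split=> // e' e'v ne; have := vk e' e'v; have := vk e ev.
  by rewrite !ffunE eqxx (negbTE ne) => -> ->.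
have [v [vi vF ev vc]] := Hb ord0; have [w [wi wF ew wc]] := Hb ord_max.
apply/existsP; exists v; apply/existsP; exists w; apply/and5P; split=> //; try exact/injectiveP.
apply/eqP/setP => e'; rewrite !inE; case: (eqVneq e' e) => [->|ne]; first by rewrite ev ew.
apply/negbTE/negP => /andP[/vc/(_ ne) h1 /wc/(_ ne)]; by rewrite h1.
Qed.

Lemma cover_edge F e u : e \in F -> u \in e -> u \in cover F.
Proof. by move=> eF ue; apply/bigcupP; exists e. Qed.

Lemma cycle_two_edges v e u : injective v -> e \in cycle_edges v -> u \in e ->
  exists f, [/\ f \in cycle_edges v, u \in f & f != e].
Proof.
move=> vi ev ue.
have [i Ei] : exists i, u = v i.
  case/imsetP: ev ue => i _ ->; rewrite !inE => /orP[/eqP ->|/eqP ->]; by [exists i|exists (ordS i)].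
have f1 : [set v i; v (ordS i)] \in cycle_edges v by apply: imset_f.
have f2 : [set v (ord_pred i); v (ordS (ord_pred i))] \in cycle_edges v by apply: imset_f.
case: (eqVneq [set v i; v (ordS i)] e) => [E|ne]; last by exists [set v i; v (ordS i)]; rewrite f1 Ei !inE eqxx.
exists [set v (ord_pred i); v (ordS (ord_pred i))]; split=> //; first by rewrite Ei ord_predK !inE eqxx orbT.
rewrite -E; apply/eqP => /(cycle_edge_inj l3 vi) E2.
by have := ordS_neq i (ltnW l3); rewrite -{1}E2 ord_predK eqxx.
Qed.

(** An edge at u continues differently along the two cycles that share only this edge. *)
Lemma closed_degree F u : all_closed F -> u \in cover F -> (3 <= #|[set e in F | u \in e]|)%N.
Proof.
move=> /forall_inP cF /bigcupP[e eF ue].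
have /existsP[v /existsP[w /and5P[/injectiveP vi /injectiveP wi vF wF /eqP vw]]] := cF e eF.
have : e \in cycle_edges v :&: cycle_edges w by rewrite vw inE.
rewrite inE => /andP[ev ew].
have [f [fv uf fe]] := cycle_two_edges vi ev ue.
have [g [gw ug ge]] := cycle_two_edges wi ew ue.
have fg : f != g.
  apply: contraNneq fe => E; have : f \in cycle_edges v :&: cycle_edges w by rewrite inE fv E gw.
  by rewrite vw inE.
apply: leq_trans (_ : #|[set e; f; g]| <= _)%N.
  by rewrite setUC cardsU1 cards2 !inE (negbTE ge) [g == f]eq_sym (negbTE fg) [e == f]eq_sym fe.
apply: subset_leq_card; apply/subsetP => x; rewrite !inE => /orP[/orP[]|] /eqP ->.
- by rewrite eF.
- by rewrite (subsetP vF _ fv).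
- by rewrite (subsetP wF _ gw).
Qed.

Lemma closed_dense F : F \subset pairs n -> all_closed F -> (3 * #|cover F| <= 2 * #|F|)%N.
Proof.
move=> FP cF.
have -> : (2 * #|F| = \sum_(e in F) \sum_(u in e) 1)%N.
  rewrite (eq_bigr (fun=> 2%N)) => [|e /(subsetP FP)]; last by rewrite inE sum1_card => /eqP.
  by rewrite sum_nat_const mulnC.
rewrite (exchange_big_dep (mem (cover F))) /=; last by move=> e u; apply: cover_edge.
rewrite mulnC -sum_nat_const; apply: leq_sum => u uF.
apply: leq_trans (closed_degree cF uF) _; rewrite -sum1_card.
by apply: eq_leq; apply: eq_bigl => e; rewrite inE.
Qed.

(** The edge to be extended is a function of F, so a step of the process costs only the choice of a
    cycle through it. *)
Definition pick_open F : {set 'I_n} := odflt set0 [pick e in F | ~~ closed_in F e].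

Definition extends F v := [&& injectiveb v, pick_open F \in F, pick_open F \in cycle_edges v &
  ~~ (cycle_edges v \subset F)].

Fixpoint chain i : {set {set {set 'I_n}}} :=
  if i is j.+1 then [set u.1 :|: cycle_edges u.2 |
     u in [set u : {set {set 'I_n}} * {ffun 'I_l -> 'I_n} | (u.1 \in chain j) && extends u.1 u.2]]
  else [set [set e] | e in pairs n].

(** While the current subgraph G of F has an open edge, the two cycles of F that meet exactly in
    this edge cannot both lie in G, so one of them can be added without leaving F. *)
Lemma chain_grow F T : F \subset pairs n -> F != set0 -> all_closed F ->
  (exists2 G, G \in chain T & G \subset F) \/
  (exists2 i, (i < T)%N & exists2 G, G \in chain i & (G \subset F) && all_closed G).
Proof.
move=> FP /set0Pn[e0 e0F] cF; elim: T => [|T [[G Gc GF]|[i iT H]]].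
- left; exists [set e0]; last by rewrite sub1set.
  by apply: imset_f; apply: (subsetP FP).
- case: (boolP (all_closed G)) => cG; first by right; exists T => //; exists G; rewrite // GF.
  left; move: cG; rewrite negb_forall_in => /exists_inP[e eG ne].
  have [oG oc] : pick_open G \in G /\ ~~ closed_in G (pick_open G).
    by rewrite /pick_open; case: pickP => [x /andP[]//|/(_ e)]; rewrite eG ne.
  have /existsP[v /existsP[w /and5P[vi wi vF wF vw]]] := forall_inP cF _ (subsetP GF _ oG).
  have : pick_open G \in cycle_edges v :&: cycle_edges w by rewrite (eqP vw) inE.
  rewrite inE => /andP[ov ow].
  have [x [xi ox xF xG]] : exists x : {ffun 'I_l -> 'I_n}, [/\ injectiveb x, pick_open G \in cycle_edges x,
       cycle_edges x \subset F & ~~ (cycle_edges x \subset G)].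
    case: (boolP (cycle_edges v \subset G)) => vG; last by exists v.
    case: (boolP (cycle_edges w \subset G)) => wG; last by exists w.
    exfalso; move/negP: oc; apply; apply/existsP; exists v; apply/existsP; exists w.
    exact/and5P.
  exists (G :|: cycle_edges x); last by rewrite subUset GF.
  apply/imsetP; exists (G, x) => //; rewrite inE /= Gc /extends xi oG ox xG //.
- by right; exists i => //; apply: ltnW.
Qed.

Lemma chain_props i F : F \in chain i -> F \subset pairs n /\ (#|cover F| <= 2 + l * i)%N.
Proof.
elim: i F => [|i IH] F /=.
  case/imsetP=> e eP ->; rewrite sub1set eP muln0 addn0; split=> //.
  by rewrite /cover big_set1; move: eP; rewrite inE => /eqP ->.
case/imsetP=> -[G v] /=; rewrite inE /= => /andP[/IH[GP Gc] /and4P[/injectiveP vi _ _ _]] ->.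
split; first by rewrite subUset GP cycle_edges_pairs // ltnW.
rewrite /cover bigcup_setU -/(cover G) -/(cover (cycle_edges v)).
apply: leq_trans (leq_card_setU _ _) _; rewrite mulnS addnCA addnC; apply: leq_add => //.
apply: leq_trans (_ : #|[set v i | i in 'I_l]| <= _)%N; last first.
  by apply: leq_trans (leq_imset_card _ _) _; rewrite card_ord.
apply: subset_leq_card; apply/subsetP => u /bigcupP[_ /imsetP[j _ ->]].
by rewrite !inE => /orP[/eqP ->|/eqP ->]; apply: imset_f.
Qed.

(** Every cycle edge at a new vertex is new. Going round from the old vertex [v i0], the edge that
    enters a run of new vertices comes on top of the edges that start at new vertices. *)
Lemma missing_edges F v (i0 : 'I_l) : injective v -> F \subset pairs n ->
  ~~ (cycle_edges v \subset F) -> v i0 \in cover F ->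
  (#|[set i | v i \notin cover F]| < #|cycle_edges v :\: F|)%N.
Proof.
move=> vi FP vF v0; set O := [set i | _].
pose B := O :|: [set i | ordS i \in O].
have BF : (#|B| <= #|cycle_edges v :\: F|)%N.
  rewrite -(card_imset _ (cycle_edge_inj l3 vi)); apply: subset_leq_card.
  apply/subsetP => _ /imsetP[i iB ->].
  have ev : [set v i; v (ordS i)] \in cycle_edges v by apply: imset_f.
  rewrite inE ev andbT.
  apply/negP => eF; move: iB; rewrite !inE => /orP[|] /negP; apply; apply: cover_edge eF _;
    by rewrite !inE eqxx ?orbT.
case: (set_0Vmem O) => [EO|[x xO]].
  rewrite EO cards0 card_gt0; apply: contra vF => /eqP E.
  by rewrite -setD_eq0 E.
apply: leq_trans BF; apply: proper_card; rewrite properE subsetUl /=.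
apply/negP => /subsetP BO; have : i0 \notin O by rewrite inE negbK.
have step i : i \notin O -> ordS i \notin O.
  by apply: contra => h; apply: BO; rewrite inE [X in _ || X]inE h orbT.
move=> h0; have := @ordS_ind l (fun i => i \notin O) i0 h0 step x.
by rewrite xO.
Qed.

Section Weights.
Variables (R : realType) (p : R).
Hypothesis p01 : 0 <= p <= 1.

(** The place i0 of the open edge in the cycle gives the factor l, its two ends at most 4. Every
    other vertex is old, with |X| choices, or new, with n choices and a factor p; the surplus new
    edge gives the last p. *)
Lemma extension_weight F : F \subset pairs n ->
  \sum_(v | extends F v) p ^+ #|cycle_edges v :\: F| <=
  (4 * l)%:R * p * (#|cover F|%:R + n%:R * p) ^+ (l - 2).
Proof.
move=> FP; have [p0 p1] := andP p01; set X := cover F; set e := pick_open F.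
pose g (i0 i : 'I_l) (u : 'I_n) : R :=
  if (i == i0) || (i == ordS i0) then (u \in e)%:R else if u \in X then 1 else p.
have g0 i0 i u : 0 <= g i0 i u by rewrite /g; case: ifP => // _; case: ifP.
case: (boolP (e \in F)) => eF; last first.
  rewrite big1 => [|v /and4P[_ h]]; last by rewrite /e h in eF.
  by rewrite mulr_ge0 ?exprn_ge0 ?addr_ge0 ?mulr_ge0.
apply: le_trans (_ : \sum_(i0 : 'I_l) \sum_(v : {ffun 'I_l -> 'I_n}) p * \prod_i g i0 i (v i) <= _).
  rewrite exchange_big /= big_mkcond /=; apply: ler_sum => v _.
  have nn i0 : 0 <= p * \prod_i g i0 i (v i) by rewrite mulr_ge0 ?prodr_ge0.
  case: ifP => [/and4P[/injectiveP vi _ /imsetP[i0 _ Ee] vF]|_]; last by rewrite sumr_ge0.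
  rewrite (bigD1 i0) //=; apply: le_trans (_ : p * \prod_i g i0 i (v i) <= _); last first.
    by rewrite lerDl sumr_ge0.
  have ve j : (j == i0) || (j == ordS i0) -> v j \in e.
    by rewrite /e Ee !inE => /orP[/eqP ->|/eqP ->]; rewrite eqxx ?orbT.
  have vX j : (j == i0) || (j == ordS i0) -> v j \in X.
    by move=> h; apply: cover_edge eF _; apply: ve.
  have -> : \prod_i g i0 i (v i) = p ^+ #|[set i | v i \notin X]|.
    rewrite -prodr_const [RHS]big_mkcond; apply: eq_bigr => i _; rewrite inE /g.
    case: ifP => h; first by rewrite ve // vX.
    by case: (v i \in X).
  rewrite -exprS; apply: ler_wiXn2l => //.
  by apply: (missing_edges (i0 := i0) vi FP vF); apply: vX; rewrite eqxx.
have inner i0 : \sum_(v : {ffun 'I_l -> 'I_n}) p * \prod_i g i0 i (v i) <=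
    p * (4 * (#|X|%:R + n%:R * p) ^+ (l - 2)).
  rewrite -mulr_sumr; apply: ler_wpM2l => //.
  rewrite -(bigA_distr_bigA (g i0)) /=.
  have S1 i : (i == i0) || (i == ordS i0) -> \sum_u g i0 i u = 2.
    move=> h; rewrite /g h -natr_sum -big_mkcond sum1_card.
    by have := subsetP FP _ eF; rewrite inE => /eqP ->.
  have S2 i : ~~ ((i == i0) || (i == ordS i0)) -> \sum_u g i0 i u <= #|X|%:R + n%:R * p.
    move=> h; rewrite /g (negbTE h).
    apply: le_trans (_ : \sum_u ((u \in X)%:R + p) <= _).
      by apply: ler_sum => u _; case: (u \in X); rewrite ?lerDl ?add0r.
    rewrite big_split /= -natr_sum -big_mkcond sum1_card sumr_const card_ord.
    by rewrite -[p *+ n]mulr_natl.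
  apply: (prod_two_special (s := fun i => \sum_u g i0 i u) (ltnW l3) _ S1 S2) => i.
  exact: sumr_ge0.
apply: le_trans (ler_sum _ (fun i _ => inner i)) _.
rewrite sumr_const card_ord -[_ *+ l]mulr_natl natrM le_eqVlt; apply/orP; left; apply/eqP; ring.
Qed.

Lemma chain_weight (T : nat) (y : R) : (0 <= y) ->
  (4 * l)%:R * p * ((2 + l * T)%:R + n%:R * p) ^+ (l - 2) <= y ->
  \sum_(F in chain T) p ^+ #|F| <= (n ^ 2)%:R * y ^+ T.
Proof.
move=> y0 yT; have [p0 p1] := andP p01.
have Hi i : (i <= T)%N -> \sum_(F in chain i) p ^+ #|F| <= (n ^ 2)%:R * y ^+ i.
  elim: i => [|i IH] iT /=.
    apply: le_trans (ler_sum_imset _ _ _) _ => [j|]; first by rewrite exprn_ge0.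
    rewrite expr0 mulr1; apply: le_trans (_ : \sum_(e in pairs n) 1 <= _).
      by apply: ler_sum => e _; rewrite cards1 expr1.
    by rewrite sumr_const card_pairs ler_nat bin_le_exp.
  apply: le_trans (ler_sum_imset _ _ _) _ => [j|]; first by rewrite exprn_ge0.
  under eq_bigl do rewrite inE.
  rewrite -(pair_big_dep (mem (chain i)) extends (fun F v => p ^+ #|F :|: cycle_edges v|)) /=.
  rewrite exprSr mulrA; apply: le_trans (ler_wpM2r y0 (IH (ltnW iT))).
  rewrite mulr_suml; apply: ler_sum => F /chain_props[FP Fc].
  have -> : \sum_(v | extends F v) p ^+ #|F :|: cycle_edges v| =
     p ^+ #|F| * \sum_(v | extends F v) p ^+ #|cycle_edges v :\: F|.
    rewrite mulr_sumr; apply: eq_bigr => v _; rewrite -exprD; congr (_ ^+ _).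
    by rewrite cardsU cardsD (setIC F) addnBA // subset_leq_card // subsetIl.
  apply: ler_wpM2l; first by rewrite exprn_ge0.
  apply: le_trans (extension_weight FP) (le_trans _ yT).
  apply: ler_wpM2l; first by rewrite mulr_ge0.
  apply: lerXn2r; [by rewrite nnegrE addr_ge0 // mulr_ge0|by rewrite nnegrE addr_ge0 // mulr_ge0|].
  rewrite lerD2r ler_nat.
  by apply: leq_trans Fc _; rewrite leq_add2l leq_mul2l ltnW ?orbT.
exact: Hi.
Qed.

(** Put z = p V^2, w = sqrt z and S = [cover F]. Then p^|F| = w^(2|F|) V^(-2|F|) <= w^(3|S|)
    V^(-2|F|). Over all F inside S the powers of V^(-2) sum to at most exp(1), because S spans at
    most V^2 pairs; over nonempty S the powers of w^3 sum to (1 + w^3)^n - 1. *)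
Lemma dense_weight (V : nat) : (0 < V)%N -> p * (V ^ 2)%:R <= 1 ->
  \sum_(F : {set {set 'I_n}} | [&& F \subset pairs n, cover F != set0, (#|cover F| <= V)%N &
      (3 * #|cover F| <= 2 * #|F|)%N]) p ^+ #|F| <=
  expR 1 * ((1 + Num.sqrt (p * (V ^ 2)%:R) ^+ 3) ^+ n - 1).
Proof.
move=> V0; have [p0 p1] := andP p01; set z := p * _ => z1.
have V20 : 0 < (V ^ 2)%:R :> R by rewrite ltr0n expn_gt0 V0.
have z0 : 0 <= z by rewrite mulr_ge0.
set w := Num.sqrt z; have w0 : 0 <= w by rewrite sqrtr_ge0.
have w1 : w <= 1 by rewrite -[leRHS]sqrtr1 ler_sqrt.
rewrite (partition_big (fun F => cover F) (fun S => (S != set0) && (#|S| <= V)%N)) /=; last first.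
  by move=> F /and4P[_ -> ->].
have -> : expR 1 * ((1 + w ^+ 3) ^+ n - 1) = \sum_(S : {set 'I_n} | S != set0) expR 1 * (w ^+ 3) ^+ #|S|.
  rewrite -mulr_sumr; congr (_ * _).
  have := sum_subsets [set: 'I_n] (w ^+ 3); rewrite cardsT card_ord => <-.
  rewrite (bigD1 set0) ?sub0set //= cards0 expr0 [X in X - 1]addrC addrK.
  by apply: eq_bigl => S; rewrite subsetT.
rewrite big_mkcond [leRHS]big_mkcond /=; apply: ler_sum => S _.
case: (boolP (S == set0)) => //= S0; case: ifP => SV; last by rewrite mulr_ge0 ?expR_ge0 ?exprn_ge0.
pose PS := [set e in pairs n | e \subset S].
apply: le_trans (_ : \sum_(F : {set {set 'I_n}} | F \subset PS) (w ^+ 3) ^+ #|S| * ((V ^ 2)%:R^-1) ^+ #|F| <= _).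
  rewrite big_mkcond [leRHS]big_mkcond /=; apply: ler_sum => F _.
  case: ifP => [/andP[/and4P[FP _ _ Fd] /eqP FS]|_]; last first.
    by case: ifP => // _; rewrite mulr_ge0 ?exprn_ge0 ?invr_ge0.
  have -> : F \subset PS.
    apply/subsetP => e eF; rewrite inE (subsetP FP _ eF) -FS.
    by apply/subsetP => u; apply: cover_edge.
  have -> : p = z / (V ^ 2)%:R by rewrite mulfK // gt_eqF.
  rewrite exprMn; apply: ler_wpM2r; first by rewrite exprn_ge0 ?invr_ge0.
  rewrite -(sqr_sqrtr z0) -/w -!exprM; apply: ler_wiXn2l => //.
  by rewrite -FS.
rewrite -mulr_sumr sum_subsets mulrC; apply: ler_wpM2r; first by rewrite !exprn_ge0.
apply: le_trans (_ : expR ((V ^ 2)%:R^-1) ^+ #|PS| <= _).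
  by apply: lerXn2r; rewrite ?nnegrE ?expR_ge0 ?addr_ge0 ?invr_ge0 ?expR_ge1Dx.
rewrite -expRM_natl ler_expR -ler_pdivlMr ?invr_gt0 // invrK mul1r ler_nat.
apply: leq_trans (_ : #|S| ^ 2 <= _)%N; last by rewrite leq_exp2r.
apply: leq_trans (bin_le_exp _ 2); rewrite -cards_draws; apply: subset_leq_card.
by apply/subsetP => e; rewrite !inE andbC.
Qed.

Lemma Pr_ramsey2 (T : nat) (y : R) : (0 <= y) ->
  (4 * l)%:R * p * ((2 + l * T)%:R + n%:R * p) ^+ (l - 2) <= y ->
  p * ((2 + l * T) ^ 2)%:R <= 1 ->
  Pr p (fun H : {set {set 'I_n}} => ramsey_cycle 2 l H) <=
  (n ^ 2)%:R * y ^+ T + expR 1 * ((1 + Num.sqrt (p * ((2 + l * T) ^ 2)%:R) ^+ 3) ^+ n - 1).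
Proof.
move=> y0 yT z1; have [p0 p1] := andP p01.
set V := (2 + l * T)%N in z1 *.
pose Q F := [&& F \subset pairs n, cover F != set0, (#|cover F| <= V)%N & (3 * #|cover F| <= 2 * #|F|)%N].
apply: le_trans (_ : \sum_(F | (F \in chain T) || Q F) p ^+ #|F| <= _).
  apply: Pr_union_sub => // [F /orP[/chain_props[]//|/and4P[]//]|H HP].
  case/minimal_closed=> G [GH G0 cG].
  have GP := subset_trans GH HP.
  case: (chain_grow T GP G0 cG) => [[F Fc FG]|[i iT [F Fc /andP[FG cF]]]].
    by exists F; [rewrite Fc|apply: subset_trans GH].
  have [FP Fv] := chain_props Fc.
  exists F; last exact: subset_trans GH.
  apply/orP; right; rewrite /Q FP closed_dense // andbT /=.
  apply/andP; split; last by apply: leq_trans Fv _; rewrite leq_add2l leq_mul2l ltnW ?orbT.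
  have [e eF] : exists e, e \in F.
    case: i Fc {iT Fv} => [/imsetP[e _ ->]|i /imsetP[[F' v] + ->]]; first by exists e; rewrite inE.
    by rewrite inE => /andP[_ /and4P[_ h _ _]]; exists (pick_open F'); rewrite inE h.
  have e2 := subsetP FP _ eF; rewrite inE in e2.
  have /set0Pn[u ue] : e != set0 by rewrite -card_gt0 (eqP e2).
  by apply/set0Pn; exists u; apply: cover_edge ue.
apply: le_trans (_ : \sum_(F in chain T) p ^+ #|F| + \sum_(F | Q F) p ^+ #|F| <= _).
  rewrite big_mkcond [X in _ <= X + _]big_mkcond [X in _ <= _ + X]big_mkcond -big_split /=.
  apply: ler_sum => F _; have := exprn_ge0 #|F| p0.
  by case: (F \in chain T); case: (Q F); rewrite /= ?addr0 ?add0r // lerDl.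
by apply: lerD; [exact: chain_weight|apply: dense_weight].
Qed.
End Weights.
End Closed.

(** * Asymptotics below the two-colour threshold *)

Lemma exp2_dominates (M A : nat) : exists T0 : nat, forall T, (T0 <= T)%N -> (A * T ^ M <= 2 ^ T)%N.
Proof.
pose C := (M.+1 ^ M.+1)%N; have C0 : (0 < C)%N by rewrite expn_gt0.
exists (A * C)%N => T AT.
pose s := (T %/ M.+1)%N.
have h1 : (s.+1 <= 2 ^ s)%N by apply: ltn_expl.
have h2 : (T < s.+1 * M.+1)%N by apply: ltn_ceil.
have h3 : (T ^ M.+1 <= C * 2 ^ T)%N.
  apply: leq_trans (_ : (s.+1 * M.+1) ^ M.+1 <= _)%N; first by rewrite leq_exp2r // ltnW.
  rewrite expnMn mulnC leq_mul2l; apply/orP; right.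
  apply: leq_trans (_ : (2 ^ s) ^ M.+1 <= _)%N; first by rewrite leq_exp2r.
  by rewrite -expnM leq_exp2l // leq_divM.
rewrite -(leq_pmul2l C0); apply: leq_trans h3.
by rewrite mulnA (mulnC C) expnS leq_mul2r AT orbT.
Qed.

Lemma polylog_small (l M : nat) (R : realType) (e : R) : 0 < e -> exists N : nat, forall n, (N <= n)%N ->
  ((2 + l * (trunc_log 2 n).+1) ^ M)%:R <= e * n%:R.
Proof.
move=> e0; pose b := Num.bound (e^-1).
have [T0 HT] := exp2_dominates M (2 * b * (l + 2) ^ M).
exists (2 ^ T0)%N => n Nn; set T := (trunc_log 2 n).+1.
have n0 : (0 < n)%N by apply: leq_trans Nn; rewrite expn_gt0.
have TT0 : (T0 <= T)%N by apply: leqW; rewrite trunc_log_max.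
have nT : (2 ^ T <= 2 * n)%N by rewrite /T expnS leq_mul2l trunc_logP.
have VT : ((2 + l * T) ^ M <= (l + 2) ^ M * T ^ M)%N.
  rewrite -expnMn; case: (posnP M) => [->|M0]; first by rewrite !expn0.
  rewrite leq_exp2r // mulnDl addnC leq_add2l.
  by rewrite leq_pmulr.
have bn : (b * (2 + l * T) ^ M <= n)%N.
  have := HT T TT0; rewrite -(leq_pmul2l (isT : 0 < 2)%N) => h.
  rewrite -(leq_pmul2l (isT : 0 < 2)%N); apply: leq_trans nT; apply: leq_trans (HT T TT0).
  by rewrite -!mulnA !leq_mul2l VT !orbT.
have b0 : e^-1 < b%:R by apply: archi_boundP; rewrite invr_ge0 ltW.
rewrite -ler_pdivrMl //; apply: le_trans (_ : (b * (2 + l * T) ^ M)%:R <= _); last by rewrite ler_nat.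
by rewrite natrM ler_wpM2r // ltW.
Qed.

(** The threshold enters the estimates through its (l-1)-st power, an integer power of n, which
    avoids real exponents there. *)
Lemma npow_threshold (R : realType) (l n : nat) : (2 <= l)%N -> (0 < n)%N ->
  (npow (-1 + 1 / (l%:R - 1)) n : R) ^+ l.-1 = (n%:R ^+ (l - 2))^-1.
Proof.
move=> l2 n0; have n0' : 0 < n%:R :> R by rewrite ltr0n.
have l0 : (l.-1)%:R != 0 :> R by rewrite pnatr_eq0; lia.
rewrite /npow -powR_mulrn ?powR_ge0 // -powRrM -powR_mulrn ?ltW // -powRN; congr (_ `^ _).
have -> : l%:R - 1 = (l.-1)%:R :> R by rewrite -[in LHS](prednK (ltnW l2)) -natr1 addrK.
have -> : (l - 2)%:R = (l.-1)%:R - 1 :> R.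
  by rewrite -(natrB _ (_ : 1 <= l.-1)%N) ?subn1 -?subn2 //; lia.
by field.
Qed.

Lemma expR1_bound (R : realType) (x : R) (n : nat) : 0 <= x -> n%:R * x <= 1 / 2 ->
  (1 + x) ^+ n - 1 <= 2 * (n%:R * x).
Proof.
move=> x0 nx; set y := _ * _ in nx *; have y0 : 0 <= y by rewrite mulr_ge0.
have h1 : (1 + x) ^+ n <= expR y.
  rewrite /y expRM_natl; apply: lerXn2r; rewrite ?nnegrE ?expR_ge0 ?addr_ge0 ?expR_ge1Dx //.
have h2 : 1 - y <= expR (- y) by exact: expR_ge1Dx.
have h3 : expR y * (1 - y) <= 1.
  by apply: le_trans (ler_wpM2l (expR_ge0 _) h2) _; rewrite -expRD subrr expR0.
have h4 : expR y <= (1 - y)^-1 by rewrite -[leRHS]mul1r ler_pdivlMr //; lra.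
have h5 : (1 - y)^-1 <= 1 + 2 * y.
  rewrite -[leLHS]mul1r ler_pdivrMr; last lra.
  have : y * (1 - 2 * y) >= 0 by rewrite mulr_ge0 //; lra.
  lra.
lra.
Qed.

Lemma expr_regroup (R : comRingType) (a q v : R) (L : nat) :
  (a ^+ 2 * (q * v ^+ 2) ^+ 3) ^+ L = a ^+ (2 * L) * (q ^+ L) ^+ 3 * v ^+ (6 * L).
Proof.
rewrite exprMn -[a ^+ 2 ^+ L]exprM -mulrA; congr (_ * _).
transitivity (q ^+ (3 * L) * v ^+ (2 * (3 * L))); first by rewrite (exprM v) -exprMn exprM.
by rewrite mulnA (mulnC 3%N L) (exprM q).
Qed.

Section LowerBound2.
Variables (R : realType) (l : nat).
Hypothesis l5 : (5 <= l)%N.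

(** With T about log n the number V of vertices is polylogarithmic, and y = 1/8 gives n^2 y^T <=
    1/n. The bounds on p are compared through (l-1)-st powers, where p^(l-1) <= n^(-(l-2)) leaves a
    factor 1/n to beat the powers of V. *)
Lemma Pr_ramsey2_small (e : R) : 0 < e -> exists N : nat, exists2 x : R, 0 < x &
  forall n (p : R), (N <= n)%N -> 0 <= p <= 1 -> p ^+ l.-1 * n%:R ^+ (l - 2) <= x ->
  Pr p (fun H : {set {set 'I_n}} => ramsey_cycle 2 l H) <= e.
Proof.
move=> e0.
have l0 : (0 < l)%N by (clear -l5; lia).
(* Two terms of at most c each, multiplied by 4 l 2^(l-2), make 1/8. The constant g is such that
   exp(1) 2 g <= e/2 and [expR1_bound] applies. *)
pose c : R := ((4 * l)%:R * 2 ^+ (l - 2))^-1 / 16.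
have c0 : 0 < c by rewrite divr_gt0 // invr_gt0 mulr_gt0 ?ltr0n ?exprn_gt0 // muln_gt0.
pose g : R := Num.min (1 / 2) (e / (expR 1 * 4)).
have g0 : 0 < g by rewrite lt_min !divr_gt0 ?mulr_gt0 ?expR_gt0.
have [N1 HN1] := @polylog_small l ((l - 2) * l.-1) R (c ^+ l.-1) (exprn_gt0 _ c0).
have [N2 HN2] := @polylog_small l (6 * l.-1) R (g ^+ 2 ^+ l.-1) (exprn_gt0 _ (exprn_gt0 _ g0)).
have [N3 HN3] := @polylog_small l (2 * l.-1) R 1 ltr01.
pose N4 := Num.bound (2 / e).
exists (maxn (maxn N1 N2) (maxn N3 N4.+1)), (Num.min c 1); first by rewrite lt_min c0 ltr01.
move=> n p; rewrite !geq_max => /andP[/andP[n1 n2] /andP[n3 n4]] p01 px.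
have [p0 p1] := andP p01.
have n0 : (0 < n)%N by apply: leq_ltn_trans n4.
have n0' : 0 < n%:R :> R by rewrite ltr0n.
have nn1 : 1 <= n%:R :> R by rewrite ler1n.
set T := (trunc_log 2 n).+1 in HN1 HN2 HN3 *.
pose V := (2 + l * T)%N.
have l10 : (0 < l.-1)%N by (clear -l5; lia).
have px1 : p ^+ l.-1 * n%:R ^+ (l - 2) <= 1 by apply: le_trans px _; rewrite ge_min lexx orbT.
have pxc : p ^+ l.-1 * n%:R ^+ (l - 2) <= c by apply: le_trans px _; rewrite ge_min lexx.
have pl : p ^+ l.-1 <= (n%:R ^+ (l - 2))^-1 by rewrite -[leRHS]mul1r ler_pdivlMr ?exprn_gt0.
have pln : p ^+ l.-1 <= n%:R^-1.
  apply: le_trans pl _; rewrite lef_pV2 ?posrE ?exprn_gt0 //.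
  by rewrite -[leLHS]expr1; apply: ler_weXn2l => //; (clear -l5; lia).
have V1 := HN1 n n1; have V2 := HN2 n n2; have V3 := HN3 n n3; rewrite -/T -/V in V1 V2 V3.
have b1 : p * V%:R ^+ (l - 2) <= c.
  rewrite -(@ler_pXn2r _ l.-1) ?nnegrE //; [|by rewrite mulr_ge0 ?exprn_ge0|exact: ltW].
  rewrite exprMn -exprM -natrX; apply: le_trans (ler_pM _ _ pln V1) _; rewrite ?exprn_ge0 //.
  by rewrite mulrCA mulVf ?mulr1 // gt_eqF.
have b3 : p * (V ^ 2)%:R <= 1.
  rewrite -(@ler_pXn2r _ l.-1) ?nnegrE //; last by rewrite mulr_ge0.
  rewrite exprMn -natrX -expnM expr1n; apply: le_trans (ler_pM _ _ pln V3) _; rewrite ?exprn_ge0 //.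
  by rewrite mul1r mulVf // gt_eqF.
(* This is n w^3 <= g, squared. Its (l-1)-st power requires 2 (l - 1) + 1 <= 3 (l - 2), that is l >=
   5. *)
have b2 : n%:R ^+ 2 * (p * (V ^ 2)%:R) ^+ 3 <= g ^+ 2.
  rewrite -(@ler_pXn2r _ l.-1) ?nnegrE //; [|by rewrite mulr_ge0 ?exprn_ge0 ?mulr_ge0|by rewrite exprn_ge0 ?ltW].
  have -> : (n%:R ^+ 2 * (p * (V ^ 2)%:R) ^+ 3) ^+ l.-1 =
     n%:R ^+ (2 * l.-1) * (p ^+ l.-1) ^+ 3 * (V ^ (6 * l.-1))%:R.
    by rewrite !natrX; exact: expr_regroup.
  apply: le_trans (_ : n%:R^-1 * (g ^+ 2 ^+ l.-1 * n%:R) <= _); last first.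
    by rewrite mulrCA mulVf ?mulr1 // gt_eqF.
  apply: ler_pM => //; first by rewrite mulr_ge0 ?exprn_ge0.
  apply: le_trans (_ : n%:R ^+ (2 * l.-1) * ((n%:R ^+ (l - 2))^-1) ^+ 3 <= _).
    apply: ler_wpM2l; first by rewrite exprn_ge0.
    by apply: lerXn2r; rewrite ?nnegrE ?exprn_ge0 ?invr_ge0 ?exprn_ge0.
  rewrite exprVn -exprM ler_pdivrMr ?exprn_gt0 // ler_pdivlMl // -exprS.
  by apply: ler_weXn2l => //; (clear -l5; lia).
have b4 : (4 * l)%:R * p * (V%:R + n%:R * p) ^+ (l - 2) <= 1 / 8.
  have np0 : 0 <= n%:R * p by rewrite mulr_ge0.
  have S : (V%:R + n%:R * p) ^+ (l - 2) <= 2 ^+ (l - 2) * (V%:R ^+ (l - 2) + (n%:R * p) ^+ (l - 2)).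
    apply: le_trans (_ : (2 * Num.max V%:R (n%:R * p)) ^+ (l - 2) <= _).
      apply: lerXn2r; [by rewrite nnegrE addr_ge0|by rewrite nnegrE mulr_ge0 // le_max ler0n|].
      have h1 : V%:R <= Num.max V%:R (n%:R * p) by rewrite le_max lexx.
      have h2 : n%:R * p <= Num.max V%:R (n%:R * p) by rewrite le_max lexx orbT.
      by move: (Num.max _ _) h1 h2 => m; lra.
    rewrite exprMn; apply: ler_wpM2l; first by rewrite exprn_ge0.
    by rewrite maxEle; case: ifP => _; rewrite ?lerDl ?lerDr exprn_ge0.
  have b5 : p * (n%:R * p) ^+ (l - 2) <= c.
    apply: le_trans pxc; rewrite exprMn mulrCA -exprS mulrC le_eqVlt; apply/orP; left; apply/eqP.
    by congr (_ ^+ _ * _); (clear -l5; lia).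
  have k0 : 0 < (4 * l)%:R * 2 ^+ (l - 2) :> R by rewrite mulr_gt0 ?exprn_gt0 // ltr0n muln_gt0.
  apply: le_trans (_ : (4 * l)%:R * 2 ^+ (l - 2) * (p * V%:R ^+ (l - 2) + p * (n%:R * p) ^+ (l - 2)) <= _).
    rewrite -mulrDr -!mulrA; apply: ler_wpM2l => //.
    by rewrite mulrCA; apply: ler_wpM2l.
  rewrite -ler_pdivlMl //; apply: le_trans (lerD b1 b5) _.
  by rewrite /c; set i := (_ * _)^-1; lra.
have l3 : (3 <= l)%N by (clear -l5; lia).
apply: le_trans (Pr_ramsey2 l3 p01 _ b4 b3) _ => //.
have E1 : (n ^ 2)%:R * (1 / 8) ^+ T <= e / 2 :> R.
  have n2T : (n <= 2 ^ T)%N by apply: ltnW; apply: trunc_log_ltn.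
  have h : (n ^ 3)%:R <= 8 ^+ T :> R.
    have -> : 8 ^+ T = ((2 ^ T) ^ 3)%:R :> R by rewrite -expnM mulnC expnM natrX.
    by rewrite ler_nat leq_exp2r.
  have n4' : 2 / e < n%:R.
    by apply: lt_trans (archi_boundP _) _; [rewrite divr_ge0 // ltW|rewrite ltr_nat].
  rewrite div1r exprVn ler_pdivrMr ?exprn_gt0 //; apply: le_trans (ler_wpM2l _ h); last by rewrite divr_ge0 // ltW.
  rewrite (expnS n 2) natrM mulrA -[leLHS]mul1r; apply: ler_wpM2r => //.
  have : 2 < n%:R * e by rewrite -ltr_pdivrMr.
  lra.
have E2 : expR 1 * ((1 + Num.sqrt (p * (V ^ 2)%:R) ^+ 3) ^+ n - 1) <= e / 2.
  set w := Num.sqrt _.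
  have w0 : 0 <= w by rewrite sqrtr_ge0.
  have wg : n%:R * w ^+ 3 <= g.
    rewrite -(@ler_pXn2r _ 2) ?nnegrE //; [|by rewrite mulr_ge0 ?exprn_ge0|exact: ltW].
    by rewrite exprMn exprAC sqr_sqrtr // mulr_ge0.
  have g1 : g <= 1 / 2 by rewrite ge_min lexx.
  have g2 : g <= e / (expR 1 * 4) by rewrite ge_min lexx orbT.
  have := @expR1_bound R (w ^+ 3) n (exprn_ge0 _ w0) (le_trans wg g1) => h.
  have h' : (1 + w ^+ 3) ^+ n - 1 <= 2 * (e / (expR 1 * 4)).
    by apply: le_trans h _; rewrite ler_pM2l //; apply: le_trans wg g2.
  apply: le_trans (ler_wpM2l (expR_ge0 1) h') _.
  rewrite le_eqVlt; apply/orP; left; apply/eqP; field.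
  by rewrite gt_eqF ?expR_gt0.
lra.
Qed.

Lemma lower_bound_ramsey2 (r : nat) (d : R) : odd l -> (2 <= r)%N -> d <= 1 - 2 ^- (r - 2) ->
  lower_bound r l d (npow (-1 + 1 / (l%:R - 1))).
Proof.
move=> lo r2 dr p p01 /little_o_seqE po; apply: (lower_bound_turan dr p01) => e e0.
have [N1 [x x0 HN1]] := Pr_ramsey2_small e0.
have m0 : 0 < Num.min x 1 by rewrite lt_min x0 ltr01.
have [N2 HN2] := po _ m0.
exists (maxn (maxn N1 N2) 1) => n; rewrite !geq_max => /andP[/andP[n1 n2] n0].
have n0' : 0 < n%:R :> R by rewrite ltr0n.
have [p0 p1] := andP (p01 n).
rewrite prob_ramseyE; apply: le_trans (HN1 n (p n) n1 (p01 n) _).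
  apply: Pr_le => // H HP rH; apply: contraLR (rH) => /= nH.
  move: nH; rewrite negb_forall => /existsP[c nc].
  have bnd (i : 'I_2) : (r - 2 + i < r)%N by have := ltn_ord i; (clear -r2; lia).
  (* The two colours are moved to r - 2 and r - 1, which the Turan graph leaves free. *)
  pose c0 := [ffun e' => Ordinal (bnd (c e'))] : {ffun {set 'I_n} -> 'I_r}.
  apply: (@not_ramsey_turan n r l (r - 2) H c0 lo (leq_subr 2 r)).
    by move=> e' _; rewrite ffunE /= leq_addr.
  apply: contra nc => /mono_cycleP[v [k [vi vH vk]]].
  have i0 : 'I_l by apply: (@Ordinal _ 0); (clear -l5; lia).
  have e0v : [set v i0; v (ordS i0)] \in cycle_edges v by apply: imset_f.
  apply/mono_cycleP; exists v, (c [set v i0; v (ordS i0)]); split=> // e' e'v.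
  apply: val_inj; apply/eqP; rewrite -(eqn_add2l (r - 2)); apply/eqP.
  have := vk _ e'v; rewrite -(vk _ e0v) !ffunE => /(congr1 val) //.
have l2 : (2 <= l)%N by (clear -l5; lia).
set f := npow _ in HN2; have fE : (f n) ^+ l.-1 = (n%:R ^+ (l - 2))^-1 by apply: npow_threshold.
have f0 : 0 <= f n by exact: powR_ge0.
have q0 : 0 <= p n / f n by rewrite divr_ge0.
have -> : p n ^+ l.-1 * n%:R ^+ (l - 2) = (p n / f n) ^+ l.-1.
  by rewrite expr_div_n fE invrK.
have h := HN2 n n2; rewrite ger0_norm // in h.
apply: le_trans (_ : (Num.min x 1) ^+ l.-1 <= _).
  by apply: lerXn2r; rewrite ?nnegrE // ltW.
apply: le_trans (_ : Num.min x 1 ^+ 1 <= _); last by rewrite expr1 ge_min lexx.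
by apply: ler_wiXn2l; [exact: ltW|rewrite ge_min lexx orbT|(clear -l5; lia)].
Qed.
End LowerBound2.

(** * A container algorithm for cycles *)

Lemma split_conditions (R : realFieldType) (y : R) (b1 b2 b3 b4 : bool) : 0 <= y ->
  y <= (if [&& b1, ~~ b2, ~~ b3 & ~~ b4] then y else 0) + (if ~~ b1 then y else 0) +
    (if b2 then y else 0) + (if b3 then y else 0) + (if b4 then y else 0).
Proof. by case: b1; case: b2; case: b3; case: b4 => /=; lra. Qed.

(** * One level of the container algorithm *)

Section Level.
Variables (R : realType) (V : finType).
Implicit Types (W : {set V * V}) (I J E : rel V) (L s : seq (rel V)).

Let n : R := #|V|%:R.

Fixpoint cnt s (b x : V) : R :=
  if s is E :: s' then \sum_c (E b c)%:R * cnt s' c x else (b == x)%:R.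

Lemma cnt_ge0 s b x : 0 <= cnt s b x.
Proof. by elim: s b => [|E s IH] b //=; apply: sumr_ge0 => c _; rewrite mulr_ge0. Qed.

Lemma cnt_le s b x : cnt s b x <= n ^+ (size s).-1.
Proof.
have [E|] := eqVneq s [::]; first by rewrite E /= expr0; case: (b == x).
elim: s b => // E s IH b _ /=.
have [Es|sn] := eqVneq s [::].
  rewrite Es /= expr0; apply: le_trans (_ : \sum_c (c == x)%:R <= _).
    by apply: ler_sum => c _; case: (E b c); case: (c == x); rewrite ?mulr1 ?mulr0 ?mul0r.
  by rewrite -natr_sum -big_mkcond sum1_card card1.
apply: le_trans (_ : \sum_(c : V) n ^+ (size s).-1 <= _).
  apply: ler_sum => c _; apply: le_trans (IH c sn).
  by case: (E b c); rewrite ?mul1r // mul0r cnt_ge0.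
rewrite sumr_const -[_ *+ _]mulr_natl -/n -exprS.
by case: s sn {IH}.
Qed.

Definition outdeg W x := #|[set a | (x, a) \in W]|.
Definition indeg W a := #|[set x | (x, a) \in W]|.
(** A pair (x, a) stands for a path found from x to a, and it is weighted by the number of ways to
    return from a to x along L. *)
Definition weight_of W L : R := \sum_(u in W) cnt L u.2 u.1.

Lemma sum_rows W (f : V -> V -> R) :
  \sum_(u in W) f u.1 u.2 = \sum_x \sum_(a | (x, a) \in W) f x a.
Proof. by rewrite (pair_big_dep xpredT (fun x a => (x, a) \in W) f) /=; apply: eq_bigl => -[x a]. Qed.

Lemma sum_cols W (f : V -> V -> R) :
  \sum_(u in W) f u.1 u.2 = \sum_a \sum_(x | (x, a) \in W) f x a.
Proof. by rewrite sum_rows (exchange_big_dep xpredT). Qed.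

Lemma card_rows W (D : nat) : (forall x, (outdeg W x <= D)%N) -> #|W|%:R <= n * D%:R.
Proof.
move=> HD; rewrite -sum1_card natr_sum (sum_rows W (fun _ _ => 1)).
rewrite /n -sum1_card natr_sum mulr_suml; apply: ler_sum => x _; rewrite mul1r.
rewrite sumr_const ler_nat; apply: leq_trans (HD x).
by rewrite /outdeg cardsE.
Qed.

Variables (E : rel V) (s : seq (rel V)) (W : {set V * V}).
Variables (D : nat) (th hv : R).

Definition addable W' x b := [&& hv <= cnt s b x, (x, b) \notin W',
  (outdeg W' x < D)%N & (indeg W' b < D)%N].

Definition fresh W' a b : {set V * V} := [set u | [&& u.2 == b, (u.1, a) \in W & addable W' u.1 b]].

Definition avail W' a b : R := \sum_(x | ((x, a) \in W) && addable W' x b) cnt s b x.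

Definition test I W' (ab : V * V) := [&& E ab.1 ab.2, I ab.1 ab.2 & th <= avail W' ab.1 ab.2].

(* One pass of the container algorithm: a pair (x, a) of W is extended to (x, b) along an edge ab
   of I only if ab creates at least th units of new walk weight; D caps the degrees of the result,
   and hv discards pairs that few walks close up. *)
Fixpoint run I W' (l : seq (V * V)) : {set V * V} :=
  if l is ab :: l' then
    run I (if test I W' ab then W' :|: fresh W' ab.1 ab.2 else W') l'
  else W'.

Fixpoint chosen I W' (l : seq (V * V)) : seq (V * V) :=
  if l is ab :: l' then
    if test I W' ab then ab :: chosen I (W' :|: fresh W' ab.1 ab.2) l' else chosen I W' l'
  else [::].

(** An edge that fails its test for I also fails for the smaller J, and the chosen edges are in J,
    so both runs stay in step. This makes a container a function of its fingerprint. *)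
Lemma run_determined I J W' l : (forall a b, J a b -> I a b) ->
  {in chosen I W' l, forall ab, J ab.1 ab.2} ->
  run J W' l = run I W' l /\ chosen J W' l = chosen I W' l.
Proof.
move=> JI; elim: l W' => [//|ab l IH] W' /= H.
case tI: (test I W' ab) H => H.
  have Jab : J ab.1 ab.2 by apply: H; rewrite mem_head.
  have -> : test J W' ab by move/and3P: tI => [h1 _ h3]; apply/and3P.
  have [-> ->] := IH (W' :|: fresh W' ab.1 ab.2) (fun cd h => H cd (mem_behead (s := ab :: _) h)).
  by [].
have -> : test J W' ab = false.
  apply: contraFF tI => /and3P[h1 /JI h2 h3]; exact/and3P.
exact: IH.
Qed.

Lemma chosen_sub I W' l ab : ab \in chosen I W' l -> I ab.1 ab.2.
Proof.
elim: l W' => [//|cd l IH] W' /=; case: ifP => [/and3P[_ h _]|_]; last exact: IH.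
by rewrite inE => /orP[/eqP -> //|]; apply: IH.
Qed.

Lemma outdeg_mono W1 W2 x : W1 \subset W2 -> (outdeg W1 x <= outdeg W2 x)%N.
Proof. by move=> S; apply: subset_leq_card; apply/subsetP => a; rewrite !inE; apply: (subsetP S). Qed.

Lemma indeg_mono W1 W2 x : W1 \subset W2 -> (indeg W1 x <= indeg W2 x)%N.
Proof. by move=> S; apply: subset_leq_card; apply/subsetP => a; rewrite !inE; apply: (subsetP S). Qed.

Lemma addable_anti W1 W2 x b : W1 \subset W2 -> addable W2 x b -> addable W1 x b.
Proof.
move=> S /and4P[h1 h2 h3 h4]; rewrite /addable h1 (contra (subsetP S _) h2) /=.
by rewrite (leq_ltn_trans (outdeg_mono x S)) // (leq_ltn_trans (indeg_mono b S)).
Qed.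

Lemma avail_anti W1 W2 a b : W1 \subset W2 -> avail W2 a b <= avail W1 a b.
Proof.
move=> S; rewrite /avail big_mkcond [leRHS]big_mkcond /=; apply: ler_sum => x _.
case: ifP => [/andP[-> /(addable_anti S) ->] //|_].
by case: ifP => // _; apply: cnt_ge0.
Qed.

Lemma avail_after W' a b : avail (W' :|: fresh W' a b) a b = 0.
Proof.
rewrite /avail big1 // => x /andP[xa ok].
have ok' : addable W' x b by apply: addable_anti ok; apply: subsetUl.
by move/and4P: ok => [_ + _ _]; rewrite !inE /= eqxx xa ok' orbT.
Qed.

Lemma run_sub I W' l : W' \subset run I W' l.
Proof.
elim: l W' => [//|ab l IH] W' /=; case: ifP => _; last exact: IH.
by apply: subset_trans (IH _); apply: subsetUl.
Qed.

(** Availability decreases along the run and is 0 as soon as ab has been chosen. *)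
Lemma run_exhausts I W' l a b : 0 < th -> (a, b) \in l -> E a b -> I a b ->
  avail (run I W' l) a b < th.
Proof.
move=> th0; elim: l W' => [//|cd l IH] W' /=; rewrite inE => /orP[/eqP <-|abl] Eab Iab.
  case: ifP => [_|]; first by apply: le_lt_trans (avail_anti _ _ (run_sub _ _ _)) _; rewrite avail_after.
  rewrite /test /= Eab Iab /= => /negbT; rewrite -ltNge; apply: le_lt_trans.
  exact/avail_anti/run_sub.
by case: ifP => _; apply: IH.
Qed.

Lemma weight_fresh W' a b : weight_of (W' :|: fresh W' a b) s = weight_of W' s + avail W' a b.
Proof.
have dis : [disjoint W' & fresh W' a b].
  rewrite -setI_eq0; apply/eqP/setP => -[x c]; rewrite !inE /=.
  by apply/negbTE/negP => /andP[h /and3P[/eqP E0 _ /and4P[_ + _ _]]]; rewrite -E0 h.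
have -> : weight_of (W' :|: fresh W' a b) s = weight_of W' s + weight_of (fresh W' a b) s.
  by rewrite /weight_of -bigU //; apply: eq_bigl => u; rewrite !inE.
rewrite /weight_of.
congr (_ + _); rewrite (sum_cols (fresh W' a b) (fun x c => cnt s c x)) (bigD1 b) //= [X in _ + X]big1.
  by rewrite addr0 /avail; apply: eq_bigl => x; rewrite inE /= eqxx.
by move=> c cb; rewrite big1 // => x; rewrite inE /= (negbTE cb).
Qed.

Lemma chosen_weight I W' l : 0 <= th ->
  weight_of W' s + th * (size (chosen I W' l))%:R <= weight_of (run I W' l) s.
Proof.
move=> th0; elim: l W' => [|ab l IH] W' /=; first by rewrite mulr0 addr0.
case: ifP => [/and3P[_ _ h]|_] /=; last exact: IH.
apply: le_trans (IH _); rewrite weight_fresh -natr1 mulrDr mulr1; lra.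
Qed.

(** The in-degree of b may pass the cap by d0, since one step adds up to d0 pairs ending in b at
    once; at each x it adds at most one pair. *)
Definition state_ok (d0 : nat) W' := [/\ forall x, (outdeg W' x <= D)%N,
  forall b, (indeg W' b <= D + d0)%N & forall x b, (x, b) \in W' -> hv <= cnt s b x].

Lemma state_ok_run (d0 : nat) I W' l : (forall a, (indeg W a <= d0)%N) ->
  state_ok d0 W' -> state_ok d0 (run I W' l).
Proof.
move=> Hd0; elim: l W' => [//|[a b] l IH] W' ok /=; apply: IH.
case: ifP => // _; have [q1 q2 q3] := ok; split=> [x|c|x c].
- case: (boolP (addable W' x b)) => [/and4P[_ _ h _]|nad].
    apply: leq_trans (_ : #|b |: [set c | (x, c) \in W']| <= _)%N; last first.
      by rewrite cardsU1; case: (_ \notin _); [rewrite add1n|rewrite add0n ltnW].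
    apply: subset_leq_card; apply/subsetP => c; rewrite !inE /= => /orP[->|/andP[-> _]] //.
    by rewrite orbT.
  apply: leq_trans (q1 x); apply: subset_leq_card; apply/subsetP => c; rewrite !inE /=.
  by rewrite (negbTE nad) !andbF orbF.
- case: (eqVneq c b) => [->|cb]; last first.
    apply: leq_trans (q2 c); apply: subset_leq_card; apply/subsetP => x; rewrite !inE /=.
    by rewrite (negbTE cb) orbF.
  case: (ltnP (indeg W' b) D) => h.
    apply: leq_trans (_ : indeg W' b + indeg W a <= _)%N; last by rewrite leq_add // ltnW.
    apply: leq_trans (_ : #|[set x | (x, b) \in W'] :|: [set x | (x, a) \in W]| <= _)%N.
      by apply: subset_leq_card; apply/subsetP => x; rewrite !inE /= => /orP[->|/and3P[_ -> _]]; rewrite ?orbT.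
    exact: leq_card_setU.
  apply: leq_trans (q2 b); apply: subset_leq_card; apply/subsetP => x; rewrite !inE /=.
  by rewrite /addable [(indeg _ _ < _)%N]ltnNge h !andbF orbF.
- rewrite !inE /= => /orP[/q3 //|/and3P[/eqP -> _ /and4P[]//]].
Qed.

Lemma state_ok0 d0 : state_ok d0 set0.
Proof.
split=> [x|b|x b]; last by rewrite inE.
- by rewrite /outdeg (eq_card0 (A := [set _ | _])) // => a; rewrite !inE.
- by rewrite /indeg (eq_card0 (A := [set _ | _])) // => a; rewrite !inE.
Qed.

(* Walk weight that is no longer available is charged to one of the four reasons why a pair fails to be addable. *)
Lemma weight_loss (d0 : nat) W' (C : R) : (forall x, (outdeg W x <= d0)%N) ->
  (forall x b, cnt s b x <= C) -> 0 <= hv ->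
  weight_of W (E :: s) <= \sum_(ab : V * V | E ab.1 ab.2) avail W' ab.1 ab.2
    + n * d0%:R * n * hv + d0%:R * weight_of W' s
    + #|[set x | D <= outdeg W' x]%N|%:R * (d0%:R * n * C)
    + #|[set b | D <= indeg W' b]%N|%:R * (n * d0%:R * C).
Proof.
move=> Hd0 HC hv0.
have n0 : 0 <= n by rewrite /n.
pose f1 x b : R := if cnt s b x < hv then cnt s b x else 0.
pose f2 x b : R := if (x, b) \in W' then cnt s b x else 0.
pose f3 x b : R := if (D <= outdeg W' x)%N then cnt s b x else 0.
pose f4 x b : R := if (D <= indeg W' b)%N then cnt s b x else 0.
pose f0 x b : R := if addable W' x b then cnt s b x else 0.
have split5 x b : cnt s b x <= f0 x b + f1 x b + f2 x b + f3 x b + f4 x b.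
  rewrite /f0 /f1 /f2 /f3 /f4 /addable ![(_ < D)%N]ltnNge ltNge.
  exact/split_conditions/cnt_ge0.
have step1 : weight_of W (E :: s) <=
   \sum_(u in W) \sum_b (E u.2 b)%:R * f0 u.1 b + \sum_(u in W) \sum_b f1 u.1 b
   + \sum_(u in W) \sum_b f2 u.1 b + \sum_(u in W) \sum_b f3 u.1 b + \sum_(u in W) \sum_b f4 u.1 b.
  rewrite /weight_of -!big_split /=; apply: ler_sum => u _.
  rewrite -!big_split /=; apply: ler_sum => b _.
  have h1 : 0 <= f1 u.1 b by rewrite /f1; case: ifP => // _; apply: cnt_ge0.
  have h2 : 0 <= f2 u.1 b by rewrite /f2; case: ifP => // _; apply: cnt_ge0.
  have h3 : 0 <= f3 u.1 b by rewrite /f3; case: ifP => // _; apply: cnt_ge0.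
  have h4 : 0 <= f4 u.1 b by rewrite /f4; case: ifP => // _; apply: cnt_ge0.
  by have := split5 u.1 b; case: (E u.2 b); rewrite ?mul1r ?mul0r; lra.
apply: le_trans step1 _.
have cW : #|W|%:R <= n * d0%:R := card_rows Hd0.
have b0 : \sum_(u in W) \sum_b (E u.2 b)%:R * f0 u.1 b = \sum_(ab : V * V | E ab.1 ab.2) avail W' ab.1 ab.2.
  rewrite (sum_cols W (fun x a => \sum_b (E a b)%:R * f0 x b)).
  rewrite -(pair_big_dep xpredT (fun a b => E a b) (fun a b => avail W' a b)) /=.
  apply: eq_bigr => a _; rewrite exchange_big /= [RHS]big_mkcond; apply: eq_bigr => b _.
  rewrite -mulr_sumr /avail; case: (E a b); rewrite ?mul1r ?mul0r // big_mkcondr.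
  by apply: eq_bigr.
have b1 : \sum_(u in W) \sum_b f1 u.1 b <= n * d0%:R * n * hv.
  apply: le_trans (_ : \sum_(u in W) n * hv <= _).
    apply: ler_sum => u _; apply: le_trans (_ : \sum_(b : V) hv <= _).
      by apply: ler_sum => b _; rewrite /f1; case: ifP => // /ltW.
    by rewrite sumr_const -[_ *+ _]mulr_natl.
  by rewrite sumr_const -[_ *+ _]mulr_natl -[leRHS]mulrA ler_wpM2r // mulr_ge0.
have b2 : \sum_(u in W) \sum_b f2 u.1 b <= d0%:R * weight_of W' s.
  rewrite (sum_rows W (fun x a => \sum_b f2 x b)) /weight_of (sum_rows W' (fun x b => cnt s b x)) mulr_sumr.
  apply: ler_sum => x _; rewrite sumr_const -[_ *+ _]mulr_natl /f2 -big_mkcond /=.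
  apply: ler_wpM2r; first by apply: sumr_ge0 => b _; apply: cnt_ge0.
  by rewrite ler_nat; apply: leq_trans (Hd0 x); rewrite /outdeg cardsE.
have rowC x : \sum_b cnt s b x <= n * C.
  apply: le_trans (_ : \sum_(b : V) C <= _); first by apply: ler_sum.
  by rewrite sumr_const -[_ *+ _]mulr_natl.
have b3 : \sum_(u in W) \sum_b f3 u.1 b <= #|[set x | D <= outdeg W' x]%N|%:R * (d0%:R * n * C).
  rewrite (sum_rows W (fun x a => \sum_b f3 x b)).
  rewrite -sum1_card natr_sum mulr_suml [leRHS]big_mkcond /=; apply: ler_sum => x _.
  rewrite sumr_const -[_ *+ _]mulr_natl inE /f3; case: ifP => _; last by rewrite big1 ?mulr0.
  rewrite mul1r -mulrA; apply: ler_pM => //; first by apply: sumr_ge0 => b _; apply: cnt_ge0.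
  by rewrite ler_nat; apply: leq_trans (Hd0 x); rewrite /outdeg cardsE.
have b4 : \sum_(u in W) \sum_b f4 u.1 b <= #|[set b | D <= indeg W' b]%N|%:R * (n * d0%:R * C).
  rewrite exchange_big /= -sum1_card natr_sum mulr_suml [leRHS]big_mkcond /=.
  apply: ler_sum => b _; rewrite inE /f4; case: ifP => _; last by rewrite big1.
  rewrite mul1r; apply: le_trans (_ : \sum_(u in W) C <= _); first by apply: ler_sum => u _.
  by rewrite sumr_const -[_ *+ _]mulr_natl; apply: ler_wpM2r => //; exact: le_trans (cnt_ge0 s b b) (HC b b).
rewrite b0; lra.
Qed.

(** Pairs with a count below hv are never added, so each saturated vertex holds D pairs of weight at
    least hv; a light W' has few such vertices. *)
Lemma saturated_out W' : (forall x b, (x, b) \in W' -> hv <= cnt s b x) -> 0 <= hv ->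
  #|[set x | D <= outdeg W' x]%N|%:R * (D%:R * hv) <= weight_of W' s.
Proof.
move=> Hhv hv0; rewrite /weight_of (sum_rows W' (fun x b => cnt s b x)).
rewrite -sum1_card natr_sum mulr_suml big_mkcond /=; apply: ler_sum => x _.
have nn : 0 <= \sum_(a | (x, a) \in W') cnt s a x by apply: sumr_ge0 => a _; apply: cnt_ge0.
rewrite inE; case: ifP => // Dx; rewrite mul1r.
apply: le_trans (_ : \sum_(a | (x, a) \in W') hv <= _); last by apply: ler_sum => a; apply: Hhv.
rewrite sumr_const -[leRHS]mulr_natl; apply: ler_wpM2r => //; rewrite ler_nat.
by apply: leq_trans Dx _; rewrite /outdeg cardsE.
Qed.

Lemma saturated_in W' : (forall x b, (x, b) \in W' -> hv <= cnt s b x) -> 0 <= hv ->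
  #|[set b | D <= indeg W' b]%N|%:R * (D%:R * hv) <= weight_of W' s.
Proof.
move=> Hhv hv0; rewrite /weight_of (sum_cols W' (fun x b => cnt s b x)).
rewrite -sum1_card natr_sum mulr_suml big_mkcond /=; apply: ler_sum => x _.
have nn : 0 <= \sum_(a | (a, x) \in W') cnt s x a by apply: sumr_ge0 => a _; apply: cnt_ge0.
rewrite inE; case: ifP => // Dx; rewrite mul1r.
apply: le_trans (_ : \sum_(a | (a, x) \in W') hv <= _); last by apply: ler_sum => a; apply: Hhv.
rewrite sumr_const -[leRHS]mulr_natl; apply: ler_wpM2r => //; rewrite ler_nat.
by apply: leq_trans Dx _; rewrite /indeg cardsE.
Qed.

Lemma avail_le W' a b (d1 : nat) (C : R) : (forall x b, cnt s b x <= C) ->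
  (indeg W a <= d1)%N -> avail W' a b <= d1%:R * C.
Proof.
move=> HC h; have C0 : 0 <= C by apply: le_trans (cnt_ge0 s a a) (HC a a).
apply: le_trans (_ : \sum_(x | (x, a) \in W) C <= _).
  rewrite /avail big_mkcondr; apply: ler_sum => x _; case: ifP => // _.
rewrite sumr_const -[leLHS]mulr_natl; apply: ler_wpM2r => //; rewrite ler_nat.
by apply: leq_trans h; rewrite /indeg cardsE.
Qed.

(* If the new relation stays light, most of the walk weight is still available. *)
Lemma level_removal (d0 : nat) W' (C ep : R) :
  (forall x, (outdeg W x <= d0)%N) -> (forall a, (indeg W a <= 2 * d0)%N) ->
  (forall x b, cnt s b x <= C) -> (0 < d0)%N -> (0 < D)%N -> D%:R <= n ->
  0 < C -> 0 < ep <= 1 -> hv = ep / 8 * C -> th = ep / 4 * (d0%:R * C) ->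
  (forall x b, (x, b) \in W' -> hv <= cnt s b x) ->
  ep * (n ^+ 2 * (d0%:R * C)) <= weight_of W (E :: s) ->
  weight_of W' s <= ep ^+ 2 / 64 * (n * D%:R * C) ->
  ep / 8 * n ^+ 2 <= #|[set ab : V * V | E ab.1 ab.2 && (th <= avail W' ab.1 ab.2)]|%:R.
Proof.
move=> Ho Hi HC d00 D0 Dn C0 /andP[ep0 ep1] hvE thE Hhv wW wW'.
have d0' : 0 < d0%:R :> R by rewrite ltr0n.
have D0' : 0 < D%:R :> R by rewrite ltr0n.
have n0 : 0 < n by apply: lt_le_trans Dn.
have hv0 : 0 < hv by rewrite hvE mulr_gt0 // divr_gt0.
(* Each of the four losses is at most ep/8 U, so ep/2 U stays available. Edges below th offer at
   most ep/4 U in total, and any other edge at most 2 d0 C. *)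
pose U := n ^+ 2 * (d0%:R * C).
have U0 : 0 < U by rewrite !mulr_gt0 ?exprn_gt0.
have loss := weight_loss W' Ho HC (ltW hv0).
have so := saturated_out Hhv (ltW hv0); have si := saturated_in Hhv (ltW hv0).
set X := #|[set x | _]|%:R in so loss; set Y := #|[set b | _]|%:R in si loss.
have satb Z : Z * (D%:R * hv) <= weight_of W' s -> Z <= ep / 8 * n.
  move=> h; rewrite -(ler_pM2r (mulr_gt0 D0' hv0)); apply: le_trans h (le_trans wW' _).
  rewrite hvE le_eqVlt; apply/orP; left; apply/eqP; by field.
have l1 : n * d0%:R * n * hv = ep / 8 * U by rewrite /U hvE; field.
have l2 : d0%:R * weight_of W' s <= ep / 8 * U.
  apply: le_trans (ler_wpM2l (ltW d0') wW') _.
  have -> : d0%:R * (ep ^+ 2 / 64 * (n * D%:R * C)) = (ep ^+ 2 / 64 * (n * d0%:R * C)) * D%:R by ring.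
  apply: le_trans (ler_wpM2l _ Dn) _; first by rewrite !mulr_ge0 ?exprn_ge0 ?ltW.
  have -> : ep ^+ 2 / 64 * (n * d0%:R * C) * n = ep ^+ 2 / 64 * U by rewrite /U; ring.
  rewrite ler_pM2r // expr2.
  have : ep * ep <= ep * 1 by rewrite ler_pM2l.
  lra.
have l3 : X * (d0%:R * n * C) <= ep / 8 * U.
  apply: le_trans (ler_wpM2r _ (satb _ so)) _; first by rewrite !mulr_ge0 ?ltW.
  by rewrite /U le_eqVlt; apply/orP; left; apply/eqP; ring.
have l4 : Y * (n * d0%:R * C) <= ep / 8 * U.
  apply: le_trans (ler_wpM2r _ (satb _ si)) _; first by rewrite !mulr_ge0 ?ltW.
  by rewrite /U le_eqVlt; apply/orP; left; apply/eqP; ring.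
have av : ep / 2 * U <= \sum_(ab : V * V | E ab.1 ab.2) avail W' ab.1 ab.2.
  rewrite -/U in wW; lra.
set A := [set _ | _].
have av2 : \sum_(ab : V * V | E ab.1 ab.2) avail W' ab.1 ab.2 <= #|A|%:R * (2 * d0%:R * C) + n ^+ 2 * th.
  apply: le_trans (_ : \sum_(ab : V * V) ((ab \in A)%:R * (2 * d0%:R * C) + th) <= _).
    rewrite big_mkcond /=; apply: ler_sum => ab _; rewrite inE.
    have th0 : 0 <= th by rewrite thE !mulr_ge0 ?ltW.
    have K0 : 0 <= 2 * d0%:R * C by rewrite !mulr_ge0 ?ltW.
    case: (E ab.1 ab.2) => /=; last by rewrite mul0r add0r.
    case: (leP th (avail W' ab.1 ab.2)) => /= [_|/ltW]; last by rewrite mul0r add0r.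
    rewrite mul1r; apply: le_trans (avail_le W' ab.2 HC (Hi ab.1)) _.
    by rewrite natrM lerDl.
  rewrite big_split /= -mulr_suml -natr_sum -big_mkcond sum1_card sumr_const -[th *+ _]mulr_natl.
  by rewrite card_prod natrM -/n -expr2.
have E1 : n ^+ 2 * th = ep / 4 * U by rewrite thE /U; ring.
have : ep / 4 * U <= #|A|%:R * (2 * d0%:R * C) by lra.
move=> h; rewrite -(ler_pM2r (_ : 0 < 2 * d0%:R * C)) ?mulr_gt0 //; apply: le_trans h.
by rewrite /U le_eqVlt; apply/orP; left; apply/eqP; field.
Qed.
End Level.

(** * The levels of one round *)

Section Layers.
Variables (R : realType) (V : finType) (l : nat).
Implicit Types (W : {set V * V}) (I J A : rel V) (pi : V -> nat).

Definition layer A pi (j : nat) : rel V := fun a b => [&& A a b, pi a == j & pi b == (j.+1 %% l)%N].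

Definition layers A pi (j k : nat) : seq (rel V) := [seq layer A pi i | i <- iota j k].

Variables (A : rel V) (pi : V -> nat) (d : nat).

Let n : R := #|V|%:R.

(** With k + 1 layers left there are at most n^k return walks, and degrees at level j are of order
    d^j. The thresholds are those of [level_removal] for C = n^k and d0 = d^j. *)
Definition pass (k j : nat) (ep : R) W I : {set V * V} :=
  run (layer A pi j) (layers A pi j.+1 k.+1) W (d ^ j.+1) (ep / 4 * ((d ^ j)%:R * n ^+ k))
    (ep / 8 * n ^+ k) I set0 (enum {: V * V}).

(** The next level runs with ep^2/64, the relative weight above which [level_removal] no longer
    applies to this level. *)
Fixpoint removed (k j : nat) (ep : R) W I : {set V * V} :=
  if k is k'.+1 then
    [set ab : V * V | layer A pi j ab.1 ab.2 && (ep / 4 * ((d ^ j)%:R * n ^+ k') <=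
       avail (layers A pi j.+1 k) W (d ^ j.+1) (ep / 8 * n ^+ k') (pass k' j ep W I) ab.1 ab.2)]
    :|: removed k' j.+1 (ep ^+ 2 / 64) (pass k' j ep W I) I
  else [set ab : V * V | layer A pi j ab.1 ab.2 && ((ab.2, ab.1) \in W)].

Fixpoint fingerprint (k j : nat) (ep : R) W I : seq (V * V) :=
  if k is k'.+1 then
    chosen (layer A pi j) (layers A pi j.+1 k) W (d ^ j.+1) (ep / 4 * ((d ^ j)%:R * n ^+ k'))
      (ep / 8 * n ^+ k') I set0 (enum {: V * V})
    ++ fingerprint k' j.+1 (ep ^+ 2 / 64) (pass k' j ep W I) I
  else [::].

Lemma removed_determined I J k j ep W : (forall a b, J a b -> I a b) ->
  {in fingerprint k j ep W I, forall ab, J ab.1 ab.2} ->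
  removed k j ep W J = removed k j ep W I /\ fingerprint k j ep W J = fingerprint k j ep W I.
Proof.
move=> JI; elim: k j ep W => [//|k IH] j ep W /= H.
have [|E1 E2] := run_determined (W' := set0) (l := enum {: V * V}) (E := layer A pi j)
  (s := layers A pi j.+1 k.+1) (W := W) (D := d ^ j.+1)
  (th := ep / 4 * ((d ^ j)%:R * n ^+ k)) (hv := ep / 8 * n ^+ k) JI.
  by move=> ab h; apply: H; rewrite mem_cat h.
have [|E3 E4] := IH j.+1 (ep ^+ 2 / 64) (pass k j ep W I).
  by move=> ab h; apply: H; rewrite mem_cat h orbT.
have E5 : pass k j ep W J = pass k j ep W I by [].
by rewrite E5 E2 E3 E4.
Qed.

Lemma fingerprint_sub I k j ep W ab : ab \in fingerprint k j ep W I -> I ab.1 ab.2.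
Proof.
elim: k j ep W => [//|k IH] j ep W /=; rewrite mem_cat => /orP[|/IH //].
exact: chosen_sub.
Qed.

Lemma size_layers j k : size (layers A pi j k) = k.
Proof. by rewrite size_map size_iota. Qed.

Lemma cnt_layers j k b x : cnt R (layers A pi j k.+1) b x <= n ^+ k.
Proof. by apply: le_trans (cnt_le _ _ _ _) _; rewrite size_layers. Qed.

Lemma pass_ok (d0 : nat) k j ep W I : (forall a, (indeg W a <= d0)%N) ->
  state_ok (layers A pi j.+1 k.+1) (d ^ j.+1) (ep / 8 * n ^+ k) d0 (pass k j ep W I).
Proof. by move=> H; apply: state_ok_run => //; apply: state_ok0. Qed.

Lemma pass_weight_le k j ep W I :
  weight_of R (pass k j ep W I) (layers A pi j.+1 k.+1) <= n * (d ^ j.+1)%:R * n ^+ k.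
Proof.
have [h1 _ _] := @pass_ok #|V| k j ep W I (fun a => max_card _).
apply: le_trans (_ : \sum_(u in pass k j ep W I) n ^+ k <= _).
  by apply: ler_sum => u _; apply: cnt_layers.
rewrite sumr_const -[_ *+ _]mulr_natl; apply: ler_wpM2r; first by rewrite exprn_ge0.
exact: card_rows.
Qed.

(** Visiting layers 0, ..., j in order makes the vertices of the walk distinct. *)
Definition walks I W (j : nat) := forall x a, (x, a) \in W ->
  exists q, [/\ path I x q, last x q = a & map pi (x :: q) = iota 0 j.+1].

Lemma walks_run I s W D (th hv : R) l0 W' j : (j.+1 < l)%N -> walks I W j -> walks I W' j.+1 ->
  walks I (run (layer A pi j) s W D th hv I W' l0) j.+1.
Proof.
move=> jl HW; elim: l0 W' => [//|[a b] l0 IH] W' HW' /=; apply: IH.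
case: ifP => // /and3P[/= /and3P[_ _ /eqP pb] Iab _] x c; rewrite !inE /= => /orP[/HW' //|].
move=> /and3P[/eqP -> /HW[q [pq lq mq]] _].
exists (rcons q b); split; first by rewrite rcons_path pq lq.
  by rewrite last_rcons.
have E : map pi (x :: rcons q b) = iota 0 j.+2.
  by rewrite -rcons_cons map_rcons mq pb modn_small // -[j.+2]addn1 iotaD cats1.
exact: E.
Qed.

(* An edge of I with much available weight would have been chosen during the pass, and an edge of I
   removed at the last level would close a cycle. *)
Lemma removed_avoids I k j ep W : 0 < ep -> (0 < d)%N -> (0 < #|V|)%N -> (j + k).+1 = l ->
  (forall x q, path I x q -> map pi (x :: q) = iota 0 l -> ~~ I (last x q) x) ->
  walks I W j -> forall ab, ab \in removed k j ep W I -> ~~ I ab.1 ab.2.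
Proof.
move=> ep0 d0 V0 + free.
have n0 : 0 < n by rewrite /n ltr0n.
elim: k j ep ep0 W => [|k IH] j ep ep0 W jk HW [a b] /=.
  rewrite inE /= => /andP[_ /HW[q [pq <- mq]]]; apply: free => //.
  by rewrite mq -jk addn0.
rewrite inE => /orP[|].
  rewrite inE /= => /andP[Eab]; apply: contraL => Iab; rewrite -ltNge.
  apply: run_exhausts => //; last by rewrite mem_enum.
  by rewrite mulr_gt0 ?divr_gt0 // mulr_gt0 ?exprn_gt0 // ltr0n expn_gt0 d0.
apply: IH; first by rewrite divr_gt0 ?exprn_gt0.
  by rewrite -jk addSnnS.
apply: walks_run => //; first by rewrite -jk !addnS !ltnS leq_addr.
by move=> x c; rewrite inE.
Qed.
End Layers.

Lemma swapK (T : Type) : cancel (fun u : T * T => (u.2, u.1)) (fun u => (u.2, u.1)).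
Proof. by case. Qed.

(** At each level the weight ends at most at n d^(j+1) n^k and grows by at least ep/4 d^j n^k per
    chosen edge, hence at most (4/ep) n d edges are chosen. *)
Lemma fingerprint_size (R : realType) (k : nat) (ep : R) : 0 < ep -> exists M : R, 0 <= M /\
  forall (V : finType) (l : nat) (A : rel V) (pi : V -> nat) (d j : nat) (W : {set V * V}) (I : rel V),
  (0 < d)%N -> (0 < #|V|)%N ->
  (size (fingerprint l A pi d k j ep W I))%:R <= M * (#|V|%:R * d%:R).
Proof.
elim: k ep => [|k IH] ep ep0.
  by exists 0; split=> // V l A pi d j W I _ _ /=; rewrite mul0r.
have [|M [M0 HM]] := IH (ep ^+ 2 / 64); first by rewrite divr_gt0 ?exprn_gt0.
exists (4 / ep + M); split; first by rewrite addr_ge0 // divr_ge0 // ltW.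
move=> V l A pi d j W I d0 V0 /=; rewrite size_cat natrD mulrDl.
have n0 : 0 < #|V|%:R :> R by rewrite ltr0n.
have d0' : 0 < d%:R :> R by rewrite ltr0n.
apply: lerD; last exact: HM.
set th := ep / 4 * _.
have th0 : 0 < th by rewrite mulr_gt0 ?divr_gt0 // mulr_gt0 ?exprn_gt0 // ltr0n expn_gt0 d0.
have := chosen_weight (layer l A pi j) (layers l A pi j.+1 k.+1) W (d ^ j.+1) (ep / 8 * #|V|%:R ^+ k)
  I set0 (enum {: V * V}) (ltW th0).
rewrite {1}/weight_of big_set0 add0r => h.
have := le_trans h (@pass_weight_le R V l A pi d k j ep W I).
set sz := (size _)%:R => h2.
rewrite -(ler_pM2l th0); apply: le_trans h2 _; rewrite le_eqVlt; apply/orP; left; apply/eqP.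
by rewrite /th expnS natrM; field; rewrite gt_eqF.
Qed.

(** If the next level stays light, this one removes ep/8 n^2 pairs; otherwise the next level starts
    heavy. At the last level the weight is itself the number of removed pairs, and n d^(l-1) is of
    order n^2. *)
Lemma removed_large (R : realType) (l k : nat) (ep : R) : 0 < ep <= 1 -> exists2 dl : R, 0 < dl &
  forall (V : finType) (A : rel V) (pi : V -> nat) (d j : nat) (W : {set V * V}) (I : rel V),
  (j + k).+1 = l -> (2 <= d)%N -> (d ^ l.-1 <= #|V|)%N -> (#|V| <= 2 ^ l * d ^ l.-1)%N ->
  (forall x, (outdeg W x <= d ^ j)%N) -> (forall a, (indeg W a <= 2 * d ^ j)%N) ->
  ep * (#|V|%:R ^+ k.+1 * (d ^ j)%:R) <= weight_of R W (layers l A pi j k.+1) ->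
  dl * #|V|%:R ^+ 2 <= #|removed l A pi d k j ep W I|%:R.
Proof.
elim: k ep => [|k IH] ep /andP[ep0 ep1].
  exists (ep / 2 ^+ l); first by rewrite divr_gt0 ?exprn_gt0.
  move=> V A pi d j W I; rewrite addn0 => jl d2 dn nd _ _ Hw /=.
  set S := [set _ | _].
  have E : weight_of R W (layers l A pi j 1) = #|S|%:R.
    rewrite -sum1_card natr_sum (reindex_inj (can_inj (@swapK V))) /= [LHS]big_mkcond [RHS]big_mkcond /=.
    apply: eq_bigr => -[x a] _; rewrite !inE /= (bigD1 x) //= eqxx mulr1 big1 ?addr0.
      by case: ((_, _) \in W); rewrite ?andbT ?andbF //; case: layer.
    by move=> c cx; rewrite (negbTE cx) mulr0.
  rewrite -E; apply: le_trans Hw; rewrite -mulrA; apply: ler_wpM2l; first exact: ltW.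
  rewrite expr1 expr2 mulrA mulrC; apply: ler_wpM2l => //.
  rewrite ler_pdivrMl ?exprn_gt0 // -natrX -natrM ler_nat.
  by move: nd; rewrite -jl.
have [|dl dl0 HIH] := IH (ep ^+ 2 / 64).
  rewrite divr_gt0 ?exprn_gt0 //= ler_pdivrMr // mul1r.
  have e2 : ep ^+ 2 <= 1 by rewrite exprn_ile1 // ltW.
  by apply: le_trans e2 _; rewrite ler1n.
exists (Num.min (ep / 8) dl); first by rewrite lt_min dl0 divr_gt0.
move=> V A pi d j W I jl d2 dn nd Ho Hi Hw /=.
have d0 : (0 < d)%N by apply: leq_trans d2.
have V0 : (0 < #|V|)%N by apply: leq_trans dn; rewrite expn_gt0 d0.
have n0 : 0 < #|V|%:R :> R by rewrite ltr0n.
set n : R := #|V|%:R in n0 Hw *.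
set W' := pass _ _ _ _ _ _ _ _ _.
have ok : state_ok (layers l A pi j.+1 k.+1) (d ^ j.+1) (ep / 8 * n ^+ k) (2 * d ^ j) W'.
  exact: pass_ok.
have [q1 q2 q3] := ok.
set S := [set _ | _] ; set S' := removed _ _ _ _ _ _ _ _ _.
have Dn : ((d ^ j.+1)%:R <= n)%R.
  rewrite /n ler_nat; apply: leq_trans dn; rewrite leq_exp2l //.
  by rewrite -jl /= addnS ltnS leq_addr.
case: (lerP (weight_of R W' (layers l A pi j.+1 k.+1)) (ep ^+ 2 / 64 * (n * (d ^ j.+1)%:R * n ^+ k))) => hw.
  apply: le_trans (_ : ep / 8 * n ^+ 2 <= _).
    by apply: ler_wpM2r; [rewrite exprn_ge0 // ltW|rewrite ge_min lexx].
  apply: le_trans (_ : #|S|%:R <= _); last by rewrite ler_nat subset_leq_card // subsetUl.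
  apply: (level_removal (E := layer l A pi j) (s := layers l A pi j.+1 k.+1) (W := W)
    (D := d ^ j.+1) (d0 := d ^ j) (W' := W') (C := n ^+ k) (ep := ep)) => //.
  - by move=> x b; apply: cnt_layers.
  - by rewrite expn_gt0 d0.
  - by rewrite expn_gt0 d0.
  - by rewrite exprn_gt0.
  - by rewrite ep0.
  - have -> : n ^+ 2 * ((d ^ j)%:R * n ^+ k) = n ^+ k.+2 * (d ^ j)%:R by rewrite !exprS; ring.
    exact: Hw.
apply: le_trans (_ : dl * n ^+ 2 <= _).
  by apply: ler_wpM2r; [rewrite exprn_ge0 // ltW|rewrite ge_min lexx orbT].
apply: le_trans (_ : #|S'|%:R <= _); last by rewrite ler_nat subset_leq_card // subsetUr.
apply: HIH => //.
- by rewrite -jl addSnnS.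
(* d^(j+1) + 2 d^j <= 2 d^(j+1) plus d^(j+1) reduces to 2 d^j <= d^(j+1), that is d >= 2. *)
- move=> a; apply: leq_trans (q2 a) _.
  by rewrite [leqRHS]mul2n -addnn leq_add2l expnS leq_mul2r d2 orbT.
- apply: le_trans (ltW hw); rewrite le_eqVlt; apply/orP; left; apply/eqP.
  by rewrite [_ ^+ k.+1]exprS -!mulrA [#|V|%:R ^+ k * _]mulrC.
Qed.

(** * Counting walks and cycles *)

Lemma card_fiber (A B J : finType) (io : J -> A) (y : J -> B) : injective io ->
  #|[set x : {ffun A -> B} | [forall j, x (io j) == y j]]| = (#|B| ^ (#|A| - #|J|))%N.
Proof.
move=> inj; pose g a b := if [pick j | io j == a] is Some j then (b == y j : nat) else 1%N.
have pickE j : [pick j' | io j' == io j] = Some j.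
  by case: pickP => [j' /eqP/inj -> //|/(_ j)]; rewrite eqxx.
have -> : #|[set x : {ffun A -> B} | [forall j, x (io j) == y j]]| = (\sum_(x : {ffun A -> B}) \prod_a g a (x a))%N.
  rewrite -sum1_card big_mkcond /=; apply: eq_bigr => x _; rewrite inE.
  case: (boolP [forall j, _]) => [/forallP h|].
    by rewrite big1 // => a _; rewrite /g; case: pickP => // j /eqP <-; rewrite h.
  by rewrite negb_forall => /existsP[j /negbTE h]; rewrite (bigD1 (io j)) //= /g pickE h.
rewrite -(bigA_distr_bigA g) /=.
have Eg a : (\sum_b g a b = if a \in [set io j | j in J] then 1 else #|B|)%N.
  case: ifP => [/imsetP[j _ ->]|/negbT h].
    by rewrite /g pickE -big_mkcond sum1_card card1.
  rewrite /g; case: pickP => [j /eqP E|_]; last by rewrite sum1_card.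
  by move/negP: h; case; rewrite -E; apply: imset_f.
rewrite (eq_bigr _ (fun a _ => Eg a)) (bigID (mem [set io j | j in J])) /=.
rewrite big1 ?mul1n => [|a ->//]; rewrite (eq_bigr (fun=> #|B|)) => [|a /negbTE -> //].
rewrite prod_nat_const; congr (_ ^ _)%N.
have := cardsC [set io j | j in J]; rewrite (card_imset _ inj) => E.
by rewrite -[in RHS]E addKn -sum1_card -[RHS]sum1_card; apply: eq_bigl => a; rewrite !inE.
Qed.

Section Walks.
Variables (R : realType) (V : finType).

Fixpoint follows (s : seq (rel V)) (b : V) (t : seq V) : bool :=
  match s, t with
  | E :: s', c :: t' => E b c && follows s' c t'
  | [::], [::] => true
  | _, _ => false
  end.

Lemma cnt_tuple s b x :
  cnt R s b x = \sum_(t : (size s).-tuple V) (follows s b t && (last b t == x))%:R.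
Proof.
elim: s b => [|E s IH] b; first by rewrite (big_tuple0 (fun t => (follows [::] b t && (last b t == x))%:R)).
apply: etrans (esym (big_tupleS (size s) (fun t => (follows (E :: s) b t && (last b t == x))%:R))).
rewrite [LHS]/=; apply: eq_bigr => c _; rewrite IH mulr_sumr; apply: eq_bigr => t _.
by rewrite -natrM mulnb /= andbA.
Qed.

Lemma follows_layers l (A : rel V) pi (f : nat -> V) j k :
  (forall i, (j <= i < j + k)%N -> layer l A pi i (f i) (f i.+1)) ->
  follows (layers l A pi j k) (f j) (map f (iota j.+1 k)).
Proof.
elim: k j => [//|k IH] j H /=; rewrite H ?leqnn ?addnS ?ltnS ?leq_addr //=.
apply: IH => i /andP[h1 h2]; apply: H; rewrite (ltnW h1) /=.
by rewrite addnS -addSn.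
Qed.

Lemma last_map_iota (f : nat -> V) j k : last (f j) (map f (iota j.+1 k)) = f (j + k)%N.
Proof. by elim: k j => [|k IH] j /=; rewrite ?addn0 // IH addSnnS. Qed.
End Walks.

(** * Rounds and containers *)

Section Containers.
Variables (R : realType) (l' : nat).
Let l := l'.+1.
Hypothesis l3 : (3 <= l)%N.

Section Fixed.
Variable (n : nat).
Implicit Types (C F J : {set {set 'I_n}}).

Definition cycles F := [set v : {ffun 'I_l -> 'I_n} | injectiveb v && (cycle_edges v \subset F)].

Definition edge_rel F : rel 'I_n := fun a b => [set a; b] \in F.

(** The paths of length 0 at the vertices of layer 0. *)
Definition start (pi : {ffun 'I_n -> 'I_l}) : {set 'I_n * 'I_n} :=
  [set u | (u.1 == u.2) && (pi u.1 == ord0)].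

Definition layered C (pi : {ffun 'I_n -> 'I_l}) : R :=
  weight_of R (start pi) (layers l (edge_rel C) (fun a => pi a : nat) 0 l).

Lemma layered_count C (pi : {ffun 'I_n -> 'I_l}) :
  #|[set v in cycles C | [forall i, pi (v i) == i]]|%:R <= layered C pi.
Proof.
rewrite /layered /weight_of; set L := layers _ _ _ _ _.
have sL : size L = l by rewrite size_layers.
have -> : \sum_(u in start pi) cnt R L u.2 u.1 = \sum_(w : ('I_n * 'I_n) * l.-tuple 'I_n |
    (w.1 \in start pi) && (follows L w.1.2 w.2 && (last w.1.2 w.2 == w.1.1))) 1.
  transitivity (\sum_(u in start pi) \sum_(t : l.-tuple 'I_n | follows L u.2 t && (last u.2 t == u.1)) (1 : R)).
    apply: eq_bigr => u _; rewrite cnt_tuple sL [RHS]big_mkcond; apply: eq_bigr => t _.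
    by case: (_ && _).
  by rewrite pair_big_dep.
rewrite -sum1_card natr_sum.
pose f (v : {ffun 'I_l -> 'I_n}) i := v (inord (i %% l)).
pose h (v : {ffun 'I_l -> 'I_n}) := ((f v 0%N, f v 0%N), [tuple of mkseq (fun i => f v i.+1) l]).
have inE0 (i : 'I_l) : inord (i %% l) = i by rewrite modn_small // inord_val.
apply: (@ler_sum_inj R _ _ _ _ h (fun=> 1)) => // [v w _ _ Eh|v].
  have E : mkseq (fun i => f v i.+1) l = mkseq (fun i => f w i.+1) l := congr1 (fun u => tval u.2) Eh.
  apply/ffunP => i.
  have H k : (k < l)%N -> f v k.+1 = f w k.+1.
    by move=> kl; have := congr1 (fun s => nth (f v 0%N) s k) E; rewrite !nth_mkseq.
  have := H (ord_pred i) (ltn_ord _); rewrite /f.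
  have -> : inord ((ord_pred i).+1 %% l) = ordS (ord_pred i) :> 'I_l.
    by apply: val_inj; rewrite /= inordK // ltn_mod.
  by rewrite ord_predK.
rewrite inE inE => /andP[/andP[/injectiveP vi /subsetP vC] /forallP pv].
have f0 : f v 0%N = v ord0 by rewrite /f mod0n; congr (v _); apply: val_inj; rewrite /= inordK.
have Em : mkseq (fun i => f v i.+1) l = map (f v) (iota 1 l).
  by rewrite /mkseq -[1%N]/(1 + 0)%N iotaDl -map_comp.
have fl : follows L (f v 0%N) (mkseq (fun i => f v i.+1) l).
  rewrite Em; apply: follows_layers => i /andP[_]; rewrite add0n => il; rewrite /layer /edge_rel /f.
  have -> : inord (i.+1 %% l) = ordS (inord (i %% l)) :> 'I_l.
    by apply: val_inj; rewrite /= !inordK ?ltn_mod // (modn_small il).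
  have pvE (j : 'I_l) : pi (v j) = j :> nat by rewrite (eqP (pv j)).
  have Ei : (inord (i %% l) : 'I_l) = i :> nat by rewrite inordK ?ltn_mod // modn_small.
  apply/and3P; split; first by apply: vC; apply: imset_f.
    by apply/eqP; apply: etrans (pvE _) Ei.
  by apply/eqP; apply: etrans (pvE _) _; rewrite /= Ei.
have la : last (f v 0%N) (mkseq (fun i => f v i.+1) l) = f v 0%N.
  by rewrite Em last_map_iota add0n /f modnn mod0n.
apply/andP; split; first by rewrite inE eqxx -[(h v).1.1]/(f v 0%N) f0 pv.
by apply/andP; split; [exact: fl|apply/eqP; exact: la].
Qed.

(** A uniformly random pi puts a given labelled cycle in the right layers with probability l^(-l),
    and some pi does at least as well as the average. *)
Lemma layered_ex C (e : R) : 0 < e -> (0 < n)%N -> e * n%:R ^+ l <= #|cycles C|%:R ->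
  exists pi, e / (l ^ l)%:R * n%:R ^+ l <= layered C pi.
Proof.
move=> e0 n0 H; apply: contrapT => Hno.
have n0' : 0 < n%:R :> R by rewrite ltr0n.
have Hlt pi : layered C pi < e / (l ^ l)%:R * n%:R ^+ l.
  by rewrite ltNge; apply/negP => h; apply: Hno; exists pi.
have ln : (l <= n)%N.
  have : (0 < #|cycles C|)%N.
    by rewrite -(ltr0n R); apply: lt_le_trans H; rewrite mulr_gt0 ?exprn_gt0.
  move=> /card_gt0P[v]; rewrite inE => /andP[/injectiveP vi _].
  by have := leq_card _ vi; rewrite !card_ord.
have E : (\sum_(pi : {ffun 'I_n -> 'I_l}) #|[set v in cycles C | [forall i, pi (v i) == i]]| =
  #|cycles C| * l ^ (n - l))%N.
  under eq_bigr do rewrite -sum1_card.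
  rewrite (exchange_big_dep (mem (cycles C))) /=; last by move=> pi v _; rewrite inE => /andP[].
  rewrite -sum_nat_const; apply: eq_bigr => v vC.
  have vi : injective v by move: vC; rewrite inE => /andP[/injectiveP].
  have := @card_fiber 'I_n 'I_l 'I_l v id vi; rewrite !card_ord => <-.
  by rewrite -sum1_card; apply: eq_bigl => pi; rewrite !inE; move: vC; rewrite inE => ->.
have : \sum_(pi : {ffun 'I_n -> 'I_l}) layered C pi < (l ^ n)%:R * (e / (l ^ l)%:R * n%:R ^+ l).
  have -> : (l ^ n)%:R * (e / (l ^ l)%:R * n%:R ^+ l) = \sum_(pi : {ffun 'I_n -> 'I_l}) (e / (l ^ l)%:R * n%:R ^+ l).
    by rewrite sumr_const card_ffun !card_ord -[RHS]mulr_natl.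
  rewrite (bigD1 [ffun=> ord0]) //= [ltRHS](bigD1 [ffun=> ord0]) //=; apply: ltr_leD => //.
  by apply: ler_sum => pi _; apply: ltW.
apply/negP; rewrite -leNgt.
apply: le_trans (_ : (#|cycles C| * l ^ (n - l))%:R <= _); last first.
  by rewrite -E natr_sum; apply: ler_sum => pi _; apply: layered_count.
have -> : (l ^ n)%:R * (e / (l ^ l)%:R * n%:R ^+ l) = (l ^ (n - l))%:R * (e * n%:R ^+ l) :> R.
  rewrite -{1}(subnK ln) expnD natrM; field.
  by rewrite pnatr_eq0 -lt0n expn_gt0.
by rewrite mulnC natrM; apply: ler_wpM2l.
Qed.

Variables (d : nat) (e : R).

(** The partition pi is picked from C alone, so the fingerprint need not record it. *)
Definition round C F : {set {set 'I_n}} :=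
  if [pick pi | e * n%:R ^+ l <= layered C pi] is Some pi then
    [set [set ab.1; ab.2] | ab in removed l (edge_rel C) (fun a => pi a : nat) d l' 0 e (start pi) (edge_rel F)]
  else set0.

Definition round_print C F : {set {set 'I_n}} :=
  if [pick pi | e * n%:R ^+ l <= layered C pi] is Some pi then
    [set [set ab.1; ab.2] | ab in fingerprint l (edge_rel C) (fun a => pi a : nat) d l' 0 e (start pi) (edge_rel F)]
  else set0.

Lemma round_determined C F J : J \subset F -> round_print C F \subset J ->
  round C J = round C F /\ round_print C J = round_print C F.
Proof.
move=> JF; rewrite /round /round_print; case: pickP => // pi _ H.
have [||E1 E2] := @removed_determined R 'I_n l (edge_rel C) (fun a => pi a : nat) d (edge_rel F) (edge_rel J) l' 0 e (start pi).
- by move=> a b; apply: (subsetP JF).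
- by move=> ab abf; apply: (subsetP H); apply: imset_f.
by rewrite E1 E2.
Qed.

Lemma round_print_sub C F : round_print C F \subset F.
Proof.
rewrite /round_print; case: pickP => [pi _|_]; last exact: sub0set.
by apply/subsetP => _ /imsetP[ab /fingerprint_sub h ->].
Qed.

Lemma round_avoids C F : 0 < e -> (0 < d)%N -> (0 < n)%N -> cycles F = set0 ->
  [disjoint round C F & F].
Proof.
move=> e0 d0 n0 F0; rewrite /round; case: pickP => [pi _|_]; last first.
  by rewrite -setI_eq0 set0I.
rewrite -setI_eq0; apply/eqP/setP => x; rewrite !inE; apply/negbTE/negP => /andP[/imsetP[ab abr ->]].
apply/negP; apply: (removed_avoids e0 d0 _ _ _ _ abr) => //; first by rewrite card_ord.
  move=> y q pq mq; apply/negP => cl.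
  have sq : size (y :: q) = l by rewrite -(size_map (fun a => pi a : nat)) mq size_iota.
  have piv i : (i < l)%N -> pi (nth y (y :: q) i) = i :> nat.
    by move=> il; rewrite -(nth_map y 0%N (fun a => pi a : nat)) ?sq // mq nth_iota.
  pose v := [ffun i : 'I_l => nth y (y :: q) i].
  have : v \in cycles F.
    rewrite inE; apply/andP; split.
      apply/injectiveP => i j; rewrite !ffunE => E; apply: val_inj => /=.
      by rewrite -(piv i) // -(piv j) // E.
    apply/subsetP => _ /imsetP[i _ ->]; rewrite !ffunE.
    case: (ltnP i.+1 l) => il.
      rewrite /= modn_small //; have /(pathP y) := pq; apply.
      by rewrite -ltnS -[(size q).+1]/(size (y :: q)) sq.
    have Ei : i = l' :> nat by apply/anti_leq/andP; split; [rewrite -ltnS|].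
    rewrite /= Ei modnn /= -[l'](_ : size q = l'); last by case: sq.
    by rewrite nth_last.
  by rewrite F0 inE.
move=> x0 a; rewrite inE /= => /andP[/eqP -> /eqP pa]; exists [::]; split=> //=.
by rewrite pa.
Qed.

(** An unordered pair comes from at most two ordered ones, which costs the factor 2. *)
Lemma round_large (dl : R) C F : 0 < dl ->
  (forall (A : rel 'I_n) pi0 (W : {set 'I_n * 'I_n}) (I : rel 'I_n),
    (forall x, (outdeg W x <= 1)%N) -> (forall a, (indeg W a <= 2)%N) ->
    e * n%:R ^+ l <= weight_of R W (layers l A pi0 0 l) ->
    dl * n%:R ^+ 2 <= #|removed l A pi0 d l' 0 e W I|%:R) ->
  (exists pi, e * n%:R ^+ l <= layered C pi) ->
  round C F \subset C /\ dl / 2 * n%:R ^+ 2 <= #|round C F|%:R.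
Proof.
move=> dl0 H [pi0 Hpi0]; rewrite /round; case: pickP => [pi Hpi|/(_ pi0)]; last by rewrite Hpi0.
set S := removed _ _ _ _ _ _ _ _ _.
have SC ab : ab \in S -> [set ab.1; ab.2] \in C.
  rewrite /S; move: (0%N) (e) (start pi) => j ep W.
  elim: (l') j ep W => [|k IH] j ep W /=; first by rewrite inE => /andP[/andP[]].
  by rewrite inE => /orP[|/IH //]; rewrite inE => /andP[/andP[]].
split; first by apply/subsetP => _ /imsetP[ab /SC h ->].
have out1 x : (outdeg (start pi) x <= 1)%N.
  rewrite -(cards1 x); apply: subset_leq_card; apply/subsetP => a; rewrite !inE /=.
  by move=> /andP[/eqP -> _].
have in1 x : (indeg (start pi) x <= 2)%N.
  apply: leq_trans (_ : #|[set x]| <= _)%N; last by rewrite cards1.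
  apply: subset_leq_card; apply/subsetP => a; rewrite !inE /=.
  by move=> /andP[/eqP -> _].
have := H (edge_rel C) (fun a => pi a : nat) (start pi) (edge_rel F) out1 in1 Hpi; rewrite -/S => HS.
rewrite mulrAC ler_pdivrMr //; apply: le_trans HS _; rewrite -natrM ler_nat.
rewrite -sum1_card (partition_big (fun ab : 'I_n * 'I_n => [set ab.1; ab.2]) (mem [set [set ab.1; ab.2] | ab in S])) /=; last first.
  by move=> ab abS; apply: imset_f.
rewrite -sum_nat_const; apply: leq_sum => x /imsetP[[a b] _ ->] /=.
apply: leq_trans (_ : #|[set (a, b); (b, a)]| <= _)%N; last by rewrite cards2; case: eqP.
rewrite sum1_card; apply: subset_leq_card; apply/subsetP => -[a1 b1]; rewrite unfold_in /= => /andP[_ /eqP/setP E].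
have := E a1; have := E b1; have := E a; have := E b; rewrite !inE !eqxx ?orbT /= !xpair_eqE.
rewrite (eq_sym b a1) (eq_sym b b1) (eq_sym a a1) (eq_sym a b1).
by case: (a1 == a); case: (b1 == b); case: (a1 == b); case: (b1 == a).
Qed.

Fixpoint container i F : {set {set 'I_n}} :=
  if i is j.+1 then container j F :\: round (container j F) F else pairs n.

Fixpoint container_print i F : {set {set 'I_n}} :=
  if i is j.+1 then container_print j F :|: round_print (container j F) F else set0.

Lemma container_determined i F J : J \subset F -> container_print i F \subset J ->
  container i J = container i F.
Proof.
move=> JF; elim: i => [//|i IH] /=; rewrite subUset => /andP[/IH -> h].
by have [-> _] := round_determined JF h.
Qed.

Lemma container_print_sub i F : container_print i F \subset F.
Proof. by elim: i => [|i IH] /=; rewrite ?sub0set // subUset IH round_print_sub. Qed.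

Lemma sub_container i F : 0 < e -> (0 < d)%N -> (0 < n)%N -> F \subset pairs n -> cycles F = set0 ->
  F \subset container i F.
Proof.
move=> e0 d0 n0 FP F0; elim: i => [//|i IH] /=.
by rewrite subsetD IH disjoint_sym round_avoids.
Qed.

Lemma container_print_card (M : R) i F : (forall (A : rel 'I_n) pi0 (W : {set 'I_n * 'I_n}) (I : rel 'I_n),
    (size (fingerprint l A pi0 d l' 0 e W I))%:R <= M * (n%:R * d%:R)) -> 0 <= M ->
  #|container_print i F|%:R <= i%:R * M * (n%:R * d%:R).
Proof.
move=> HM M0; elim: i => [|i IH] /=; first by rewrite cards0 !mul0r.
apply: le_trans (_ : #|container_print i F|%:R + #|round_print (container i F) F|%:R <= _).
  by rewrite -natrD ler_nat leq_card_setU.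
rewrite -natr1 mulrDl mulrDl mul1r; apply: lerD => //.
rewrite /round_print; case: pickP => [pi _|_]; last by rewrite cards0 mulr_ge0 ?mulr_ge0.
apply: le_trans (HM (edge_rel (container i F)) (fun a => pi a : nat) (start pi) (edge_rel F)).
rewrite ler_nat; apply: leq_trans (leq_imset_card _ _) _; exact: card_size.
Qed.
End Fixed.
End Containers.

Lemma cycles_sub l' n (C D : {set {set 'I_n}}) : C \subset D -> cycles l' C \subset cycles l' D.
Proof.
by move=> CD; apply/subsetP => v; rewrite !inE => /andP[-> /subset_trans]; apply.
Qed.

(** As long as the container has many cycles, a round removes dl/2 n^2 of its pairs; more than 2/dl
    rounds would remove more than n^2. *)
Lemma containers (R : realType) (l' : nat) (e0 : R) : (3 <= l'.+1)%N -> 0 < e0 ->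
  exists2 K : R, 0 <= K & forall n d : nat, (2 <= d)%N -> (d ^ l' <= n)%N ->
  (n <= 2 ^ l'.+1 * d ^ l')%N ->
  exists C T : {set {set 'I_n}} -> {set {set 'I_n}}, forall F : {set {set 'I_n}}, F \subset pairs n ->
  cycles l' F = set0 -> [/\ T F \subset F, F \subset C (T F),
    #|cycles l' (C (T F))|%:R < e0 * n%:R ^+ l'.+1 & #|T F|%:R <= K * (n%:R * d%:R)].
Proof.
move=> l3 e00; pose e1 := Num.min e0 1; pose e := e1 / (l'.+1 ^ l'.+1)%:R.
have e10 : 0 < e1 by rewrite lt_min e00 ltr01.
have L0 : 0 < (l'.+1 ^ l'.+1)%:R :> R by rewrite ltr0n expn_gt0.
have ee : 0 < e <= 1.
  rewrite divr_gt0 //= ler_pdivrMr // mul1r ge_min; apply/orP; right.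
  by rewrite ler1n expn_gt0.
have /andP[ee0 _] := ee.
have [dl dl0 Hdl] := removed_large l'.+1 l' ee.
have [M [M0 HM]] := fingerprint_size l' ee0.
pose m := Num.bound (2 / dl).
have mE : 1 < m%:R * (dl / 2).
  have := archi_boundP (ltW (divr_gt0 (ltr0n R 2) dl0)); rewrite -/m ltr_pdivrMr //; lra.
exists (m%:R * M); first by rewrite mulr_ge0.
move=> n d d2 dn nd.
have d0 : (0 < d)%N by apply: leq_trans d2.
have n0 : (0 < n)%N by apply: leq_trans dn; rewrite expn_gt0 d0.
have n0' : 0 < n%:R :> R by rewrite ltr0n.
(* The container is recovered by running the algorithm on the fingerprint in place of F. *)
exists (container l' d e m), (container_print l' d e m) => F FP F0.
have TF := container_print_sub l' d e m F.
rewrite (container_determined TF (subxx _)); split => //.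
- exact: sub_container.
- rewrite ltNge; apply/negP => big.
  have shrink i : e1 * n%:R ^+ l'.+1 <= #|cycles l' (container l' d e i F)|%:R ->
      #|container l' d e i F|%:R + i%:R * (dl / 2 * n%:R ^+ 2) <= n%:R ^+ 2.
    elim: i => [|i IH] Hi.
      by rewrite mul0r addr0 -natrX ler_nat card_pairs bin_le_exp.
    have Hi' : e1 * n%:R ^+ l'.+1 <= #|cycles l' (container l' d e i F)|%:R.
      by apply: le_trans Hi _; rewrite ler_nat subset_leq_card // cycles_sub // subsetDl.
    have [|rC rl] := @round_large R l' n d e dl (container l' d e i F) F dl0 _ (layered_ex e10 n0 Hi').
      move=> A pi0 W I o1 i1 w1; have := Hdl 'I_n A pi0 d 0%N W I; rewrite card_ord; apply=> //.
      by rewrite expn0 mulr1.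
    apply: le_trans (IH Hi').
    have -> : #|container l' d e i F|%:R = #|container l' d e i.+1 F|%:R
        + #|round l' d e (container l' d e i F) F|%:R :> R.
      by rewrite -natrD /= cardsD (setIidPr rC) subnK // subset_leq_card.
    rewrite -natr1; move: rl; set u := dl / 2 * _; lra.
  have e1e0 : e1 <= e0 by rewrite /e1 ge_min lexx.
  have := shrink m (le_trans (ler_wpM2r (exprn_ge0 l'.+1 (ltW n0')) e1e0) big).
  have : 0 <= #|container l' d e m F|%:R :> R by [].
  have : n%:R ^+ 2 < m%:R * (dl / 2) * n%:R ^+ 2 :> R by rewrite ltr_pMl ?exprn_gt0.
  rewrite -mulrA; lra.
- apply: container_print_card => // A pi0 W I.
  by have := HM 'I_n l'.+1 A pi0 d 0%N W I; rewrite card_ord; apply.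
Qed.

(** * Supersaturation and the union bound *)

Lemma card_fiber_set (A B J : finType) (io : J -> A) (S : {set {ffun J -> B}}) : injective io ->
  #|[set x : {ffun A -> B} | [ffun j => x (io j)] \in S]| = (#|S| * #|B| ^ (#|A| - #|J|))%N.
Proof.
move=> inj; rewrite -sum1_card (partition_big (fun x : {ffun A -> B} => [ffun j => x (io j)]) (mem S)) /=.
  rewrite -sum_nat_const; apply: eq_bigr => y yS; rewrite -(card_fiber y inj) -sum1_card.
  apply: eq_bigl => x; rewrite !inE; apply/andP/forallP => [[_ /eqP <-] j|H]; first by rewrite ffunE.
  have -> : [ffun j => x (io j)] = y by apply/ffunP => j; rewrite ffunE; apply/eqP.
  by rewrite yS eqxx.
by move=> x; rewrite inE.
Qed.

Lemma card_fiber_pair (n N0 : nat) (B : {set 'I_n * 'I_n}) (i j : 'I_N0) : i != j ->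
  (#|[set x : {ffun 'I_N0 -> 'I_n} | (x i, x j) \in B]| <= #|B| * n ^ (N0 - 2))%N.
Proof.
move=> ij; pose S := [set y : {ffun bool -> 'I_n} | (y true, y false) \in B].
pose io b := if b then i else j.
have inj : injective io by case; case=> //= E; move: ij; rewrite E eqxx.
have := card_fiber_set S inj; rewrite card_bool !card_ord => E.
have SB : (#|S| <= #|B|)%N.
  have hi : injective (fun y : {ffun bool -> 'I_n} => (y true, y false)).
    by move=> y z [E1 E2]; apply/ffunP => -[].
  rewrite -(card_imset _ hi); apply: subset_leq_card; apply/subsetP => _ /imsetP[y yS ->].
  by rewrite inE in yS.
apply: leq_trans (leq_mul SB (leqnn _)); rewrite -E; apply: subset_leq_card.
by apply/subsetP => x; rewrite !inE !ffunE.
Qed.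

Lemma complete_ramsey (R : realType) (r l : nat) : (2 ^ r + 1 <= l)%N -> odd l ->
  exists2 N0 : nat, (2 <= N0)%N & ramsey_cycle r l (pairs N0).
Proof.
move=> lr lo.
have [|N HN] := @zero_threshold_dense R r l 1 lr lo.
  by rewrite ltrBlDr ltrDl invr_gt0 exprn_gt0.
exists (maxn N 2); first exact: leq_maxr.
apply: HN; rewrite ?leq_maxl ?/is_graph //.
by rewrite /density card_pairs divff // pnatr_eq0 -lt0n bin_gt0 leq_maxr.
Qed.

(** Take N0 with K_(N0) Ramsey and map its vertices to [n] in all ways. At most a quarter of the
    maps have collisions and at most a quarter meet a missing pair; every other map carries a cycle
    into some [C c]. Few cycles in all classes would account for only another quarter. *)
Lemma supersaturation (R : realType) (r l' : nat) : (0 < r)%N -> (2 ^ r + 1 <= l'.+1)%N -> odd l'.+1 ->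
  (3 <= l'.+1)%N ->
  exists e0 d0 : R, [/\ 0 < e0, 0 < d0 & exists N : nat, forall n (C : 'I_r -> {set {set 'I_n}}), (N <= n)%N ->
  #|pairs n :\: \bigcup_c C c|%:R <= d0 * n%:R ^+ 2 ->
  exists c, e0 * n%:R ^+ l'.+1 <= #|cycles l' (C c)|%:R].
Proof.
move=> r0 lr lo l3; have [N0 N2 HN0] := complete_ramsey R lr lo.
set l := l'.+1 in lr lo l3 HN0 *.
have N00 : 0 < N0%:R :> R by rewrite ltr0n; apply: leq_trans N2.
have r0' : 0 < r%:R :> R by rewrite ltr0n.
exists ((4 * (N0%:R ^+ l * r%:R))^-1), ((8 * N0%:R ^+ 2)^-1); split.
- by rewrite invr_gt0 !mulr_gt0 ?exprn_gt0.
- by rewrite invr_gt0 mulr_gt0 ?exprn_gt0.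
set e0 : R := (4 * (N0%:R ^+ l * r%:R))^-1; set d0 : R := (8 * N0%:R ^+ 2)^-1.
exists (4 * N0 ^ 2).+1 => n C nN Hmiss; apply: contrapT => Hno.
have n0' : 0 < n%:R :> R by rewrite ltr0n; apply: leq_trans nN.
have few c : #|cycles l' (C c)|%:R <= e0 * n%:R ^+ l.
  by rewrite leNgt; apply/negP => h; apply: Hno; exists c; apply: ltW.
set S := pairs n :\: \bigcup_c C c in Hmiss.
pose B := [set u : 'I_n * 'I_n | (u.1 == u.2) || ([set u.1; u.2] \in S)].
have cB : (#|B| <= n + 2 * #|S|)%N.
  rewrite -(card_edges (G := S)) ?/is_graph ?subsetDl // pair_big /=.
  have -> : (\sum_(p : 'I_n * 'I_n) ((p.1 != p.2) && ([set p.1; p.2] \in S)) =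
     #|[set u : 'I_n * 'I_n | (u.1 != u.2) && ([set u.1; u.2] \in S)]|)%N.
    by rewrite -sum1_card [RHS]big_mkcond; apply: eq_bigr => u _; rewrite inE; case: (_ && _).
  set O := [set u | _ & _].
  apply: leq_trans (_ : #|[set (a, a) | a in 'I_n]| + #|O| <= _)%N; last first.
    by rewrite leq_add2r -[leqRHS]card_ord; apply: leq_imset_card.
  apply: leq_trans (leq_card_setU _ _); apply: subset_leq_card; apply/subsetP => -[a b].
  rewrite !inE /=; case: (eqVneq a b) => [-> _|ab] /=; last by move=> ->; rewrite orbT.
  by rewrite imset_f.
pose X := {ffun 'I_N0 -> 'I_n}.
pose bad := [set x : X | [exists i, exists j, (i != j) && ((x i, x j) \in B)]].
have cbad : (#|bad| <= N0 ^ 2 * (#|B| * n ^ (N0 - 2)))%N.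
  apply: leq_trans (_ : \sum_(u : 'I_N0 * 'I_N0 | u.1 != u.2) #|[set x : X | (x u.1, x u.2) \in B]| <= _)%N.
    rewrite -sum1_card; under [leqRHS]eq_bigr do rewrite -sum1_card.
    rewrite (exchange_big_dep xpredT) //= big_mkcond; apply: leq_sum => x _.
    case: ifP => //; rewrite inE => /existsP[i /existsP[j /andP[ij h]]].
    by rewrite (bigD1 (i, j)) //= inE ij h.
  apply: leq_trans (_ : \sum_(u : 'I_N0 * 'I_N0 | u.1 != u.2) (#|B| * n ^ (N0 - 2)) <= _)%N.
    by apply: leq_sum => -[i j] /= ij; apply: card_fiber_pair.
  rewrite sum_nat_const leq_mul2r; apply/orP; right.
  by apply: leq_trans (max_card _) _; rewrite card_prod !card_ord.
pose comp (v : {ffun 'I_l -> 'I_N0}) (x : X) := [ffun i => x (v i)].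
have cgood : (#|~: bad| <= \sum_(v : {ffun 'I_l -> 'I_N0} | injectiveb v) \sum_(c : 'I_r) #|cycles l' (C c)| * n ^ (N0 - l))%N.
  apply: leq_trans (_ : \sum_(v : {ffun 'I_l -> 'I_N0} | injectiveb v) \sum_(c : 'I_r) #|[set x : X | comp v x \in cycles l' (C c)]| <= _)%N; last first.
    apply: leq_sum => v /injectiveP vi; apply: leq_sum => c _.
    by have := card_fiber_set (cycles l' (C c)) vi; rewrite !card_ord => ->.
  rewrite -sum1_card; under [leqRHS]eq_bigr do under eq_bigr do rewrite -sum1_card.
  under [leqRHS]eq_bigr do rewrite (exchange_big_dep xpredT) //=.
  rewrite (exchange_big_dep xpredT) //= big_mkcond; apply: leq_sum => x _.
  case: ifP => //; rewrite !inE negb_exists => /forallP good.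
  have ok i j : i != j -> (x i != x j) /\ exists c, [set x i; x j] \in C c.
    move=> ij; have := good i; rewrite negb_exists => /forallP/(_ j); rewrite ij inE /= negb_or inE.
    case/andP=> xij; rewrite negb_and inE cards2 xij orbF negbK => /bigcupP[c _ h].
    by split=> //; exists c.
  (* The classes may overlap; an edge takes any colour whose class contains its image. *)
  pose col := [ffun e : {set 'I_N0} => odflt (Ordinal r0) [pick c | [set x i | i in e] \in C c]].
  have /mono_cycleP[v [k [vi vP vk]]] := forallP HN0 col.
  have vw i j : x (v i) = x (v j) -> i = j.
    move=> E; apply: vi; apply/eqP; apply: contraT => /ok[]; by rewrite E eqxx.
  have xcyc : comp v x \in cycles l' (C k).
    rewrite inE; apply/andP; split; first by apply/injectiveP => i j; rewrite !ffunE => /vw.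
    apply/subsetP => _ /imsetP[i _ ->]; rewrite !ffunE.
    have ij : v i != v (ordS i) by rewrite (inj_eq vi) eq_sym ordS_neq // (ltn_trans _ l3).
    have ein : [set v i; v (ordS i)] \in cycle_edges v by apply/imsetP; exists i.
    have := vk _ ein; rewrite ffunE.
    rewrite imsetU1 imset_set1; case: pickP => [c h <- //|h _].
    by have [_ [c hc]] := ok _ _ ij; have := h c; rewrite hc.
  rewrite (bigD1 v) /=; last by rewrite andbT; apply/injectiveP.
  have xk : x \in [set x | comp v x \in cycles l' (C k)] by rewrite inE.
  by rewrite (bigD1 k xk).
have tot : (n ^ N0 = #|bad| + #|~: bad|)%N by rewrite cardsC card_ffun !card_ord.
have h1 : #|bad|%:R <= n%:R ^+ N0 / 2 :> R.
  apply: le_trans (_ : (N0 ^ 2 * ((n + 2 * #|S|) * n ^ (N0 - 2)))%:R <= _).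
    by rewrite ler_nat; apply: leq_trans cbad _; rewrite leq_mul2l leq_mul2r cB !orbT.
  have -> : n%:R ^+ N0 = n%:R ^+ 2 * n%:R ^+ (N0 - 2) :> R by rewrite -exprD subnKC.
  rewrite mulnA natrM [(n ^ _)%:R]natrX mulrAC; apply: ler_wpM2r; first by rewrite exprn_ge0.
  rewrite natrM natrD natrM !natrX.
  have i1 : N0%:R ^+ 2 * n%:R <= n%:R ^+ 2 / 4 :> R.
    have -> : n%:R ^+ 2 / 4 = n%:R / 4 * n%:R :> R by ring.
    rewrite ler_pM2r // ler_pdivlMr // mulrC -natrX -natrM ler_nat.
    exact: ltnW.
  have i2 : N0%:R ^+ 2 * (2 * #|S|%:R) <= n%:R ^+ 2 / 4 :> R.
    apply: le_trans (_ : N0%:R ^+ 2 * (2 * (d0 * n%:R ^+ 2)) <= _).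
      by rewrite !ler_wpM2l ?exprn_ge0.
    by rewrite le_eqVlt; apply/orP; left; apply/eqP; rewrite /d0; field; rewrite gt_eqF.
  rewrite mulrDr; move: i1 i2; clear; lra.
have h2 : #|~: bad|%:R <= n%:R ^+ N0 / 4 :> R.
  move: cgood; rewrite -(ler_nat R) natr_sum => /le_trans; apply.
  apply: le_trans (_ : \sum_(v : {ffun 'I_l -> 'I_N0}) \sum_(c : 'I_r) e0 * n%:R ^+ N0 <= _).
    rewrite big_mkcond; apply: ler_sum => v _.
    have e00 : 0 <= e0 * n%:R ^+ N0 by rewrite mulr_ge0 ?invr_ge0 ?mulr_ge0 ?exprn_ge0.
    case: ifP => [/injectiveP vi|_]; last by apply: sumr_ge0.
    have lN : (l <= N0)%N by have := leq_card _ vi; rewrite !card_ord.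
    rewrite natr_sum; apply: ler_sum => c _.
    have -> : n%:R ^+ N0 = n%:R ^+ l * n%:R ^+ (N0 - l) :> R by rewrite -exprD subnKC.
    rewrite natrM natrX mulrA.
    by apply: ler_wpM2r; [rewrite exprn_ge0|exact: few].
  rewrite !sumr_const card_ffun !card_ord -!mulrnA -[_ *+ _]mulr_natl natrM natrX.
  rewrite /e0; move: (exprn_gt0 l N00) r0'; move: (N0%:R ^+ l) (n%:R ^+ N0) (r%:R) => P Q q P0 q0.
  by rewrite le_eqVlt; apply/orP; left; apply/eqP; field; rewrite !gt_eqF.
have : (n ^ N0)%:R <= n%:R ^+ N0 / 2 + n%:R ^+ N0 / 4 :> R by rewrite tot natrD lerD.
have : 0 < n%:R ^+ N0 :> R by rewrite exprn_gt0.
by rewrite natrX; move: (n%:R ^+ N0) => Q; clear; lra.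
Qed.

Lemma ramsey_mono (n r l : nat) (G H : {set {set 'I_n}}) : G \subset H ->
  ramsey_cycle r l G -> ramsey_cycle r l H.
Proof.
move=> GH /forallP HG; apply/forallP => c.
have /mono_cycleP[v [k [vi vG vk]]] := HG c.
by apply/mono_cycleP; exists v, k; split=> //; apply: subset_trans GH.
Qed.

(** For the largest d with d^k <= n one has n < (d + 1)^k <= (2 d)^k. *)
Lemma exists_root (k n : nat) : (0 < k)%N -> (2 ^ k <= n)%N ->
  exists d, [/\ (2 <= d)%N, (d ^ k <= n)%N & (n <= 2 ^ k.+1 * d ^ k)%N].
Proof.
move=> k0 kn.
have bd d : (d ^ k <= n)%N -> (d <= n)%N.
  by apply: leq_trans; case: d => // d; rewrite -{1}[d.+1]expn1 leq_pexp2l.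
case: (ex_maxnP (ex_intro (fun d => (d ^ k <= n)%N) 2 kn) bd) => d dn dmax.
exists d; split=> //; first exact: dmax.
have : ~~ (d.+1 ^ k <= n)%N by apply/negP => /dmax; rewrite ltnn.
rewrite -ltnNge => /ltnW/leq_trans; apply.
apply: leq_trans (_ : (2 * d) ^ k <= _)%N.
  rewrite leq_exp2r //; have := dmax _ kn; lia.
by rewrite expnMn leq_mul2r leq_exp2l // leqnSn orbT.
Qed.

(** * The union bound over fingerprints *)

Lemma sum_partial_colourings (R : realType) (n r : nat) (x : R) : 0 <= x ->
  \sum_(f : {ffun {set 'I_n} -> option 'I_r} | [set e | f e != None] \subset pairs n)
     x ^+ #|[set e | f e != None]| <= expR (r%:R * x * n%:R ^+ 2).
Proof.
move=> x0.
pose g (e : {set 'I_n}) (o : option 'I_r) : R := if e \in pairs n then (if o is Some _ then x else 1) else (o == None)%:R.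
have -> : \sum_(f : {ffun {set 'I_n} -> option 'I_r} | [set e | f e != None] \subset pairs n)
     x ^+ #|[set e | f e != None]| = \sum_(f : {ffun {set 'I_n} -> option 'I_r}) \prod_e g e (f e).
  rewrite big_mkcond; apply: eq_bigr => f _; case: ifP => [/subsetP sub|/negbT/subsetPn[e]].
    rewrite -prod_set; apply: eq_bigr => e _; rewrite inE /g.
    case: (boolP (e \in pairs n)) => eP; first by case: (f e).
    by have := contraNN (sub e) eP; rewrite inE negbK => /eqP ->.
  by rewrite inE => fe eP; rewrite (bigD1 e) //= /g (negbTE eP) (negbTE fe) mul0r.
rewrite -(bigA_distr_bigA g) /=.
have Eg e : \sum_o g e o = if e \in pairs n then 1 + r%:R * x else 1.
  rewrite /g; case: ifP => _; last first.
    by rewrite (bigD1 None) //= big1 ?addr0 // => o /negbTE ->.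
  rewrite (bigD1 None) //=; congr (_ + _).
  rewrite (eq_bigr (fun=> x)) => [|[] //]; rewrite sumr_const -[LHS]mulr_natl; congr (_%:R * _).
  by have := cardC1 (None : option 'I_r); rewrite card_option card_ord /= => E; apply: etrans E; apply: eq_card.
rewrite (eq_bigr _ (fun e _ => Eg e)) prod_set.
apply: le_trans (_ : expR (r%:R * x) ^+ #|pairs n| <= _).
  by apply: lerXn2r; rewrite ?nnegrE ?expR_ge0 ?addr_ge0 ?mulr_ge0 ?expR_ge1Dx.
rewrite -expRM_natl ler_expR mulrC; apply: ler_wpM2l; first by rewrite mulr_ge0.
by rewrite -natrX ler_nat card_pairs bin_le_exp.
Qed.

(* A non-Ramsey graph splits into r cycle-free classes and is thus disjoint from the set B of pairs
   missed by their containers; the factor expR (- t) makes the sum over the fingerprints small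
   against (1 - p) ^+ #|B|. *)
Lemma Pr_not_ramsey (R : realType) (r l' : nat) : (0 < r)%N -> (2 ^ r + 1 <= l'.+1)%N -> odd l'.+1 ->
  (3 <= l'.+1)%N ->
  exists N : nat, exists La : R, forall n d (p : R), (N <= n)%N -> (2 <= d)%N -> (d ^ l' <= n)%N ->
  (n <= 2 ^ l'.+1 * d ^ l')%N -> 0 <= p <= 1 -> La * d%:R <= p * n%:R ->
  Pr p (fun H : {set {set 'I_n}} => ~~ ramsey_cycle r l'.+1 H) <= expR (- n%:R).
Proof.
move=> r0 lr lo l3.
have [e0 [d0 [e00 d00 [N HN]]]] := supersaturation R r0 lr lo l3.
have [K K0 HK] := containers l3 e00.
have r0' : 0 < r%:R :> R by rewrite ltr0n.
(* Then r exp(-t) <= r/t = d0/2, so half of the exponent p d0 n^2 pays for summing over the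
   fingerprints. *)
pose t := 2 * r%:R / d0.
have t0 : 0 < t by rewrite divr_gt0 // mulr_gt0.
exists (maxn N 1), (2 / d0 * (t * (r%:R * K) + 1)) => n d p.
rewrite geq_max => /andP[Nn n1] d2 dn nd p01 pn.
have [p0 p1] := andP p01.
have [C [T HCT]] := HK n d d2 dn nd.
pose m := r%:R * (K * (n%:R * d%:R)).
pose class (s : {ffun {set 'I_n} -> option 'I_r}) c := [set e | s e == Some c].
pose A (s : {ffun {set 'I_n} -> option 'I_r}) := [set e | s e != None].
pose B s := pairs n :\: \bigcup_(c : 'I_r) C (class s c).
pose Q s := [&& A s \subset pairs n, [disjoint A s & B s], #|A s|%:R <= m & d0 * n%:R ^+ 2 <= #|B s|%:R].
apply: le_trans (_ : \sum_(s | Q s) p ^+ #|A s| * (1 - p) ^+ #|B s| <= _).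
  apply: Pr_union => // [s /and4P[h1 h2 _ _]|H HP]; first by split=> //; apply: subsetDl.
  rewrite negb_forall => /existsP[col nocyc].
  pose F c := [set e in H | col e == c].
  have FP c : F c \subset pairs n by apply: subset_trans HP; apply/subsetP => e; rewrite inE => /andP[].
  have F0 c : cycles l' (F c) = set0.
    apply/setP => v; rewrite !inE; apply/negbTE/negP => /andP[/injectiveP vi /subsetP vF].
    move/negP: nocyc; apply; apply/mono_cycleP; exists v, c; split=> //.
      by apply/subsetP => e /vF; rewrite inE => /andP[].
    by move=> e /vF; rewrite inE => /andP[_ /eqP].
  pose s : {ffun {set 'I_n} -> option 'I_r} := [ffun e => if e \in T (F (col e)) then Some (col e) else None].
  have sE c : class s c = T (F c).
    have [/subsetP TF _ _ _] := HCT _ (FP c) (F0 c).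
    apply/setP => e; rewrite inE ffunE; apply/idP/idP => [|eT].
      by case: ifP => // h /eqP[<-].
    by have := TF _ eT; rewrite inE => /andP[_ /eqP ->]; rewrite eT eqxx.
  have As e : e \in A s -> e \in T (F (col e)) by rewrite inE ffunE; case: ifP.
  have AH : A s \subset H.
    apply/subsetP => e /As; have [/subsetP TF _ _ _] := HCT _ (FP (col e)) (F0 (col e)).
    by move=> /TF; rewrite inE => /andP[].
  have BH : [disjoint B s & H].
    rewrite -setI_eq0; apply/eqP/setP => e; rewrite !inE; apply/negbTE/negP => /andP[/andP[/negP h _] eH].
    apply: h; apply/bigcupP; exists (col e) => //; rewrite sE.
    have [_ /subsetP FC _ _] := HCT _ (FP (col e)) (F0 (col e)).
    by apply: FC; rewrite inE eH eqxx.
  exists s; last by rewrite AH BH.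
  apply/and4P; split.
  - exact: subset_trans HP.
  - by rewrite disjoint_sym; apply: disjointWr BH.
  - apply: le_trans (_ : (\sum_(c : 'I_r) #|T (F c)|)%:R <= _).
      rewrite ler_nat; apply: leq_trans (_ : #|\bigcup_(c : 'I_r) T (F c)| <= _)%N.
        by apply: subset_leq_card; apply/subsetP => e /As h; apply/bigcupP; exists (col e).
      apply: (big_ind2 (fun (X : {set {set 'I_n}}) k => #|X| <= k)%N) => //; first by rewrite cards0.
      by move=> X1 k1 X2 k2 h1 h2; apply: leq_trans (leq_card_setU _ _) _; apply: leq_add.
    rewrite natr_sum /m mulr_natl -[r in X in _ <= X]card_ord -sumr_const; apply: ler_sum => c _.
    by have [] := HCT _ (FP c) (F0 c).
  - rewrite leNgt; apply/negP => /ltW h.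
    have [c] := HN n (fun c => C (class s c)) Nn h; apply/negP; rewrite -ltNge sE.
    by have [] := HCT _ (FP c) (F0 c).
(* As |A s| <= m, replacing p by x in p^|A s| costs at most the factor exp(t m). *)
pose x := p * expR (- t).
have x0 : 0 <= x by rewrite mulr_ge0 ?expR_ge0.
apply: le_trans (_ : \sum_(s | Q s) expR (t * m - p * (d0 * n%:R ^+ 2)) * x ^+ #|A s| <= _).
  apply: ler_sum => s /and4P[_ _ h1 h2].
  rewrite expRD mulrAC; apply: ler_pM; rewrite ?exprn_ge0 ?subr_ge0 //.
    rewrite /x exprMn mulrCA; apply: ler_peMr; first exact: exprn_ge0.
    rewrite -expRM_natl -expRD; rewrite -[leLHS]expR0 ler_expR mulrN subr_ge0 mulrC; apply: ler_wpM2l => //; exact: ltW.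
  apply: le_trans (_ : expR (- p) ^+ #|B s| <= _).
    by apply: lerXn2r; rewrite ?nnegrE ?expR_ge0 ?subr_ge0 ?expR_ge1Dx.
  by rewrite -expRM_natl ler_expR mulrN lerN2 mulrC; apply: ler_wpM2r.
rewrite -mulr_sumr.
apply: le_trans (_ : expR (t * m - p * (d0 * n%:R ^+ 2)) * expR (r%:R * x * n%:R ^+ 2) <= _).
  apply: ler_wpM2l; first exact: expR_ge0.
  apply: le_trans (sum_partial_colourings _ _ x0).
  rewrite big_mkcond [leRHS]big_mkcond; apply: ler_sum => s _.
  rewrite /Q; case: (A s \subset pairs n) => //=; case: ifP => // _; exact: exprn_ge0.
rewrite -expRD ler_expR.
have rx : r%:R * x <= p * (d0 / 2).
  rewrite /x mulrCA; apply: ler_wpM2l => //.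
  have : expR (- t) <= t^-1.
    rewrite expRN lef_pV2 ?posrE ?expR_gt0 //; have := expR_ge1Dx t; lra.
  move=> h; apply: le_trans (ler_wpM2l (ltW r0') h) _.
  by rewrite le_eqVlt; apply/orP; left; apply/eqP; rewrite /t; field; rewrite !gt_eqF.
have n0 : 1 <= n%:R :> R by rewrite ler1n.
have d1 : 1 <= d%:R :> R by rewrite ler1n; apply: leq_trans d2.
have s1 : r%:R * x * n%:R ^+ 2 <= p * (d0 / 2) * n%:R ^+ 2 by apply: ler_wpM2r; rewrite ?exprn_ge0.
have s2 : (t * (r%:R * K) + 1) * d%:R * n%:R <= p * (d0 / 2) * n%:R ^+ 2.
  have h : (t * (r%:R * K) + 1) * d%:R <= p * n%:R * (d0 / 2).
    rewrite -ler_pdivrMr ?divr_gt0 //; apply: le_trans pn.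
    by rewrite le_eqVlt; apply/orP; left; apply/eqP; field; rewrite !gt_eqF.
  have -> : p * (d0 / 2) * n%:R ^+ 2 = p * n%:R * (d0 / 2) * n%:R by ring.
  by apply: ler_wpM2r.
have s3 : n%:R <= d%:R * n%:R :> R by apply: ler_peMl.
have E1 : (t * (r%:R * K) + 1) * d%:R * n%:R = t * m + d%:R * n%:R by rewrite /m; ring.
rewrite E1 in s2; move: s1 s2 s3; set u := p * (d0 / 2) * _.
have -> : p * (d0 * n%:R ^+ 2) = 2 * u by rewrite /u; field.
clearbody u; move: (n%:R) (d%:R * _) (r%:R * x * _) (t * m) => *; lra.
Qed.

Lemma upper_bound_containers (R : realType) (r l : nat) (d : R) : (0 < r)%N -> (2 ^ r + 1 <= l)%N ->
  odd l -> (3 <= l)%N -> upper_bound r l d (npow (-1 + 1 / (l%:R - 1))).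
Proof.
case: l => // l' r0 lr lo l3 p p01 /omega_seqE om G _.
have [N [La H]] := Pr_not_ramsey R r0 lr lo l3.
have [N1 HN1] := om (Num.max La 1).
apply: cvg_of_bounds => e e0.
pose N2 := Num.bound (e^-1).
exists (maxn (maxn N N1) (maxn (2 ^ l') N2.+1)) => n; rewrite !geq_max => /andP[/andP[Nn N1n] /andP[ln N2n]].
have [pn0 pn1] := andP (p01 n).
have n1 : (0 < n)%N by apply: leq_trans N2n.
have n0 : 0 < n%:R :> R by rewrite ltr0n.
have l0 : (0 < l')%N by (clear -l3; lia).
have [b [b2 bn nb]] := exists_root l0 ln.
rewrite prob_ramseyE Pr_compl opprB addrC subrK ger0_norm; last by apply: Pr_ge0.
apply: le_trans (_ : Pr (p n) (fun H : {set {set 'I_n}} => ~~ ramsey_cycle r l'.+1 H) <= _).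
  apply: Pr_le => // S _; apply: contraNN; apply: ramsey_mono; exact: subsetUr.
apply: le_trans (H n b (p n) Nn b2 bn nb (p01 n) _) _.
  set f := npow (-1 + 1 / (l'.+1%:R - 1)) in HN1.
  have f0 : 0 < f n by rewrite /f /npow powR_gt0.
  have fE := @npow_threshold R l'.+1 n (ltnW l3) n1; rewrite -/f /= in fE.
  have q1 : 1 <= Num.max La 1 by rewrite le_max lexx orbT.
  have h : Num.max La 1 * f n <= p n by rewrite -ler_pdivlMr //; apply: HN1.
  apply: le_trans (_ : Num.max La 1 * b%:R <= _); first by apply: ler_wpM2r; rewrite // le_max lexx.
  (* f n * n is n^(1/(l-1)), so a large multiple of f bounds p n below by that multiple of b. *)
  have bf : b%:R <= f n * n%:R.
    rewrite -(ler_pXn2r l0) ?nnegrE ?mulr_ge0 ?(ltW f0) //.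
    have En : n%:R ^+ l' = n%:R ^+ (l'.+1 - 2) * n%:R :> R.
      by rewrite -exprSr; congr (_ ^+ _); (clear -l3; lia).
    rewrite exprMn fE En mulrA mulVf ?mul1r; last by rewrite gt_eqF // exprn_gt0.
    by rewrite -natrX ler_nat.
  apply: le_trans (_ : Num.max La 1 * (f n * n%:R) <= _).
    by apply: ler_wpM2l => //; apply: le_trans q1.
  by rewrite mulrA; apply: ler_wpM2r.
rewrite expRN -[e]invrK lef_pV2 ?posrE ?expR_gt0 ?invr_gt0 //.
have := archi_boundP (ltW (_ : 0 < e^-1)); rewrite invr_gt0 => /(_ e0); rewrite -/N2 => hN2.
have : N2%:R <= n%:R :> R by rewrite ler_nat ltnW.
have := expR_ge1Dx (n%:R : R); lra.
Qed.

Unset Implicit Arguments.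

Theorem theorem1p11 (R : realType) (r l : nat) :
  (3 <= r)%N -> (2 ^ r + 1 <= l)%N -> odd l ->
  (forall d : R, 0 <= d <= 1 - 2 ^- (r - 2) ->
     is_threshold r l d (npow (-1 + 1 / (l%:R - 1)))) /\
  (forall d : R, 1 - 2 ^- (r - 2) < d <= 1 - 2 ^- (r - 1) ->
     lower_bound r l d (npow (-1)) /\
     upper_bound r l d (npow (-1 + 1 / (l%:R - 1)))) /\
  (forall d : R, 1 - 2 ^- (r - 1) < d <= 1 - 2 ^- r ->
     is_threshold r l d (npow (-2))) /\
  (forall d : R, 1 - 2 ^- r < d <= 1 -> zero_threshold r l d).
Proof.
move=> r3 lr lo; have r0 : (0 < r)%N by apply: leq_trans r3.
have l5 : (5 <= l)%N.
  by apply: leq_trans lr; rewrite addn1 ltnS (leq_trans (_ : 4 <= 2 ^ 3)%N) ?leq_exp2l.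
have l3 : (3 <= l)%N by apply: leq_trans l5.
split; [|split; [|split]] => d /andP[d1 d2].
- split; first exact: upper_bound_containers.
  by apply: lower_bound_ramsey2 => //; apply: leq_trans r3.
- split; first exact: lower_bound_cycle_free.
  exact: upper_bound_containers.
- split; first exact: upper_bound_sprinkle.
  exact: lower_bound_empty.
- exact: zero_threshold_dense.
Qed.
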